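(* Let $q\ge 2$ be an integer and let $0<\beta<\beta_s(q)$. There exists a constant $c(\beta,q)>0$ such that the systematic scan dynamics for the $q$-state mean-field ferromagnetic Potts model on $n$ vertices exhibits cutoff at mixing time $T_{\mathrm{mix}}=c(\beta,q)\log n+\Theta(1)$. That is: for every fixed $\varepsilon\in(0,1)$ there is $\kappa(\varepsilon)$, independent of $n$, such that for all sufficiently large $n$ $$c(\beta,q)\log n-\kappa(\varepsilon)\;\le\; T_{\mathrm{mix}}(\varepsilon)\;\le\; c(\beta,q)\log n+\kappa(\varepsilon),$$ and in particular $T_{\mathrm{mix}}(\varepsilon)-T_{\mathrm{mix}}(1-\varepsilon)=o(T_{\mathrm{mix}})$ as $n\to\infty$ for every fixed $\varepsilon\in(0,1)$.
   Context: Let $V=\{1,\dots,n\}$, $Q=\{1,\dots,q\}$ and $\Sigma_n=Q^V$. The mean-field ferromagnetic Potts model with parameter $\beta>0$ is the probability distribution on $\Sigma_n$ given by $$\mu(\sigma)=\frac{1}{Z_{\beta,n}}\exp\Big\{\frac{\beta}{n}\sum_{\{u,v\}\subseteq V,\,u\ne v}\mathbf 1\big(\sigma(u)=\sigma(v)\big)\Big\},$$ where $Z_{\beta,n}$ is the normalizing constant. Systematic scan dynamics: fix an arbitrary ordering of $V$. A (heat-bath) site update at vertex $v$ in configuration $\sigma$ replaces $\sigma(v)$ by a spin sampled from the conditional distribution $\mu(\cdot\mid\sigma(V\setminus\{v\}))$ of the spin at $v$ given the spins of all other vertices. One step of the Markov chain (a full scan) performs one site update at each of the $n$ vertices, in the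 fixed order. Let $P$ be the transition matrix of one full scan on $\Sigma_n$. Define $$T_{\mathrm{mix}}(\varepsilon)=\min\Big\{t\in\mathbb Z_{\ge0}:\max_{\sigma\in\Sigma_n}\|P^t(\sigma,\cdot)-\mu\|_{\mathrm{TV}}\le\varepsilon\Big\},\qquad T_{\mathrm{mix}}=T_{\mathrm{mix}}(1/4).$$ The threshold $\beta_s=\beta_s(q)$ is $$\beta_s=\sup\{\beta>0: G_\beta(x)-x\ne0\ \ \forall x\in(1/q,1)\},\qquad G_\beta(x)=\frac{e^{\beta x}}{e^{\beta x}+(q-1)e^{\beta\frac{1-x}{q-1}}}.$$ *)

(* Defs.v *)
From HB Require Import structures.
From mathcomp Require Import all_boot all_order all_fingroup all_algebra.
From mathcomp Require Import all_classical all_reals all_analysis.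

Set Implicit Arguments.
Unset Strict Implicit.
Unset Printing Implicit Defensive.

Import Order.TTheory GRing.Theory Num.Theory.
Import numFieldNormedType.Exports.
Local Open Scope ring_scope.

Section FiniteChains.
Variables (R : realType) (T : finType).

Definition prob (p : T -> R) (A : {set T}) : R := \sum_(x in A) p x.

Definition cond_prob (p : T -> R) (A B : {set T}) : R :=
  prob p (A :&: B)%SET / prob p B.

Definition tv_dist (p r : T -> R) : R := 2^-1 * \sum_(x : T) `|p x - r x|.

(* Matrices over T are indexed by ordinals through [enum_rank]. *)
Definition kernel_mx (K : T -> T -> R) : 'M[R]_#|T| :=
  \matrix_(i, j) K (enum_val i) (enum_val j).

Definition mx_kernel (P : 'M[R]_#|T|) (x y : T) : R :=
  P (enum_rank x) (enum_rank y).

(* The base value 0 is harmless because total variation is nonnegative. *)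
Definition worst_tv (P : 'M[R]_#|T|) (pi : T -> R) (t : nat) : R :=
  \big[Num.max/0]_(x : T) tv_dist (mx_kernel (P ^+ t) x) pi.

(* Least t with worst_tv at most eps, or +oo if there is none. *)
Definition mixing_time (P : 'M[R]_#|T|) (pi : T -> R) (eps : R) : \bar R :=
  match pselect (exists t, worst_tv P pi t <= eps) with
  | left ex_t => ((ex_minn ex_t)%:R)%:E
  | right _ => +oo%E
  end.

End FiniteChains.

Definition config (n q : nat) := {ffun 'I_n -> 'I_q}.

Section MeanFieldPotts.
Variables (R : realType) (n q : nat) (beta : R).

Definition potts_weight (s : config n q) : R :=
  expR (beta / n%:R * \sum_(u < n) \sum_(v < n | (u < v)%N) (s u == s v)%:R).

Definition potts_Z : R := \sum_(s : config n q) potts_weight s.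

Definition potts (s : config n q) : R := potts_weight s / potts_Z.

Definition agree_off (v : 'I_n) (s : config n q) : {set config n q} :=
  [set t : config n q | [forall u, (u != v) ==> (t u == s u)]].

Definition site_update (v : 'I_n) (s t : config n q) : R :=
  if t \in agree_off v s
  then cond_prob potts [set r : config n q | r v == t v] (agree_off v s)
  else 0.

(* The site o 0 is updated first: matrices act on row vectors, so the leftmost
   factor of the product is the first update. *)
Definition scan_mx (o : 'S_n) : 'M[R]_#|config n q| :=
  \prod_(i < n) kernel_mx (site_update (o i)).

Definition scan_tmix (o : 'S_n) (eps : R) : \bar R :=
  mixing_time (scan_mx o) potts eps.

End MeanFieldPotts.

Definition potts_G (R : realType) (q : nat) (beta x : R) : R :=
  expR (beta * x) /
  (expR (beta * x) + (q%:R - 1) * expR (beta * ((1 - x) / (q%:R - 1)))).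

(* For 2 <= q this set is nonempty and bounded above, so [sup] does not take
   its default value. *)
Definition beta_s (R : realType) (q : nat) : R :=
  sup [set beta : R | 0 < beta /\
    forall x : R, q%:R^-1 < x < 1 -> potts_G q beta x - x != 0]%classic.

(* Main.v *)
(** Read one update per unit of time and put a = beta / q. A chain is encoded by
    the list of all spins produced so far; the next spin has a softmax law in the
    counts of the last n - 1 spins. Near equilibrium this is a delayed linear
    recursion z_t = (a / n) (z_(t-1) + ... + z_(t-n+1)), whose decay rate per scan
    is lambda = exp (- gam), with gam > 0 the root of a (exp gam - 1) = gam. Hence
    c = 1 / (2 gam): deviations of order n shrink to order sqrt n in c log n scans.

    For beta < beta_s, Hoeffding's inequality and the same type of recursion force
    the spin proportions to equilibrium at some exponential rate, with
    overwhelming probability. The nonlinear errors are then summable over scans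
    and only cost constant factors. Upper bound: in the maximal coupling the
    number of disagreements obeys the linear recursion, so it is at most sqrt n
    times a small constant after c log n + O(1) scans, and then the laws of one
    further full scan are close in chi-square. Lower bound: the positive eigenfunction
    Phi of the linear recursion is, from a slightly biased random start, a large
    multiple of sqrt n with fluctuations of order sqrt n at time c log n - O(1),
    whereas it is of order sqrt n at equilibrium. *)

Require Import Defs.
From HB Require Import structures.
From mathcomp Require Import all_boot all_order all_fingroup all_algebra.
From mathcomp Require Import all_classical all_reals all_analysis.
From mathcomp Require Import ring lra zify.

Set Implicit Arguments.
Unset Strict Implicit.
Unset Printing Implicit Defensive.

Import Order.TTheory GRing.Theory Num.Theory.
Import numFieldNormedType.Exports.
Local Open Scope ring_scope.

(** * Histories and compensated sums *)

(** Three obstacles shape the proof. The contraction available up to [beta_s] is one-sided: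
    convexity bounds the probability of a spin from above by a scalar map, so only positive parts of
    deviations contract; lower deviations are recovered because all deviations sum to zero. The
    resulting rate [gr] need not be sharp. It only has to make the nonlinear corrections summable;
    the sharp rate [gam] comes from the exact slope [beta / q] at equilibrium. No event is ever
    conditioned on. Each pointwise estimate carries an additive term [bad], whose expectation is at
    most [1 / n] over the whole time horizon, so it enters the recursions as a bounded source. In
    the lower bound, a start with a macroscopic bias produces a nonlinear drift of the same order as
    the signal. With bias [d], the signal after [k] scans is of order [d * n * expR (- gam * k)] and
    the nonlinear error of order [d ^ 2 * n * expR (- gam * k)]; a small fixed [d] separates them,
    provided that the constants are chosen before [d]. Hence the uniformity in [d0] of the
    estimates. *)

Lemma sqr_le1 (R : realDomainType) (x : R) : `|x| <= 1 -> x ^+ 2 <= 1.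
Proof. by move=> x1; rewrite -(real_normK (num_real x)) exprn_ile1. Qed.

(** Squaring the tangent bound [1 - x / 2 <= expR (- (x / 2))] turns the claim into a polynomial
    inequality on [|x| <= 1 / 3]. *)
Lemma expR_le_quad (R : realType) (x : R) : `|x| <= 3^-1 -> expR x <= 1 + x + x ^+ 2.
Proof.
rewrite ler_norml => /andP[x1 x2].
have h2 : 0 < 1 - x / 2 by lra.
have e1 : 1 - x / 2 <= expR (- (x / 2)) by have := expR_ge1Dx (- (x / 2)); lra.
have e2 : (1 - x / 2) ^+ 2 * expR x <= 1.
  have -> : expR x = (expR (- (x / 2)) ^+ 2)^-1.
    by rewrite expr2 -expRD -expRN; congr expR; lra.
  rewrite ler_pdivrMr ?exprn_gt0 ?expR_gt0 // mul1r.
  by rewrite lerXn2r ?nnegrE ?expR_ge0 // ltW.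
have h3 : 1 <= (1 - x / 2) ^+ 2 * (1 + x + x ^+ 2).
  rewrite -subr_ge0.
  have -> : (1 - x / 2) ^+ 2 * (1 + x + x ^+ 2) - 1 = x ^+ 2 * ((1 - 3 * x + x ^+ 2) / 4) by field.
  apply: mulr_ge0; first exact: sqr_ge0.
  nra.
by rewrite -(ler_pM2l (exprn_gt0 2 h2)) (le_trans e2).
Qed.

Section HistoryProcess.
Variables (R : realType) (T : finType).
Implicit Types (K : seq T -> T -> R) (f g : seq T -> R) (h : seq T).

Definition stochastic K :=
  (forall h x, 0 <= K h x) /\ (forall h, \sum_x K h x = 1).

Definition step K f h : R := \sum_x K h x * f (x :: h).

(* Expectation over the histories of length [t] generated by [K] from the empty
   history; the most recent value is the head of the list. *)
Fixpoint Ex K t f : R := if t is t'.+1 then Ex K t' (step K f) else f [::].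

Definition after K h (l : seq T) := K (l ++ h).

Lemma stochastic_after K h : stochastic K -> stochastic (after K h).
Proof. by case=> K0 K1; split=> *; [exact: K0|exact: K1]. Qed.

Lemma Ex_ext K t f g :
  (forall h, size h = t -> f h = g h) -> Ex K t f = Ex K t g.
Proof.
elim: t f g => [|t IH] f g fg /=; first exact: fg.
by apply: IH => h sh; apply: eq_bigr => x _; rewrite fg //= sh.
Qed.

Lemma Ex_kernel_ext K K' t f :
  (forall h, (size h < t)%N -> K h =1 K' h) -> Ex K t f = Ex K' t f.
Proof.
elim: t f => [//|t IH] f KK' /=; rewrite IH; last by move=> h ht; apply: KK'; lia.
by apply: Ex_ext => h sh; apply: eq_bigr => x _; rewrite KK' // sh.
Qed.

Lemma Ex_le K t f g : stochastic K ->
  (forall h, size h = t -> f h <= g h) -> Ex K t f <= Ex K t g.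
Proof.
move=> [K0 _]; elim: t f g => [|t IH] f g fg /=; first exact: fg.
by apply: IH => h sh; apply: ler_sum => x _; rewrite ler_wpM2l // fg //= sh.
Qed.

Lemma ExD K t f g : Ex K t (fun h => f h + g h) = Ex K t f + Ex K t g.
Proof.
elim: t f g => [//|t IH] f g /=; rewrite -IH; apply: Ex_ext => h _.
by rewrite /step -big_split /=; apply: eq_bigr => x _; rewrite mulrDr.
Qed.

Lemma ExZ K t c f : Ex K t (fun h => c * f h) = c * Ex K t f.
Proof.
elim: t f => [//|t IH] f /=; rewrite -IH; apply: Ex_ext => h _.
by rewrite /step mulr_sumr; apply: eq_bigr => x _; rewrite mulrCA.
Qed.

Lemma Ex_cst K t c : stochastic K -> Ex K t (fun=> c) = c.
Proof.
move=> [_ K1]; elim: t => [//|t IH] /=; rewrite -{2}IH; apply: Ex_ext => h _.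
by rewrite /step -mulr_suml K1 mul1r.
Qed.

Lemma ExB K t f g : Ex K t (fun h => f h - g h) = Ex K t f - Ex K t g.
Proof.
rewrite -[- Ex K t g]mulN1r -ExZ -ExD.
by apply: Ex_ext => h _; rewrite mulN1r.
Qed.

Lemma Ex_sum (I : Type) (r : seq I) K t (f : I -> seq T -> R) :
  Ex K t (fun h => \sum_(i <- r) f i h) = \sum_(i <- r) Ex K t (f i).
Proof.
elim: r => [|i r IH].
  rewrite big_nil -[RHS](mul0r (Ex K t (fun=> 0))) -ExZ.
  by apply: Ex_ext => h _; rewrite big_nil mul0r.
by rewrite big_cons -IH -ExD; apply: Ex_ext => h _; rewrite big_cons.
Qed.

Lemma Ex_ge0 K t f : stochastic K ->
  (forall h, size h = t -> 0 <= f h) -> 0 <= Ex K t f.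
Proof. by move=> sK f0; rewrite -(Ex_cst t 0 sK); exact: Ex_le. Qed.

Lemma Ex_norm K t f : stochastic K -> `|Ex K t f| <= Ex K t (fun h => `|f h|).
Proof.
move=> sK; rewrite ler_norml -mulN1r -ExZ; apply/andP; split; apply: Ex_le => // h _.
  by rewrite mulN1r lerNl -normrN ler_norm.
exact: ler_norm.
Qed.

Lemma Ex_behead K t f : stochastic K -> Ex K t.+1 (fun h => f (behead h)) = Ex K t f.
Proof.
move=> [_ K1] /=; apply: Ex_ext => h _.
by rewrite /step /= -mulr_suml K1 mul1r.
Qed.

Lemma Ex_drop K i t f : stochastic K -> (i <= t)%N ->
  Ex K t (fun h => f (drop i h)) = Ex K (t - i) f.
Proof.
move=> sK; elim: i t f => [|i IH] t f it.
  by rewrite subn0; apply: Ex_ext => h _; rewrite drop0.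
case: t it => [//|t] it; rewrite subSS -(IH t) // -[RHS]Ex_behead //.
Qed.

Lemma Ex_add K s t f :
  Ex K (s + t) f = Ex K s (fun h => Ex (after K h) t (fun l : seq T => f (l ++ h))).
Proof. by elim: t f => [|t IH] f; rewrite ?addn0 // addnS /= IH. Qed.

(** An average never exceeds the maximum. This later replaces a random biased start by one fixed
    configuration. *)
Lemma Ex_exists K t f c : stochastic K -> c <= Ex K t f ->
  exists2 h, size h = t & c <= f h.
Proof.
move=> sK; elim: t f => [|t IH] f /= cf; first by exists [::].
have [h sh ch] := IH _ cf.
have [/existsP[x xc]|/existsPn no] := boolP [exists x, c <= f (x :: h)].
  by exists (x :: h) => //=; rewrite sh.
have: step K f h < c; last by rewrite ltNge ch.
have [K0 K1] := sK.
rewrite -[ltRHS]mul1r -(K1 h) mulr_suml ltNge; apply/negP => le.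
have {}le x : K h x * (c - f (x :: h)) = 0.
  have nn y : true -> 0 <= K h y * (c - f (y :: h)).
    by move=> _; rewrite mulr_ge0 // subr_ge0 ltW // ltNge no.
  apply: (psumr_eq0P nn) => //; apply/eqP; rewrite eq_le sumr_ge0 // andbT.
  under eq_bigr do rewrite mulrBr.
  by rewrite sumrB subr_le0.
have: \sum_x K h x = 0.
  apply: big1 => x _; have /eqP := le x; rewrite mulf_eq0 subr_eq0 => /orP[/eqP//|/eqP e].
  by have := no x; rewrite -e lexx.
by rewrite K1 => /eqP; rewrite oner_eq0.
Qed.

(** A substitute for Cauchy-Schwarz: with [s] of the order of the L2 norm of [f], it loses only a
    constant factor. *)
Lemma Ex_AMGM K t f (s : R) : stochastic K -> 0 < s ->
  Ex K t (fun h => `|f h|) <= 2^-1 * (Ex K t (fun h => f h ^+ 2) / s + s).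
Proof.
move=> sK s0.
have -> : 2^-1 * (Ex K t (fun h => f h ^+ 2) / s + s) =
    Ex K t (fun h => 2^-1 * (s^-1 * f h ^+ 2 + s)).
  by rewrite ExZ ExD ExZ Ex_cst // [s^-1 * _]mulrC.
apply: Ex_le => // h _.
rewrite -(real_normK (num_real (f h))) -subr_ge0; set u := `|f h|.
have -> : 2^-1 * (s^-1 * u ^+ 2 + s) - u = (2^-1 * s^-1) * (u - s) ^+ 2.
  by field; rewrite gt_eqF.
by rewrite mulr_ge0 ?sqr_ge0 // mulr_ge0 ?invr_ge0 // ltW.
Qed.

End HistoryProcess.

(** Lumpability: the image process has kernel [K'] once the fibre sums of [K] depend on the history
    only through its image. Both marginals of the coupling are read off in this way. *)
Lemma Ex_map (R : realType) (T U : finType) (p : T -> U)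
    (K : seq T -> T -> R) (K' : seq U -> U -> R) t (f : seq U -> R) :
  (forall h u, \sum_(x | p x == u) K h x = K' (map p h) u) ->
  Ex K t (fun h => f (map p h)) = Ex K' t f.
Proof.
move=> KK'; elim: t f => [//|t IH] f /=; rewrite -IH; apply: Ex_ext => h _.
rewrite /step (partition_big p xpredT) //=; apply: eq_bigr => u _.
by rewrite -KK' mulr_suml; apply: eq_bigr => x /eqP <-.
Qed.

(** * Martingale sums and their moments *)

Section CompensatedSums.
Variables (R : realType) (T : finType) (K : seq T -> T -> R).
Hypothesis sK : stochastic K.
Variable (e : T -> R).
Implicit Types (v : nat -> R) (h : seq T).

Definition mean h : R := \sum_x K h x * e x.

(** Weights are indexed by age, so a new value shifts them all. The moment bounds below are
    therefore proved by induction on the time with [v] arbitrary. *)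
Definition compsum v h : R :=
  \sum_(i < size h) v i * ((map e h)`_i - mean (drop i.+1 h)).

Lemma compsum_cons v x h :
  compsum v (x :: h) = v 0%N * (e x - mean h) + compsum (fun i => v i.+1) h.
Proof. by rewrite /compsum /= big_ord_recl /= drop0. Qed.

Lemma compsumZ c v h : compsum (fun i => c * v i) h = c * compsum v h.
Proof. by rewrite /compsum mulr_sumr; apply: eq_bigr => i _; rewrite mulrA. Qed.

Lemma step_compsum_sqr v h : (forall x, `|e x| <= 1) ->
  step K (fun h => compsum v h ^+ 2) h <=
  v 0%N ^+ 2 + compsum (fun i => v i.+1) h ^+ 2.
Proof.
move=> e1; have [K0 K1] := sK; set c := compsum _ h; set m := mean h.
have -> : step K (fun h => compsum v h ^+ 2) h =
  v 0%N ^+ 2 * (\sum_x K h x * e x ^+ 2 - m ^+ 2) + c ^+ 2.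
  transitivity (\sum_x (v 0%N ^+ 2 * (K h x * e x ^+ 2)
     + (2 * v 0%N * (c - v 0%N * m)) * (K h x * e x)
     + K h x * (v 0%N * m - c) ^+ 2)).
    by apply: eq_bigr => x _; rewrite compsum_cons -/c -/m; ring.
  rewrite !big_split /= -!mulr_sumr -mulr_suml K1 -/(mean h) -/m; ring.
rewrite lerD2r ler_piMr ?sqr_ge0 // lerBlDr.
apply: (@le_trans _ _ (\sum_x K h x)); last by rewrite K1 lerDl sqr_ge0.
apply: ler_sum => x _; by rewrite ler_piMr ?sqr_le1.
Qed.

Lemma Ex_compsum_sqr v t : (forall x, `|e x| <= 1) ->
  Ex K t (fun h => compsum v h ^+ 2) <= \sum_(i < t) v i ^+ 2.
Proof.
move=> e1; elim: t v => [|t IH] v /=; first by rewrite /compsum !big_ord0 expr0n.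
apply: (@le_trans _ _ (Ex K t (fun h => v 0%N ^+ 2 + compsum (fun i => v i.+1) h ^+ 2))).
  by apply: Ex_le => // h _; exact: step_compsum_sqr.
by rewrite ExD Ex_cst // big_ord_recl lerD2l IH.
Qed.

(** The increments are centred given the past and at most 1/3 in size, so in
    [expR y <= 1 + y + y ^ 2] the linear term averages to zero and each step costs a factor
    [1 + v 0 ^ 2]. *)
Lemma Ex_compsum_exp v t : (forall x, 0 <= e x <= 1) -> (forall i, `|v i| <= 3^-1) ->
  Ex K t (fun h => expR (compsum v h)) <= expR (\sum_(i < t) v i ^+ 2).
Proof.
move=> e1; have [K0 K1] := sK.
have m01 h : 0 <= mean h <= 1.
  apply/andP; split; first by apply: sumr_ge0 => x _; case/andP: (e1 x) => *; rewrite mulr_ge0.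
  by rewrite -(K1 h); apply: ler_sum => x _; rewrite ler_piMr //; case/andP: (e1 x).
elim: t v => [|t IH] v v1 /=; first by rewrite /compsum !big_ord0.
have H h : step K (fun h => expR (compsum v h)) h <=
     expR (v 0%N ^+ 2) * expR (compsum (fun i => v i.+1) h).
  have -> : step K (fun h => expR (compsum v h)) h =
    (\sum_x K h x * expR (v 0%N * (e x - mean h))) * expR (compsum (fun i => v i.+1) h).
    by rewrite mulr_suml; apply: eq_bigr => x _; rewrite compsum_cons expRD mulrA.
  rewrite ler_wpM2r ?expR_ge0 //; set m := mean h.
  apply: (@le_trans _ _ (1 + v 0%N ^+ 2)); last exact: expR_ge1Dx.
  apply: (@le_trans _ _ (\sum_x K h x * (1 + v 0%N * (e x - m) + v 0%N ^+ 2))).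
    apply: ler_sum => x _; rewrite ler_wpM2l //.
    have em : `|e x - m| <= 1.
      by rewrite ler_norml; have := e1 x; have := m01 h; rewrite -/m; lra.
    apply: (le_trans (expR_le_quad _)).
      by rewrite normrM -[3^-1]mulr1 ler_pM.
    by rewrite lerD2l exprMn ler_piMr ?sqr_ge0 // sqr_le1.
  rewrite le_eqVlt; apply/orP; left; apply/eqP.
  transitivity (\sum_x ((1 - v 0%N * m + v 0%N ^+ 2) * K h x + v 0%N * (K h x * e x))).
    by apply: eq_bigr => x _; ring.
  rewrite big_split /= -!mulr_sumr K1 -/(mean h) -/m; ring.
apply: (@le_trans _ _ (Ex K t (fun h => expR (v 0%N ^+ 2) * expR (compsum (fun i => v i.+1) h)))).
  by apply: Ex_le => // h _.
by rewrite ExZ big_ord_recl expRD ler_wpM2l ?expR_ge0 // IH.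
Qed.

Lemma compsum_window m h : (m <= size h)%N ->
  compsum (fun i => (i < m)%:R) h =
  \sum_(x <- take m h) e x - \sum_(i < m) mean (drop i.+1 h).
Proof.
move=> mh; rewrite /compsum.
rewrite (eq_bigr (fun i : 'I_(size h) => if (i < m)%N then (map e h)`_i - mean (drop i.+1 h) else 0)); last first.
  by move=> i _; case: ifP; rewrite ?mul1r ?mul0r.
rewrite -big_mkcond /= -(big_ord_widen_cond _ xpredT (fun i => (map e h)`_i - mean (drop i.+1 h))) //=.
rewrite sumrB; congr (_ - _).
rewrite -[RHS](big_map e xpredT id) map_take (big_nth 0) size_take size_map.
rewrite (_ : (if _ then _ else _) = m); last by case: ltnP mh => //; lia.
by rewrite big_mkord; apply: eq_bigr => i _; rewrite nth_take.
Qed.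

End CompensatedSums.

(** * Likelihood ratios and chi-square distance *)

Section ChangeOfMeasure.
Variables (R : realType) (T : finType) (K K' : seq T -> T -> R).
Hypotheses (sK : stochastic K) (sK' : stochastic K').
Variables (t : nat) (chi : R).
Hypothesis K_gt0 : forall h x, (size h < t)%N -> 0 < K h x.
Hypothesis K_chi : forall h, (size h < t)%N ->
  \sum_x (K' h x - K h x) ^+ 2 / K h x <= chi.

Fixpoint lratio (h : seq T) : R :=
  if h is x :: h' then lratio h' * (K' h' x / K h' x) else 1.

Lemma Ex_lratio s f : (s <= t)%N ->
  Ex K' s f = Ex K s (fun h => f h * lratio h).
Proof.
elim: s f => [|s IH] f st /=; first by rewrite mulr1.
rewrite IH 1?ltnW //; apply: Ex_ext => h sh.
rewrite /step mulr_suml; apply: eq_bigr => x _ /=.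
have : K h x != 0 by rewrite gt_eqF // K_gt0 // sh.
by move=> k0; field.
Qed.

(** Chi-square distance tensorises: given the past, the next factor of the ratio has second moment
    one plus the chi-square distance of that step. *)
Lemma Ex_lratio_sqr s : (s <= t)%N ->
  Ex K s (fun h => lratio h ^+ 2) <= (1 + chi) ^+ s.
Proof.
elim: s => [|s IH] st /=; first by rewrite expr1n expr0.
apply: (@le_trans _ _ (Ex K s (fun h => (1 + chi) * lratio h ^+ 2))); last first.
  rewrite ExZ exprS ler_wpM2l ?IH 1?ltnW //.
  apply: addr_ge0 => //; apply: le_trans (K_chi (h := [::]) _); last by rewrite /=; lia.
  by apply: sumr_ge0 => x _; rewrite divr_ge0 ?sqr_ge0 // sK.1.
apply: Ex_le => // h sh.
have := K_chi (h := h); rewrite sh => /(_ st) H.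
rewrite (_ : step _ _ _ = (1 + \sum_x (K' h x - K h x) ^+ 2 / K h x) * lratio h ^+ 2).
  by rewrite ler_wpM2r ?sqr_ge0 // lerD2l.
rewrite [LHS](_ : _ = (\sum_x ((K' h x - K h x) ^+ 2 / K h x + 2 * K' h x - K h x)) * lratio h ^+ 2).
  rewrite sumrB big_split /= -mulr_sumr sK.2 sK'.2; ring.
rewrite /step mulr_suml; apply: eq_bigr => x _ /=.
have : K h x != 0 by rewrite gt_eqF // K_gt0 // sh.
by move=> k0; field.
Qed.

Lemma Ex_diff_le f (s : R) : (forall h, `|f h| <= 1) -> 0 < s ->
  `|Ex K' t f - Ex K t f| <= 2^-1 * (((1 + chi) ^+ t - 1) / s + s).
Proof.
move=> f1 s0; rewrite Ex_lratio // -ExB.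
apply: (le_trans (Ex_norm _ _ sK)).
apply: (@le_trans _ _ (Ex K t (fun h => `|lratio h - 1|))).
  apply: Ex_le => // h _; rewrite -{2}[f h]mulr1 -mulrBr normrM.
  by rewrite ler_piMl.
apply: (le_trans (Ex_AMGM _ _ sK s0)).
rewrite ler_pM2l ?invr_gt0 // lerD2r ler_pM2r ?invr_gt0 //.
have L1 : Ex K t lratio = 1.
  have := Ex_lratio (fun=> 1) (leqnn t); rewrite Ex_cst // => ->.
  by apply: Ex_ext => h _; rewrite mul1r.
rewrite (_ : Ex K t _ = Ex K t (fun h => lratio h ^+ 2) - 1).
  by rewrite lerD2r Ex_lratio_sqr.
rewrite (@Ex_ext _ _ _ _ _ (fun h => (lratio h ^+ 2 + (-2) * lratio h) + 1)); last by move=> h _; ring.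
rewrite !ExD ExZ L1 Ex_cst //; ring.
Qed.

End ChangeOfMeasure.

(** * The softmax map and the threshold *)

Section Softmax.
Variables (R : realType) (I : finType).
Implicit Types (u w : I -> R).

Definition softmax u (k : I) : R := expR (u k) / \sum_j expR (u j).

Lemma sum_expR_gt0 u (k : I) : 0 < \sum_j expR (u j).
Proof.
rewrite (bigD1 k) //= ltr_wpDr ?expR_gt0 //.
by apply: sumr_ge0 => *; exact: expR_ge0.
Qed.

Lemma softmax_gt0 u k : 0 < softmax u k.
Proof. by rewrite divr_gt0 ?expR_gt0 // (sum_expR_gt0 _ k). Qed.

Lemma softmax_sum1 u : (0 < #|I|)%N -> \sum_k softmax u k = 1.
Proof.
case/card_gt0P => k _; rewrite -mulr_suml mulfV // gt_eqF //.
exact: (sum_expR_gt0 _ k).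
Qed.

Lemma softmax_shift u (c : R) : softmax (fun k => u k + c) =1 softmax u.
Proof.
move=> k; rewrite /softmax.
under [X in _ / X]eq_bigr do rewrite expRD.
rewrite expRD -mulr_suml -mulf_div divff ?mulr1 //.
by rewrite gt_eqF ?expR_gt0.
Qed.

Lemma eq_softmax u w : u =1 w -> softmax u =1 softmax w.
Proof. by move=> uw k; rewrite /softmax uw; under eq_bigr do rewrite uw. Qed.

Lemma natr_card : #|I|%:R = \sum_(k : I) 1 :> R.
Proof. by rewrite -sum1_card natr_sum; apply: eq_bigl. Qed.

Lemma sum_expR_ge u : \sum_k u k = 0 -> #|I|%:R <= \sum_k expR (u k).
Proof.
move=> u0; rewrite natr_card -[leLHS]addr0 -[X in _ + X]u0 -big_split /=.
by apply: ler_sum => k _; exact: expR_ge1Dx.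
Qed.

Lemma expR_sub1_le (x b : R) : `|x| <= b -> `|expR x - 1| <= `|x| * expR b.
Proof.
move=> xb; have b0 : 1 <= expR b by rewrite -expR0 ler_expR (le_trans _ xb).
have := expR_ge1Dx x; have [x0|x0] := leP 0 x => ex.
  rewrite ger0_norm in xb => //; rewrite !ger0_norm //; last lra.
  apply: (@le_trans _ _ (x * expR x)); last by rewrite ler_wpM2l // ler_expR.
  have := expR_ge1Dx (- x); rewrite expRN => /(ler_wpM2l (expR_ge0 x)).
  rewrite mulfV ?gt_eqF ?expR_gt0 //; lra.
have e1 : expR x <= 1 by rewrite -expR0 ler_expR ltW.
rewrite ler0_norm ?subr_le0 // ltr0_norm //.
apply: (@le_trans _ _ (- x)); first lra.
by rewrite ler_peMr // oppr_ge0 ltW.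
Qed.

Lemma expR_diff_le (x y m b : R) : `|x| <= m -> `|y| <= m -> m <= b ->
  `|expR x - expR y - (x - y)| <= m * expR b * `|x - y|.
Proof.
wlog xy : x y / y <= x.
  move=> W xm ym mb; have [yx|/ltW xy] := leP y x; first exact: W.
  rewrite -normrN distrC [X in `|X|](_ : _ = expR y - expR x - (y - x)); first exact: W.
  ring.
move=> xm ym mb.
have d0 : 0 <= x - y by rewrite subr_ge0.
have X := expR_sub1_le (le_trans xm mb); have Y := expR_sub1_le (le_trans ym mb).
have {X}X := le_trans X (ler_wpM2r (expR_ge0 b) xm).
have {Y}Y := le_trans Y (ler_wpM2r (expR_ge0 b) ym).
move: X Y; rewrite !ler_norml [`|x - y|]ger0_norm // => /andP[_ X] /andP[Y _].
have h1 : expR x - expR y <= expR x * (x - y).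
  have := ler_wpM2l (expR_ge0 x) (expR_ge1Dx (y - x)).
  rewrite -expRD (_ : x + (y - x) = y); [lra|ring].
have h2 : expR y * (x - y) <= expR x - expR y.
  have := ler_wpM2l (expR_ge0 y) (expR_ge1Dx (x - y)).
  rewrite -expRD (_ : y + (x - y) = x); [lra|ring].
have := ler_wpM2r d0 X; have := ler_wpM2r d0 Y.
rewrite !mulrBl !mul1r => Y' X'; apply/andP; split; lra.
Qed.

Section Expansions.
Variables (beta M : R) (u w : I -> R).
Hypotheses (beta0 : 0 <= beta) (M01 : 0 <= M <= 1).
Hypotheses (u0 : \sum_k u k = 0) (w0 : \sum_k w k = 0).
Hypotheses (uM : forall k, `|u k| <= M) (wM : forall k, `|w k| <= M).

Let bM k : `|beta * u k| <= beta * M.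
Proof. by rewrite normrM ger0_norm // ler_wpM2l. Qed.
Let bM' k : `|beta * w k| <= beta * M.
Proof. by rewrite normrM ger0_norm // ler_wpM2l. Qed.
Let bMb : beta * M <= beta.
Proof. by rewrite ler_piMr //; case/andP: M01. Qed.

(** On zero-sum vectors the derivative of softmax at 0 is multiplication by [beta / #|I|]. The error
    is relative to [|u i - u j|] rather than of order [M ^ 2], so that it can be absorbed into the
    coefficient of a linear recursion. *)
Lemma softmax_sub_le i j :
  `|softmax (fun k => beta * u k) i - softmax (fun k => beta * u k) j
    - beta / #|I|%:R * (u i - u j)|
  <= 2 * beta ^+ 2 * expR beta / #|I|%:R * M * `|u i - u j|.
Proof.
rewrite /softmax -mulrBl.
set Z := \sum_ _ _; set q := #|I|%:R.
have q0 : 0 < q by rewrite ltr0n; apply/card_gt0P; exists i.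
have Zq : q <= Z by apply: sum_expR_ge; rewrite -mulr_sumr u0 mulr0.
have Z0 := lt_le_trans q0 Zq.
set m := beta * M * expR beta.
have ZB : `|q - Z| <= q * m.
  have -> : q - Z = \sum_k (1 - expR (beta * u k)).
    by rewrite sumrB /q natr_card.
  apply: (le_trans (ler_norm_sum _ _ _)).
  apply: (@le_trans _ _ (\sum_(k : I) m)); last by rewrite sumr_const mulr_natl.
  apply: ler_sum => k _; rewrite distrC.
  apply: (le_trans (expR_sub1_le (le_trans (bM k) bMb))).
  by rewrite ler_wpM2r ?expR_ge0.
have rB := expR_diff_le (bM i) (bM j) bMb.
rewrite -mulrBr normrM (ger0_norm beta0) -/m in rB.
set r := expR _ - expR _ - _ in rB.
set d := u i - u j in rB *.
have -> : (expR (beta * u i) - expR (beta * u j)) / Z - beta / q * d =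
   r / Z + beta * d * ((q - Z) / (q * Z)).
  rewrite /r -/d; field; by rewrite !gt_eqF.
apply: (le_trans (ler_normD _ _)).
have m0 : 0 <= m by rewrite !mulr_ge0 ?expR_ge0 //; case/andP: M01.
have A : `|r / Z| <= m * (beta * `|d|) / q.
  rewrite normrM normfV [`|Z|]gtr0_norm //.
  by apply: ler_pM => //; rewrite ?invr_ge0 ?(ltW Z0) // lef_pV2.
have B : `|beta * d * ((q - Z) / (q * Z))| <= beta * `|d| * (m / q).
  rewrite 2!normrM (ger0_norm beta0) ler_wpM2l ?mulr_ge0 //.
  rewrite normrM normfV [`|q * Z|]gtr0_norm ?mulr_gt0 //.
  rewrite ler_pdivrMr ?mulr_gt0 //; apply: (le_trans ZB).
  rewrite (_ : m / q * (q * Z) = m * Z); last by field; rewrite gt_eqF.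
  by rewrite mulrC ler_wpM2l.
apply: (le_trans (lerD A B)); rewrite le_eqVlt; apply/orP; left; apply/eqP.
by rewrite /m; field; rewrite gt_eqF.
Qed.

(** The zero sums cancel the linear terms of [Z - Z'], so the l1 Lipschitz constant tends to the
    sharp slope [beta / #|I|] as [M] tends to 0. *)
Lemma softmax_l1_le :
  \sum_k `|softmax (fun k => beta * u k) k - softmax (fun k => beta * w k) k|
  <= (beta / #|I|%:R + 2 * beta ^+ 2 * expR beta / #|I|%:R * M) *
     \sum_k `|u k - w k|.
Proof.
have [I0|/card_gt0P[i0 _]] := posnP #|I|.
  by rewrite !big_pred0 ?mulr0 // => i; have := fintype0 i; rewrite I0 => /(_ erefl).
set Z := \sum_j expR (beta * u j); set Z' := \sum_j expR (beta * w j); set q := #|I|%:R.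
have q0 : 0 < q by rewrite ltr0n; apply/card_gt0P; exists i0.
have Zq : q <= Z by apply: sum_expR_ge; rewrite -mulr_sumr u0 mulr0.
have Zq' : q <= Z' by apply: sum_expR_ge; rewrite -mulr_sumr w0 mulr0.
have Z0 := lt_le_trans q0 Zq; have Z0' := lt_le_trans q0 Zq'.
set m := beta * M * expR beta.
have m0 : 0 <= m by rewrite !mulr_ge0 ?expR_ge0 //; case/andP: M01.
pose r k := expR (beta * u k) - expR (beta * w k) - (beta * u k - beta * w k).
set D := \sum_k `|u k - w k|.
have rB k : `|r k| <= m * beta * `|u k - w k|.
  have := expR_diff_le (bM k) (bM' k) bMb.
  by rewrite -/(r k) -mulrBr normrM (ger0_norm beta0) -/m mulrA.
have ZB : `|Z - Z'| <= m * beta * D.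
  have -> : Z - Z' = \sum_k r k.
    by rewrite /r !sumrB -!mulr_sumr u0 w0 mulr0 !subr0.
  apply: (le_trans (ler_norm_sum _ _ _)); rewrite mulr_sumr.
  by apply: ler_sum => k _.
apply: (@le_trans _ _ (\sum_k ((m * beta + beta) * `|u k - w k| / q +
   softmax (fun k => beta * w k) k * (m * beta * D / q)))).
  apply: ler_sum => k _.
  rewrite (_ : _ - _ = (expR (beta * u k) - expR (beta * w k)) / Z -
    softmax (fun k => beta * w k) k * ((Z - Z') / Z)); last first.
    by rewrite /softmax -/Z -/Z'; field; rewrite !gt_eqF.
  apply: (le_trans (ler_normB _ _)); apply: lerD.
    rewrite normrM normfV [`|Z|]gtr0_norm //; apply: ler_pM => //.
      by rewrite invr_ge0 ltW.
      rewrite (_ : _ - _ = r k + beta * (u k - w k)); last by rewrite /r; ring.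
      apply: (le_trans (ler_normD _ _)).
      by rewrite mulrDl lerD // normrM ger0_norm.
    by rewrite lef_pV2.
  rewrite normrM (gtr0_norm (softmax_gt0 _ _)) ler_wpM2l ?(ltW (softmax_gt0 _ _)) //.
  rewrite normrM normfV [`|Z|]gtr0_norm //; apply: ler_pM => //.
    by rewrite invr_ge0 ltW.
  by rewrite lef_pV2.
rewrite big_split /= -[X in _ + X]mulr_suml softmax_sum1; last by apply/card_gt0P; exists i0.
rewrite mul1r -mulr_suml -mulr_sumr.
rewrite -/D le_eqVlt; apply/orP; left; apply/eqP.
by rewrite /m; field; rewrite gt_eqF.
Qed.

Lemma softmax_ge i : expR (- 2 * beta) / #|I|%:R <= softmax (fun k => beta * u k) i.
Proof.
have q0 : 0 < #|I|%:R :> R by rewrite ltr0n; apply/card_gt0P; exists i.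
rewrite /softmax (_ : - 2 * beta = - beta - beta); last ring.
rewrite expRB -mulrA -invfM; apply: ler_pM; rewrite ?expR_ge0 // ?invr_ge0 ?mulr_ge0 ?expR_ge0 //.
  by rewrite ler_expR; have := le_trans (bM i) bMb; rewrite ler_norml => /andP[].
rewrite lef_pV2 ?posrE ?mulr_gt0 ?expR_gt0 ?(sum_expR_gt0 _ i) //.
rewrite natr_card mulr_sumr; apply: ler_sum => k _; rewrite mulr1.
by rewrite ler_expR (le_trans (ler_norm _)) // (le_trans (bM k)).
Qed.

End Expansions.

End Softmax.

(** * The scalar mean-field map and the threshold *)

Section SpinProb.
Variables (R : realType) (q : nat).
Hypothesis q2 : (2 <= q)%N.
Implicit Types (x y z : R).

Let Q1 : (1 : R) <= q%:R - 1.
Proof. by have : 2 <= q%:R :> R; [rewrite ler_nat|lra]. Qed.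

Let q1n0 : q%:R - 1 != 0 :> R.
Proof. by rewrite gt_eqF //; have := Q1; lra. Qed.

Let qn0 : q%:R != 0 :> R.
Proof. by rewrite gt_eqF //; have := Q1; lra. Qed.

(** This is [potts_G] in a centred variable: the softmax weight of a coordinate [z] when the [q - 1]
    others all equal [- z / (q - 1)]. *)
Definition spin_prob z : R :=
  (1 + (q%:R - 1) * expR (- (q%:R / (q%:R - 1) * z)))^-1.

Lemma potts_GE (beta x : R) : potts_G q beta x = spin_prob (beta * (x - q%:R^-1)).
Proof.
rewrite /potts_G /spin_prob.
have -> : beta * ((1 - x) / (q%:R - 1)) =
    beta * x - q%:R / (q%:R - 1) * (beta * (x - q%:R^-1)).
  by field; rewrite q1n0 qn0.
rewrite expRD; set u := expR (beta * x); set e := expR (- _).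
have u0 : u != 0 by rewrite gt_eqF ?expR_gt0.
have e0 : 0 < e by rewrite expR_gt0.
have d0 : 1 + (q%:R - 1) * e != 0 by rewrite gt_eqF // ltr_pwDl // mulr_ge0 ?ltW //; have := Q1; lra.
have d1 : u + (q%:R - 1) * (u * e) != 0.
  by rewrite (_ : _ + _ = u * (1 + (q%:R - 1) * e)) ?mulf_neq0 //; ring.
by field; rewrite d0 d1.
Qed.

(** Jensen's inequality: for zero sum and fixed [u k], the rest of the partition sum is smallest
    when the other coordinates coincide. This reduces the [q]-dimensional dynamics to the scalar map
    that defines [beta_s]. *)
Lemma softmax_le_spin (I : finType) (u : I -> R) k : #|I| = q ->
  \sum_j u j = 0 -> softmax u k <= spin_prob (u k).
Proof.
move=> Iq u0; set v := - (u k / (q%:R - 1)).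
have card1 : (q%:R - 1 : R) = \sum_(j | j != k) 1.
  by rewrite -Iq natr_card (bigD1 k) //= addrAC subrr add0r.
have uk : \sum_(j | j != k) u j = - u k.
  by move: u0; rewrite (bigD1 k) //= addrC => /eqP; rewrite addr_eq0 => /eqP.
have H : (q%:R - 1) * expR v <= \sum_(j | j != k) expR (u j).
  have : \sum_(j | j != k) expR v * (1 + (u j - v)) <= \sum_(j | j != k) expR (u j).
    apply: ler_sum => j _; rewrite [leRHS](_ : _ = expR v * expR (u j - v)).
      by rewrite ler_wpM2l ?expR_ge0 // expR_ge1Dx.
    by rewrite -expRD; congr expR; ring.
  apply: le_trans; rewrite -mulr_sumr mulrC ler_wpM2l ?expR_ge0 //.
  rewrite big_split /= -card1 sumrB uk -[v in leRHS]mulr1 -mulr_sumr -card1 /v.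
  by rewrite mulNr mulrVK ?unitfE // subrr addr0.
rewrite /softmax /spin_prob (bigD1 k) //=.
have -> : - (q%:R / (q%:R - 1) * u k) = v - u k by rewrite /v; field.
rewrite expRD expRN; set e := expR (u k).
have e0 : 0 < e := expR_gt0 _.
have v0 : 0 < expR v := expR_gt0 _.
have s0 : 0 <= \sum_(j | j != k) expR (u j) by apply: sumr_ge0 => *; exact: expR_ge0.
rewrite ler_pdivrMr; last by rewrite ltr_pwDl.
rewrite mulrC ler_pdivlMr; last by rewrite ltr_pwDl // !mulr_ge0 ?invr_ge0 ?ltW //; have := Q1; lra.
rewrite mulrDr mulr1 lerD2l mulrCA [X in _ * X]mulrC !mulrA.
by rewrite -[_ * _ * e]mulrA mulVf ?mulr1 ?gt_eqF.
Qed.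

Lemma spin_prob_le0 z : z <= 0 -> spin_prob z <= q%:R^-1.
Proof.
move=> z0; rewrite /spin_prob lef_pV2 ?posrE.
- rewrite -[leLHS](subrK 1) addrC lerD2l -[leLHS]mulr1 ler_wpM2l //; first (have := Q1; lra).
  rewrite -[leLHS]expR0 ler_expR oppr_ge0 mulr_ge0_le0 // divr_ge0 //; have := Q1; lra.
- by rewrite ltr_pwDl // mulr_ge0 ?expR_ge0 //; have := Q1; lra.
- have := Q1; lra.
Qed.

Lemma spin_prob_lt1 z : spin_prob z < 1.
Proof.
rewrite /spin_prob invf_lt1; last by rewrite ltr_pwDl // mulr_ge0 ?expR_ge0 //; have := Q1; lra.
by rewrite ltrDl mulr_gt0 ?expR_gt0 //; have := Q1; lra.
Qed.

Lemma spin_prob_ge z : let u := q%:R / (q%:R - 1) * z in 0 <= u ->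
  z / q%:R * (1 - u) <= spin_prob z - q%:R^-1.
Proof.
move=> u u0; rewrite /spin_prob -/u.
have zE : z = (q%:R - 1) / q%:R * u by rewrite /u; field; rewrite q1n0 qn0.
clearbody u; rewrite zE => {zE}.
set e := expR _; have e0 : 0 < e by exact: expR_gt0.
have e1 : e * (1 + u) <= 1.
  by rewrite /e expRN mulrC ler_pdivrMr ?expR_gt0 // mul1r expR_ge1Dx.
have e2 : e <= 1 by have := Q1; nra.
have D0 : 0 < 1 + (q%:R - 1) * e by have := Q1; nra.
have Dq : 1 + (q%:R - 1) * e <= q%:R by have := Q1; nra.
have -> : (1 + (q%:R - 1) * e)^-1 - q%:R^-1 =
  (q%:R - 1) / q%:R * (1 - e) / (1 + (q%:R - 1) * e).
  by field; rewrite qn0 gt_eqF.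
rewrite ler_pdivlMr // -!mulrA ler_wpM2l //; first (have := Q1; lra).
rewrite ler_wpM2l ?invr_ge0 //.
have e3 : u * (1 - u) <= 1 - e.
  have : (1 - e) * (1 + u) >= u by have := Q1; nra.
  have : u * (1 - u) * (1 + u) <= u by have := Q1; nra.
  move=> A B; rewrite -(ler_pM2r (_ : 0 < 1 + u)); have := Q1; lra.
have A : q%:R^-1 * (1 + (q%:R - 1) * e) <= 1.
  by rewrite mulrC ler_pdivrMr ?mul1r //; have := Q1; lra.
have B : 0 <= q%:R^-1 * (1 + (q%:R - 1) * e) by rewrite mulr_ge0 ?invr_ge0 ?ltW //; have := Q1; lra.
rewrite (_ : u * _ = (u * (1 - u)) * (q%:R^-1 * (1 + (q%:R - 1) * e))); last by ring.
apply: (le_trans (ler_wpM2r B e3)).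
by rewrite ler_piMr // subr_ge0.
Qed.

(** Take [b > beta] in the set whose supremum is [beta_s]. The map is below the diagonal at the
    right end; a point above the diagonal would give a fixed point by the intermediate value
    theorem. Being below the diagonal then forces the slope [b / q] at the left end to be at most
    1. *)
Lemma beta_s_sub (beta : R) : 0 < beta < beta_s R q ->
  exists2 b : R, beta < b <= q%:R &
    forall y, 0 < y < 1 - q%:R^-1 -> spin_prob (b * y) - q%:R^-1 <= y.
Proof.
move=> /andP[beta0 betas].
set S := [set beta : R | 0 < beta /\
    forall x : R, q%:R^-1 < x < 1 -> potts_G q beta x - x != 0]%classic.
(* Otherwise [sup] takes its default value 0, which [0 < beta < beta_s] excludes. *)
have hS : has_sup S.
  by apply: contrapT => /sup_out nS; move: betas; rewrite /beta_s nS; have := Q1; lra.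
have e0 : 0 < sup S - beta by rewrite subr_gt0.
have [b [b0 Sb] bS] := sup_adherent e0 hS.
have bb : beta < b by move: bS; rewrite opprB addrCA subrr addr0.
have iq0 : 0 < q%:R^-1 :> R by rewrite invr_gt0; have := Q1; lra.
have iq1 : q%:R^-1 <= 2^-1 :> R by rewrite lef_pV2 ?posrE ?ler_nat //; have := Q1; lra.
have sub y : 0 < y < 1 - q%:R^-1 -> spin_prob (b * y) - q%:R^-1 <= y.
  move=> /andP[y0 y1]; rewrite leNgt; apply/negP => hy.
  pose h t := spin_prob (b * t) - q%:R^-1 - t.
  have hc : {within `[y, 1 - q%:R^-1], continuous h}%classic.
    apply: continuous_subspaceT => t; apply: cvgB; last exact: cvg_id.
    apply: cvgB; last exact: cvg_cst.
    apply: cvgV; first by rewrite gt_eqF // ltr_pwDl // mulr_ge0 ?expR_ge0 //; have := Q1; lra.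
    apply: cvgD; first exact: cvg_cst.
    apply: cvgM; first exact: cvg_cst.
    apply: continuous_cvg; first exact: continuous_expR.
    apply: cvgN; apply: cvgM; first exact: cvg_cst.
    apply: cvgM; [exact: cvg_cst|exact: cvg_id].
  have h0 : 0 < h y by rewrite /h subr_gt0.
  have h1 : h (1 - q%:R^-1) < 0 by rewrite /h; have := spin_prob_lt1 (b * (1 - q%:R^-1)); have := Q1; lra.
  have [|c cI hc0] := IVT (ltW y1) hc (v := 0).
    by rewrite ge_min le_max (ltW h0) (ltW h1) !orbT.
  have c1 : c != 1 - q%:R^-1 by apply: contraTneq h1 => <-; rewrite hc0 ltxx.
  move: cI; rewrite in_itv /= => /andP[yc cq].
  have c2 : c < 1 - q%:R^-1 by rewrite lt_neqAle c1.
  have := Sb (c + q%:R^-1); rewrite potts_GE addrK.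
  have -> : q%:R^-1 < c + q%:R^-1 < 1 by have := Q1; lra.
  move=> /(_ isT)/eqP; apply; rewrite -hc0 /h; ring.
exists b => //; rewrite bb leNgt /=; apply/negP => qb.
(* Here [c * y] is the [u] of [spin_prob_ge]. The choice [u = (1 - q / b) / 2] gives the chord slope
   [(b / q) * (1 - u) = (b / q + 1) / 2 > 1]. *)
pose c : R := q%:R * b / (q%:R - 1); pose y : R := (1 - q%:R / b) / (2 * c).
have c0 : 0 < c by rewrite divr_gt0 ?mulr_gt0 //; have := Q1; lra.
have qb0 : 0 < q%:R / b by rewrite divr_gt0 //; have := Q1; lra.
have qb1 : q%:R / b < 1 by rewrite ltr_pdivrMr // mul1r.
have y0 : 0 < y by rewrite /y; apply: divr_gt0; [rewrite subr_gt0|apply: mulr_gt0].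
have cy : c * y = (1 - q%:R / b) / 2 by rewrite /y; field; rewrite !gt_eqF.
have y1 : y < 1 - q%:R^-1.
  have cq : c * (1 - q%:R^-1) = b by rewrite /c; field; rewrite !gt_eqF //; have := Q1; lra.
  rewrite -(ltr_pM2l c0) cq cy; have := Q1; lra.
have := sub y; rewrite y0 y1 => /(_ isT) Hy.
have u0 : 0 <= q%:R / (q%:R - 1) * (b * y).
  by apply: mulr_ge0; [apply: divr_ge0|apply: mulr_ge0]; have := Q1; lra.
have := le_trans (spin_prob_ge u0) Hy.
have -> : q%:R / (q%:R - 1) * (b * y) = c * y by rewrite /c; field; rewrite gt_eqF //; have := Q1; lra.
have -> : b * y / q%:R = y * (b / q%:R) by ring.
rewrite -mulrA ger_pMr // cy.
have bq : b / q%:R * (q%:R / b) = 1 by field; rewrite !gt_eqF //; have := Q1; lra.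
have bq0 : 1 < b / q%:R by rewrite ltr_pdivlMr ?mul1r //; have := Q1; lra.
(have := Q1; nra).
Qed.

(* [spin_prob] only sees the product [beta * y], so an admissible [b > beta] gives
   a contraction with factor [beta / b], without any compactness argument. *)
Lemma spin_prob_contract (beta : R) : 0 < beta < beta_s R q ->
  beta / q%:R < 1 /\
  exists2 rho : R, 0 < rho < 1 & forall y, y < 1 - q%:R^-1 ->
    spin_prob (beta * y) - q%:R^-1 <= rho * Num.max 0 y.
Proof.
move=> bs; have [b /andP[bb bq] sub] := beta_s_sub bs.
have /andP[b0 _] := bs.
split; first by rewrite ltr_pdivrMr; have := Q1; lra.
have b'0 := lt_trans b0 bb.
exists (beta / b); first by rewrite divr_gt0 //= ltr_pdivrMr // mul1r.
move=> y yq; have [y0|y0] := leP y 0.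
  rewrite mulr0 subr_le0 spin_prob_le0 // mulr_ge0_le0 //; have := Q1; lra.
have -> : beta * y = b * (beta / b * y) by field; rewrite gt_eqF.
apply: sub; rewrite !mulr_gt0 ?invr_gt0 //=; apply: le_lt_trans yq.
by rewrite ger_pMl // ler_pdivrMr // mul1r ltW.
Qed.

End SpinProb.

(** * Delayed linear recursions *)

Section Gronwall.
Variable R : realType.
Implicit Types (a gam : R) (n t : nat).

(** The function [h] has slope [a - 1 < 0] at 0, so it is still nonpositive at [x0], and exponential
    growth makes it nonnegative at [x1]. The positive left endpoint excludes the trivial root 0. *)
Lemma gamma_exists a : 0 < a < 1 ->
  exists2 gam : R, 0 < gam & a * (expR gam - 1) = gam.
Proof.
move=> /andP[a0 a1].
pose h (x : R) := a * (expR x - 1) - x.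
pose x0 : R := (1 - a) / 3; pose x1 : R := 4 / a.
have ax0 : a = 1 - 3 * x0 by rewrite /x0; lra.
have x00 : 0 < x0 by rewrite /x0; lra.
have x0x1 : x0 <= x1.
  apply: (@le_trans _ _ 2); first by rewrite /x0; lra.
  by rewrite /x1 ler_pdivlMr //; lra.
have hc : {within `[x0, x1], continuous h}%classic.
  apply: continuous_subspaceT => t; apply: cvgB; last exact: cvg_id.
  apply: cvgM; first exact: cvg_cst.
  apply: cvgB; [exact: continuous_expR|exact: cvg_cst].
have h0 : h x0 <= 0.
  have : expR x0 <= 1 + x0 + x0 ^+ 2.
    by apply: expR_le_quad; rewrite ger0_norm ?ltW // /x0; lra.
  move=> /(ler_wpM2l (ltW a0)); rewrite /h; move: (expR x0) => e H.
  have : a * x0 ^+ 2 <= x0 ^+ 2 by rewrite ler_piMl ?sqr_ge0 // ltW.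
  have : a * x0 = x0 - 3 * x0 ^+ 2 by rewrite {1}ax0; ring.
  have := sqr_ge0 x0; lra.
have h1 : 0 <= h x1.
  have x10 : 0 < x1 by rewrite divr_gt0.
  have : (1 + x1 / 2) ^+ 2 <= expR x1.
    have -> : expR x1 = expR (x1 / 2) ^+ 2 by rewrite expr2 -expRD; congr expR; lra.
    by rewrite lerXn2r ?nnegrE ?expR_ge0 ?expR_ge1Dx //; lra.
  move=> /(ler_wpM2l (ltW a0)).
  have ax : a * x1 = 4 by rewrite /x1; field; rewrite gt_eqF.
  rewrite /h (_ : a * (1 + x1 / 2) ^+ 2 = a + a * x1 + a * x1 * x1 / 4); last by field.
  rewrite ax; lra.
have [|c cI hc0] := IVT x0x1 hc (v := 0).
  by rewrite ge_min le_max h0 h1 !orbT.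
exists c; first by move: cI; rewrite in_itv /= => /andP[cx _]; exact: lt_le_trans cx.
by apply/eqP; rewrite -subr_eq0 -/(h c) hc0.
Qed.

Definition decay gam n t : R := expR (- (gam / n%:R) * t%:R).

Lemma decay_gt0 gam n t : 0 < decay gam n t.
Proof. exact: expR_gt0. Qed.

Lemma decayB gam n i t : (i <= t)%N ->
  decay gam n (t - i) = decay gam n t * expR (gam / n%:R) ^+ i.
Proof.
move=> it; rewrite /decay -expRM_natr -expRD; congr expR.
by rewrite natrB //; ring.
Qed.

Lemma decay_geo a gam n : (0 < n)%N -> 0 < gam -> 0 < a ->
  a * (expR gam - 1) <= gam ->
  a / n%:R * \sum_(i < n) expR (gam / n%:R) ^+ i <= 1.
Proof.
move=> n0 g0 a0 ag; set x := expR (gam / n%:R).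
have nR : 0 < n%:R :> R by rewrite ltr0n.
have xn : x ^+ n = expR gam.
  by rewrite /x -expRM_natr; congr expR; rewrite divfK // gt_eqF.
have x1 : gam / n%:R <= x - 1 by have := expR_ge1Dx (gam / n%:R); rewrite -/x; lra.
have := subrX1 x n; rewrite xn.
set S := \sum_ _ _ => e.
have S0 : 0 <= S by apply: sumr_ge0 => i _; rewrite exprn_ge0 // expR_ge0.
have : a * (gam / n%:R * S) <= gam.
  apply: le_trans ag; rewrite e; apply: ler_wpM2l; [exact: ltW|exact: ler_wpM2r].
rewrite (_ : a * (gam / n%:R * S) = gam * (a / n%:R * S)); last by ring.
by rewrite ger_pMr.
Qed.

(** The matching lower bound uses the equation for [gam] as an equality; it will make [weight 0]
    equal to 1 up to [O(1 / n)]. *)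
Lemma decay_geo_ge a gam n : (0 < n)%N -> 0 < gam -> 3 * gam <= n%:R -> 0 < a ->
  a * (expR gam - 1) = gam ->
  1 - gam / n%:R <= a / n%:R * \sum_(i < n) expR (gam / n%:R) ^+ i.
Proof.
move=> n0 g0 gn a0 ag; set x := expR (gam / n%:R).
have nR : 0 < n%:R :> R by rewrite ltr0n.
have xn : x ^+ n = expR gam.
  by rewrite /x -expRM_natr; congr expR; rewrite divfK // gt_eqF.
set d := gam / n%:R.
have d0 : 0 < d by rewrite divr_gt0.
have d1 : d <= 3^-1 by rewrite /d ler_pdivrMr //; lra.
have x1 : x - 1 <= d + d ^+ 2.
  by have := @expR_le_quad _ d; rewrite (ger0_norm (ltW d0)) => /(_ d1); rewrite /x -/d; lra.
have := subrX1 x n; rewrite xn.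
set S := \sum_ _ _ => e.
have S0 : 0 <= S by apply: sumr_ge0 => i _; rewrite exprn_ge0 // expR_ge0.
have : gam <= a * ((d + d ^+ 2) * S).
  rewrite -[leLHS]ag e; apply: ler_wpM2l; [exact: ltW|exact: ler_wpM2r].
rewrite (_ : a * ((d + d ^+ 2) * S) = gam * ((1 + d) * (a / n%:R * S))); last by rewrite /d; ring.
rewrite -{1}[gam]mulr1 ler_pM2l // => H.
have : 0 <= a / n%:R * S by rewrite mulr_ge0 // divr_ge0 ?ltW.
set T := a / n%:R * S in H * => T0; nra.
Qed.

Lemma sum_nincr_ge (eta : nat -> R) t j : (j <= t)%N ->
  (forall s r, (s <= r)%N -> eta r <= eta s) ->
  \sum_(s < (t - j).+1) eta s + j%:R * eta t <= \sum_(s < t.+1) eta s.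
Proof.
move=> jt mono; elim: j jt => [|j IH] jt; first by rewrite subn0 mul0r addr0.
apply: le_trans (IH (ltnW jt)); rewrite (_ : (t - j).+1 = (t - j.+1).+2); last lia.
rewrite [in leRHS]big_ord_recr /= -addrA lerD2l.
have := mono (t - j.+1).+1 t; rewrite -natr1 => H.
have {}H : eta t <= eta (t - j.+1).+1 by apply: H; lia.
lra.
Qed.

(* An error [eta t] enters each [z t], but [z t] averages over a window of [n]
   times, so the errors accumulate only at the rate [eta t / n]; this is why the
   exponent carries [1 / n]. *)
Lemma gronwall n t0 a a1 gam b B (eta z : nat -> R) :
  (1 < n)%N -> (n.-1 <= t0)%N -> 0 < a -> 0 < gam ->
  a * (expR gam - 1) <= gam ->
  (forall s t, (s <= t)%N -> eta t <= eta s) -> (forall t, 0 <= eta t) ->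
  (forall t, (t0 <= t)%N -> 8 / a * eta t <= 1) ->
  (forall t, (t0 <= t)%N -> a * (1 + eta t) <= a1) -> a1 < 1 ->
  0 <= b -> 0 <= B ->
  (forall t, (t < t0)%N -> z t <= B * decay gam n t) ->
  (forall t, (t0 <= t)%N ->
     z t <= a * (1 + eta t) / n%:R * \sum_(i < n.-1) z (t - i.+1)%N + b) ->
  forall t, z t <= B * decay gam n t * expR (8 / a / n%:R * \sum_(s < t.+1) eta s)
                   + b / (1 - a1).
Proof.
move=> n1 nt0 a0 g0 ag mono eta0 etas eta1 a11 b0 B0 zB zrec.
have nR : 0 < n%:R :> R by rewrite ltr0n ltnW.
have b1 : 0 <= b / (1 - a1) by rewrite divr_ge0 //; lra.
have c0 : 0 <= 8 / a / n%:R by rewrite !divr_ge0 // ltW.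
pose F t := expR (8 / a / n%:R * \sum_(s < t.+1) eta s).
elim/ltn_ind => t IH; rewrite -/(F t).
have [tt0|tt0] := ltnP t t0.
  apply: (le_trans (zB _ tt0)); apply: ler_wpDr => //.
  rewrite ler_peMr ?mulr_ge0 ?(ltW (decay_gt0 _ _ _)) // /F -[leLHS]expR0 ler_expR.
  by rewrite mulr_ge0 // sumr_ge0.
apply: (le_trans (zrec _ tt0)).
set al := a * (1 + eta t); have al0 : 0 <= al by rewrite mulr_ge0 ?addr_ge0 // ltW.
(* At lag [j] the exponential correction is smaller by a factor [expR (- k * j / n) <= 1 - k * j /
   (2 * n)]. Summed over lags, whose total is at least [n ^ 2 / 4], this gains [a / n * (k / (2 *
   n)) * (n ^ 2 / 4) = eta t], which pays for the factor [1 + eta t]. This fixes the constant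
   [8 / a]. *)
pose x := expR (gam / n%:R); pose k := 8 / a * eta t.
have k0 : 0 <= k by rewrite mulr_ge0 // divr_ge0 // ltW.
have k1 : k <= 1 by exact: etas.
have H1 (i : 'I_n.-1) : z (t - i.+1)%N <=
   B * decay gam n t * F t * (x ^+ i.+1 - k / (2 * n%:R) * i.+1%:R) + b / (1 - a1).
  have it : (i < t)%N by apply: leq_trans (ltn_ord i) (leq_trans nt0 tt0).
  apply: (le_trans (IH _ _)); first by rewrite ltn_subrL (leq_trans _ it).
  rewrite lerD2r decayB // -/x mulrA -mulrA -[leRHS]mulrA.
  apply: ler_wpM2l; first by rewrite mulr_ge0 ?(ltW (decay_gt0 _ _ _)).
  set j := i.+1; pose y := k * j%:R / n%:R.
  have jn : j%:R <= n%:R :> R by rewrite ler_nat (leq_trans (ltn_ord i)) // leq_pred.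
  have y01 : 0 <= y <= 1.
    apply/andP; split; first by apply: divr_ge0 => //; apply: mulr_ge0.
    by rewrite /y ler_pdivrMr // mul1r (le_trans _ jn) // ler_piMl.
  have Fj : expR (8 / a / n%:R * \sum_(s < (t - j).+1) eta s) <= F t * (1 - y / 2).
    apply: (@le_trans _ _ (F t * expR (- y))).
      rewrite /F -expRD ler_expR.
      have := ler_wpM2l c0 (sum_nincr_ge it mono); rewrite mulrDr -/j.
      rewrite (_ : _ * (_ * eta t) = y); first lra.
      by rewrite /y /k; ring.
    rewrite ler_wpM2l ?expR_ge0 // expRN.
    rewrite -[leLHS]mul1r ler_pdivrMr ?expR_gt0 //.
    have := expR_ge1Dx y; nra.
  apply: (le_trans (ler_wpM2l _ Fj)); first by rewrite exprn_ge0 // expR_ge0.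
  rewrite mulrCA ler_wpM2l ?expR_ge0 // mulrBr mulr1 lerD2l lerN2.
  have -> : y / 2 = k / (2 * n%:R) * j%:R by rewrite /y; field; rewrite gt_eqF.
  rewrite ler_peMl ?exprn_ege1 //; last first.
    by rewrite -[leLHS]expR0 ler_expR divr_ge0 ?ltW.
  by rewrite mulr_ge0 // divr_ge0 // mulr_ge0 // ltW.
have H2 : \sum_(i < n.-1) z (t - i.+1)%N <= \sum_(i < n.-1)
    (B * decay gam n t * F t * (x ^+ i.+1 - k / (2 * n%:R) * i.+1%:R) + b / (1 - a1)).
  by apply: ler_sum => i _; exact: H1.
have aln : 0 <= al / n%:R by rewrite divr_ge0 // ltW.
apply: (le_trans (lerD (ler_wpM2l aln H2) (lexx b))).
rewrite big_split /= -mulr_sumr sumrB -mulr_sumr.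
rewrite [_ * (_ + _)]mulrDr.
rewrite sumr_const card_ord -[_ *+ n.-1]mulr_natl.
rewrite -addrA; apply: lerD; last first.
  have nn : n.-1%:R <= n%:R :> R by rewrite ler_nat leq_pred.
  have -> : al / n%:R * (n.-1%:R * (b / (1 - a1))) = al * (n.-1%:R / n%:R) * (b / (1 - a1)) by ring.
  have A : al * (n.-1%:R / n%:R) <= a1.
    apply: le_trans (eta1 _ tt0); rewrite -/al ler_piMr // ler_pdivrMr // mul1r //.
  have := ler_wpM2r b1 A.
  have : b / (1 - a1) = b + a1 * (b / (1 - a1)) by field; rewrite gt_eqF //; lra.
  lra.
set S := \sum_(i < n.-1) x ^+ i.+1; set N := \sum_(i < n.-1) _.
have BF : 0 <= B * decay gam n t * F t.
  by rewrite !mulr_ge0 ?expR_ge0.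
rewrite mulrCA ler_piMr //.
have S1 : a / n%:R * S <= 1.
  apply: le_trans (decay_geo (ltnW n1) g0 a0 ag).
  apply: ler_wpM2l; first by rewrite divr_ge0 // ltW.
  rewrite /S -/x -(big_mkord xpredT (fun i => x ^+ i)) -[in leRHS](prednK (ltnW n1)).
  by rewrite big_nat_recl //= big_mkord ler_wpDl.
have N1 : n%:R ^+ 2 / 4 <= N.
  have -> : N = n%:R * (n%:R - 1) / 2.
    rewrite /N (_ : n%:R - 1 = n.-1%:R); last by rewrite -subn1 natrB // ltnW.
    rewrite -[in LHS](prednK (ltnW n1)) -[n in n%:R](prednK (ltnW n1)) /=.
    elim: n.-1 => [|m IHm]; first by rewrite big_ord0; lra.
    by rewrite big_ord_recr /= IHm -!natr1; field.
  have : 2 <= n%:R :> R by rewrite ler_nat.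
  nra.
have -> : al / n%:R * (S - k / (2 * n%:R) * N) = (1 + eta t) * (a / n%:R * S - a / n%:R * (k / (2 * n%:R)) * N) by rewrite /al; ring.
have K1 : eta t <= a / n%:R * (k / (2 * n%:R)) * N.
  rewrite /k (_ : a / n%:R * _ = 4 / n%:R ^+ 2 * eta t); last by field; rewrite !gt_eqF.
  have := ler_wpM2l (_ : 0 <= 4 / n%:R ^+ 2 * eta t) N1.
  rewrite (_ : _ * eta t * (_ / _) = eta t); last by field; rewrite gt_eqF.
  by apply; rewrite mulr_ge0 // divr_ge0 // exprn_ge0 // ltW.
have := eta0 t; nra.
Qed.

End Gronwall.

(** * Concentration of the spin counts *)

Section Gibbs.
Variables (R : realType) (q n : nat) (beta : R).
Hypotheses (q2 : (2 <= q)%N) (n2 : (2 <= n)%N).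
Implicit Types (h : seq 'I_q) (k : 'I_q).

(* Updating a site forgets its own spin, which is the [n]-th most recent one: only
   the last [n - 1] spins matter. *)
Definition cnt h k : nat := count_mem k (take n.-1 h).

(** The centring is the mean count [(n - 1) / q] of a full window, but the scale is [n], as in the
    Hamiltonian; hence [beta * dev] is the exponent of [gibbs] up to a constant. *)
Definition dev h k : R := (cnt h k)%:R / n%:R - n.-1%:R / (n%:R * q%:R).

Definition gibbs h k : R := softmax (fun k => beta / n%:R * (cnt h k)%:R) k.

Let nR : 0 < n%:R :> R. Proof. by rewrite ltr0n ltnW. Qed.
Let qR : 0 < q%:R :> R. Proof. by rewrite ltr0n ltnW. Qed.

Lemma gibbsE h k : gibbs h k = softmax (fun k => beta * dev h k) k.
Proof.
rewrite /gibbs -(softmax_shift _ (- (beta * (n.-1%:R / (n%:R * q%:R))))).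
by apply: eq_softmax => j; rewrite /dev; ring.
Qed.

Lemma gibbs_gt0 h k : 0 < gibbs h k.
Proof. exact: softmax_gt0. Qed.

Lemma stochastic_gibbs : stochastic gibbs.
Proof.
split=> [h k|h]; first exact/ltW/gibbs_gt0.
by apply: softmax_sum1; rewrite card_ord ltnW.
Qed.

Lemma cnt_sum h k : (cnt h k)%:R = \sum_(x <- take n.-1 h) (x == k)%:R :> R.
Proof.
rewrite /cnt -sum1_count natr_sum big_mkcond /=.
by apply: eq_bigr => x _; case: eqP.
Qed.

Lemma sum_cnt h : (\sum_k cnt h k = size (take n.-1 h))%N.
Proof.
rewrite /cnt -[RHS]sum1_size.
under eq_bigr do rewrite -sum1_count big_mkcond.
rewrite exchange_big /=; apply: eq_bigr => x _.
by rewrite (bigD1 x) //= eqxx big1 // => k /negPf; rewrite eq_sym => ->.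
Qed.

Lemma size_window h : (n.-1 <= size h)%N -> size (take n.-1 h) = n.-1.
Proof. by move=> nh; rewrite size_take; case: ltngtP nh. Qed.

Lemma sum_dev h : (n.-1 <= size h)%N -> \sum_k dev h k = 0.
Proof.
move=> nh; rewrite /dev sumrB -mulr_suml -natr_sum sum_cnt size_window //.
rewrite sumr_const card_ord -mulr_natr.
by field; rewrite !gt_eqF.
Qed.

Lemma cnt_le h k : (cnt h k <= n.-1)%N.
Proof. by apply: leq_trans (count_size _ _) _; rewrite size_take; case: ltnP. Qed.

Let m_n : n.-1%:R = n%:R - 1 :> R.
Proof. by rewrite -subn1 natrB // ltnW. Qed.

Lemma dev_lt h k : dev h k < 1 - q%:R^-1.
Proof.
have c : (cnt h k)%:R <= n%:R - 1 :> R by rewrite -m_n ler_nat cnt_le.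
have -> : dev h k = ((cnt h k)%:R - (n%:R - 1) / q%:R) / n%:R.
  by rewrite /dev m_n; field; rewrite !gt_eqF.
rewrite ltr_pdivrMr //.
have : q%:R^-1 < 1 :> R by rewrite invf_lt1 // ltr1n.
set p := q%:R^-1; nra.
Qed.

Lemma dev_norm_le h k : `|dev h k| <= 1.
Proof.
have ip : 0 < q%:R^-1 :> R by rewrite invr_gt0.
rewrite ler_norml; have := dev_lt h k => d1; apply/andP; split; last lra.
have : 0 <= (cnt h k)%:R / n%:R :> R by rewrite divr_ge0.
have : n.-1%:R / (n%:R * q%:R) <= 1 :> R; last by rewrite /dev; lra.
rewrite ler_pdivrMr ?mulr_gt0 // mul1r -natrM ler_nat.
by apply: leq_trans (leq_pred n) _; rewrite leq_pmulr // ltnW.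
Qed.

(** The zero sum turns common upper bounds into a lower bound, which the one-sided contraction does
    not provide. *)
Lemma dev_ge h k (B : R) : (n.-1 <= size h)%N -> (forall j, dev h j <= B) ->
  - (q%:R - 1) * B <= dev h k.
Proof.
move=> nh dB; have := sum_dev nh; rewrite (bigD1 k) //= => /eqP.
rewrite addr_eq0 => /eqP ->; rewrite mulNr lerN2.
apply: (@le_trans _ _ (\sum_(j < q | j != k) B)); first exact: ler_sum.
rewrite -(big_mkord (fun j => j != k) (fun=> B)) /=.
have -> : (q%:R - 1) * B = (\sum_(j < q) B) - B.
  by rewrite sumr_const card_ord mulrBl mul1r mulr_natl.
by rewrite [X in _ <= X - _](bigD1 k) //= addrC addrK big_mkord.
Qed.

End Gibbs.

(** * Pathwise bounds on the spin proportions *)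

Section Deviation.
Variables (R : realType) (q n : nat) (beta rho gr d0 f : R).
Hypotheses (q2 : (2 <= q)%N) (n2 : (2 <= n)%N).
Hypotheses (rho01 : 0 < rho < 1) (gr0 : 0 < gr) (rg : rho * (expR gr - 1) = gr).
Hypothesis rho_contract : forall y, y < 1 - q%:R^-1 ->
  spin_prob q (beta * y) - q%:R^-1 <= rho * Num.max 0 y.
Hypotheses (d00 : 0 <= d0) (f0 : 0 < f) (f1 : f <= 2 / 3).
Variable K : seq 'I_q -> 'I_q -> R.
Hypothesis sK : stochastic K.
Hypothesis K_gibbs : forall h, (n <= size h)%N -> K h =1 gibbs n beta h.
Hypothesis K_init : forall h k, (size h < n)%N -> K h k - q%:R^-1 <= d0.
Implicit Types (h : seq 'I_q) (k : 'I_q).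

Let nR : 0 < n%:R :> R. Proof. by rewrite ltr0n ltnW. Qed.

Definition fluct k h : R :=
  compsum K (fun x => (x == k)%:R) (fun i => (i < n.-1)%:R) h.

(* An exponential-moment version of the union bound: [bad h < 1] rules out every
   large fluctuation along the history, and its expectation is tiny. *)
Definition bad h : R := \sum_(i < (size h).+1) \sum_k
  expR (f / 2 * fluct k (drop i h) - f ^+ 2 / 2 * n%:R).

Lemma bad_ge0 h : 0 <= bad h.
Proof. by apply: sumr_ge0 => i _; apply: sumr_ge0 => k _; exact: expR_ge0. Qed.

(** The exponential moment costs [f ^ 2 * n / 4], half of what each term of [bad] subtracts. The
    condition [f <= 2 / 3] keeps the weights [f / 2] below 1/3. *)
Lemma Ex_bad t : Ex K t bad <= t.+1%:R * (q%:R * expR (- (f ^+ 2 * n%:R) / 4)).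
Proof.
pose w k h := expR (f / 2 * fluct k h - f ^+ 2 / 2 * n%:R).
rewrite (@Ex_ext _ _ _ _ _ (fun h => \sum_(i < t.+1) \sum_k w k (drop i h))); last first.
  by move=> h sh; rewrite /bad sh.
rewrite Ex_sum; apply: (@le_trans _ _ (\sum_(i < t.+1) (q%:R * expR (- (f ^+ 2 * n%:R) / 4)))); last first.
  by rewrite sumr_const card_ord -[leLHS]mulr_natl.
apply: ler_sum => i _; rewrite Ex_sum.
apply: (@le_trans _ _ (\sum_(k < q) expR (- (f ^+ 2 * n%:R) / 4))); last first.
  by rewrite sumr_const card_ord -[leLHS]mulr_natl.
apply: ler_sum => k _; rewrite (Ex_drop (w k) sK); last exact: ltn_ord i.
rewrite /w (@Ex_ext _ _ _ _ _ (fun h => expR (- (f ^+ 2 / 2 * n%:R)) *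
   expR (compsum K (fun x => (x == k)%:R) (fun i => f / 2 * (i < n.-1)%:R) h))); last first.
  by move=> h _; rewrite -expRD compsumZ addrC.
rewrite ExZ.
have -> : - (f ^+ 2 * n%:R) / 4 = - (f ^+ 2 / 2 * n%:R) + f ^+ 2 / 4 * n%:R by field.
rewrite expRD ler_wpM2l ?expR_ge0 //.
apply: (le_trans (Ex_compsum_exp sK _ _ _)).
- by move=> x; rewrite ler0n lern1 leq_b1.
- move=> j; rewrite normrM normr_nat ger0_norm; last by rewrite divr_ge0 // ltW.
  by case: (j < n.-1)%N; rewrite ?mulr1 ?mulr0 ?invr_ge0 //; have := f1; lra.
rewrite ler_expR; set m := (t - i)%N.
have -> : \sum_(j < m) (f / 2 * (j < n.-1)%:R) ^+ 2 = f ^+ 2 / 4 * (\sum_(j < m) (j < n.-1)%N)%:R.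
  rewrite natr_sum mulr_sumr; apply: eq_bigr => j _; rewrite exprMn.
  by case: (j < n.-1)%N => /=; field.
rewrite ler_wpM2l ?divr_ge0 ?sqr_ge0 // ler_nat.
elim: (m) => [|l IH]; first by rewrite big_ord0.
have [ln|ln] := leqP n.-1 l.
  by rewrite big_ord_recr /= ltnNge ln addn0.
apply: leq_trans (_ : l.+1 <= n)%N; last by rewrite (leq_trans ln) // leq_pred.
rewrite -[leqRHS](card_ord l.+1) -sum1_card; apply: leq_sum => j _; exact: leq_b1.
Qed.

(** The bound on upper deviations produced by the recursion, times [q], which covers the factor
    [q - 1] of [dev_ge]. *)
Definition eta t : R := q%:R * (d0 / rho * expR gr * decay gr n t + f / (1 - rho)).

Lemma eta_ge0 t : 0 <= eta t.
Proof.
have /andP[r0 r1] := rho01.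
rewrite mulr_ge0 // addr_ge0 // ?divr_ge0 //; last 2 first.
- exact: ltW.
- by rewrite subr_ge0 ltW.
by rewrite !mulr_ge0 ?expR_ge0 // ?invr_ge0 ltW.
Qed.

Lemma eta_nincr s t : (s <= t)%N -> eta t <= eta s.
Proof.
move=> st; have /andP[r0 r1] := rho01.
rewrite /eta ler_wpM2l // lerD2r ler_wpM2l //.
  by rewrite !mulr_ge0 ?expR_ge0 // invr_ge0 ltW.
by rewrite /decay ler_expR !mulNr lerN2 ler_wpM2l ?ler_nat // divr_ge0 // ltW.
Qed.

(** Up to [f * n], the count of [k] in the window is the sum of its conditional probabilities, each
    at most [1 / q] plus [rho] times a positive part. This is the recursion of [gronwall] with zero
    relative error. *)
Lemma dev_le_of_fluct h k : (n <= size h)%N ->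
  (forall i, (i <= size h)%N -> fluct k (drop i h) <= f * n%:R) ->
  dev R n h k <= d0 / rho * expR gr * decay gr n (size h) + f / (1 - rho).
Proof.
move=> nh hf; have /andP[r0 r1] := rho01; set t := size h.
(* For [s < n] the window is not yet full; the value [d0 / rho] makes [rho * z s] equal to the
   allowed initial bias. The final 0 extends [z] past the end of [h], since [gronwall] speaks of all
   times. *)
pose z s := if (s < n)%N then d0 / rho else
  if (s <= t)%N then Num.max 0 (dev R n (drop (t - s) h) k) else 0.
have dr0 : 0 <= d0 / rho by rewrite divr_ge0 // ltW.
have z0 s : 0 <= z s.
  by rewrite /z; case: ifP => // _; case: ifP => // _; rewrite le_max lexx.
have H : z t <= d0 / rho * expR gr * decay gr n t *
    expR (8 / rho / n%:R * \sum_(s < t.+1) 0) + f / (1 - rho); last first.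
  rewrite big1 // mulr0 expR0 mulr1 in H; apply: le_trans H.
  by rewrite /z ltnNge nh /= leqnn subnn drop0 le_max lexx orbT.
apply: (@gronwall R n n rho rho gr f (d0 / rho * expR gr) (fun=> 0)) => //.
- exact: leq_pred.
- by rewrite rg.
- by move=> *; rewrite mulr0.
- by move=> *; rewrite addr0 mulr1.
- exact: ltW.
- by rewrite !mulr_ge0 ?expR_ge0 // invr_ge0 ltW.
- move=> s sn; rewrite /z sn -[leLHS]mulr1 -[leRHS]mulrA ler_wpM2l // /decay -expRD.
  rewrite -[leLHS]expR0 ler_expR.
  have -> : gr + - (gr / n%:R) * s%:R = gr * (1 - s%:R / n%:R) by ring.
  apply: mulr_ge0; first exact: ltW.
  by rewrite subr_ge0 ler_pdivrMr // mul1r ler_nat ltnW.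
move=> s ns; rewrite addr0 mulr1.
have S0 : 0 <= rho / n%:R * \sum_(i < n.-1) z (s - i.+1)%N.
  by rewrite mulr_ge0 ?sumr_ge0 // divr_ge0 // ltW.
rewrite {1}/z ltnNge ns /=; have [st|] := leqP s t; last first.
  by move=> _; rewrite addr_ge0 // ltW.
rewrite ge_max addr_ge0 ?(ltW f0) //=.
set h' := drop (t - s) h.
have sh' : size h' = s by rewrite size_drop subKn.
have nh' : (n.-1 <= size h')%N by rewrite sh' (leq_trans (leq_pred _)).
have := hf (t - s)%N (leq_subr _ _); rewrite -/h' /fluct compsum_window // -cnt_sum.
have meanE g : mean K (fun x => (x == k)%:R) g = K g k.
  rewrite /mean (bigD1 k) //= eqxx mulr1 big1 ?addr0 // => j /negPf ->.
  by rewrite mulr0.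
have m_n : n.-1%:R = n%:R - 1 :> R by rewrite -subn1 natrB // ltnW.
have qR : 0 < q%:R :> R by rewrite ltr0n ltnW.
move=> Hf.
have A : \sum_(i < n.-1) mean K (fun x => (x == k)%:R) (drop i.+1 h') <=
  \sum_(i < n.-1) (rho * z (s - i.+1)%N + q%:R^-1).
  apply: ler_sum => i _; rewrite meanE -lerBlDr.
  have si : (i.+1 <= s)%N by apply: leq_trans (ltn_ord i) _; rewrite -sh'.
  have sz : size (drop i.+1 h') = (s - i.+1)%N by rewrite size_drop sh'.
  rewrite /z; case: ltnP => sn.
    by rewrite mulrCA mulfV ?gt_eqF // mulr1 K_init // sz.
  rewrite (leq_trans (leq_subr _ _) st).
  have -> : drop (t - (s - i.+1)) h = drop i.+1 h'.
    by rewrite /h' drop_drop addnC subnBA // addnC addnBAC // addnC.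
  rewrite K_gibbs ?sz // gibbsE //.
  apply: le_trans (rho_contract (dev_lt R q2 n2 _ k)).
  rewrite lerD2r; apply: (softmax_le_spin q2); first by rewrite card_ord.
  by rewrite -mulr_sumr sum_dev ?mulr0 // sz (leq_trans _ sn) // leq_pred.
rewrite big_split /= -mulr_sumr sumr_const card_ord -mulr_natr in A.
have -> : dev R n h' k = ((cnt n h' k)%:R - q%:R^-1 * n.-1%:R) / n%:R.
  by rewrite /dev; field; rewrite !gt_eqF.
rewrite ler_pdivrMr // mulrDl mulrAC divfK ?gt_eqF //; lra.
Qed.

(** If [bad h >= 1], the trivial bound [|dev| <= 1] suffices; if not, every exponent in [bad] is
    negative and no fluctuation exceeds [f * n]. *)
Lemma dev_bound h k : (n <= size h)%N -> `|dev R n h k| <= eta (size h) + bad h.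
Proof.
move=> nh; have [b1|b1] := leP 1 (bad h).
  rewrite (le_trans (dev_norm_le R q2 n2 h k)) //.
  by rewrite (le_trans b1) // lerDr eta_ge0.
have fl j i : (i <= size h)%N -> fluct j (drop i h) <= f * n%:R.
  move=> ih; rewrite leNgt; apply/negP => hf.
  move: b1; rewrite ltNge => /negP; apply.
  rewrite /bad (bigD1 (Ordinal (ih : (i < (size h).+1)%N))) //= ler_wpDr //.
    by apply: sumr_ge0 => l _; apply: sumr_ge0 => m _; exact: expR_ge0.
  rewrite (bigD1 j) //= ler_wpDr //; first by apply: sumr_ge0 => l _; exact: expR_ge0.
  rewrite -[leLHS]expR0 ler_expR.
  have : f / 2 * (f * n%:R) <= f / 2 * fluct j (drop i h).
    by apply: ler_wpM2l; [rewrite divr_ge0 // ltW|exact: ltW].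
  by rewrite [_ / 2 * (_ * _)](_ : _ = f ^+ 2 / 2 * n%:R); [lra|field].
have B j := dev_le_of_fluct nh (fl j).
rewrite -[leLHS]addr0 lerD ?bad_ge0 //.
have L := dev_ge q2 n2 k (leq_trans (leq_pred _) nh) B.
set b := _ + _ in B L; rewrite -/(eta _).
have q1 : 1 <= q%:R :> R by rewrite ler1n ltnW.
have b0 : 0 <= b.
  have := eta_ge0 (size h); rewrite /eta -/b pmulr_rge0 //.
  exact: lt_le_trans q1.
rewrite ler_norml /eta -/b; have := B k; nra.
Qed.

End Deviation.

(** * Coupling and the last scan *)

Section MaximalCoupling.
Variables (R : realType) (I : finType).
Implicit Types (p r : I -> R).

Definition excess p r k : R := p k - Num.min (p k) (r k).

Definition half_l1 p r : R := 2^-1 * \sum_k `|p k - r k|.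

(* When [p = r] the denominator is 0 and so are both excesses. *)
Definition max_coupling p r (x : I * I) : R :=
  (if x.1 == x.2 then Num.min (p x.1) (r x.1) else 0) +
  excess p r x.1 * excess r p x.2 / half_l1 p r.

Lemma excess_ge0 p r k : 0 <= excess p r k.
Proof. by rewrite subr_ge0 ge_min lexx. Qed.

Lemma half_l1_ge0 p r : 0 <= half_l1 p r.
Proof. by rewrite mulr_ge0 ?invr_ge0 // sumr_ge0. Qed.

Lemma half_l1C p r : half_l1 p r = half_l1 r p.
Proof. by congr (_ * _); apply: eq_bigr => k _; rewrite distrC. Qed.

Lemma sum_excess p r : \sum_k p k = \sum_k r k ->
  \sum_k excess p r k = half_l1 p r.
Proof.
move=> pr; have E k : excess p r k = 2^-1 * `|p k - r k| + 2^-1 * (p k - r k).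
  rewrite /excess; case: (leP (p k) (r k)) => h.
    by rewrite ler0_norm ?subr_le0 //; lra.
  by rewrite gtr0_norm ?subr_gt0 //; lra.
rewrite (eq_bigr _ (fun k _ => E k)) big_split /= -!mulr_sumr sumrB pr subrr.
by rewrite mulr0 addr0.
Qed.

Lemma max_coupling_ge0 p r x : (forall k, 0 <= p k) -> (forall k, 0 <= r k) ->
  0 <= max_coupling p r x.
Proof.
move=> p0 r0; apply: addr_ge0.
  by case: ifP => // _; rewrite le_min p0 r0.
by apply: divr_ge0; [apply: mulr_ge0; exact: excess_ge0|exact: half_l1_ge0].
Qed.

Lemma excess_half_l1_0 p r k : \sum_k p k = \sum_k r k ->
  half_l1 p r = 0 -> excess p r k = 0.
Proof.
move=> pr; rewrite -sum_excess // => /psumr_eq0P; apply => //.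
by move=> *; exact: excess_ge0.
Qed.

Lemma max_coupling_fst p r k : \sum_k p k = \sum_k r k ->
  \sum_(x | x.1 == k) max_coupling p r x = p k.
Proof.
move=> pr; rewrite (eq_bigl (fun x : I * I => (x.1 == k) && true)); last first.
  by move=> x; rewrite andbT.
rewrite -(pair_big (fun i => i == k) xpredT (fun i j => max_coupling p r (i, j))) /=.
rewrite big_pred1_eq big_split /= (bigD1 k) //= eqxx big1 ?addr0; last first.
  by move=> j jk; rewrite eq_sym (negPf jk).
rewrite -mulr_suml -mulr_sumr sum_excess // half_l1C.
have [D0|D0] := eqVneq (half_l1 p r) 0.
  have := excess_half_l1_0 k pr D0; rewrite D0 invr0 mulr0 addr0 /excess => /eqP.
  by rewrite subr_eq0 => /eqP.
by rewrite mulfK // /excess addrC subrK.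
Qed.

Lemma max_couplingC p r i j : max_coupling p r (i, j) = max_coupling r p (j, i).
Proof.
rewrite /max_coupling /= eq_sym half_l1C [excess p r i * _]mulrC.
by case: eqVneq => [->|//]; rewrite minC.
Qed.

Lemma max_coupling_snd p r k : \sum_k p k = \sum_k r k ->
  \sum_(x | x.2 == k) max_coupling p r x = r k.
Proof.
move=> pr; rewrite -[RHS](@max_coupling_fst r p) //.
rewrite (reindex_inj (h := fun x : I * I => (x.2, x.1))) /=; last first.
  by apply: (can_inj (g := fun x => (x.2, x.1))) => -[].
by apply: eq_bigr => -[i j] _; exact: max_couplingC.
Qed.

Lemma max_coupling_neq p r : \sum_k p k = \sum_k r k ->
  \sum_x max_coupling p r x * (x.1 != x.2)%:R <= half_l1 p r.
Proof.
move=> pr; apply: (@le_trans _ _ (\sum_(x : I * I) excess p r x.1 * excess r p x.2 / half_l1 p r)).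
  apply: ler_sum => x _; rewrite /max_coupling.
  have E : 0 <= excess p r x.1 * excess r p x.2 / half_l1 p r.
    by apply: divr_ge0; [apply: mulr_ge0; exact: excess_ge0|exact: half_l1_ge0].
  by case: eqVneq => /= _; rewrite ?mulr0 // add0r mulr1.
rewrite -(pair_big xpredT xpredT (fun i j => excess p r i * excess r p j / half_l1 p r)) /=.
under eq_bigr do rewrite -mulr_suml -mulr_sumr sum_excess // half_l1C.
rewrite -!mulr_suml sum_excess //.
have [->|D0] := eqVneq (half_l1 p r) 0; first by rewrite !mul0r.
by rewrite mulfK.
Qed.

End MaximalCoupling.

(** The tower property. It expresses the content of the window through one-step means, which closes
    the linear recursions. *)
Lemma Ex_window (R : realType) (T : finType) (K : seq T -> T -> R) (e : T -> R) m t :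
  stochastic K -> (m <= t)%N ->
  Ex K t (fun h => \sum_(x <- take m h) e x) =
  \sum_(i < m) Ex K (t - i.+1) (mean K e).
Proof.
move=> sK; elim: t m => [|t IH] [|m] // mt.
- by rewrite big_ord0 -[RHS](Ex_cst 0 0 sK) //; apply: Ex_ext => h _; rewrite take0 big_nil.
- by rewrite big_ord0 -[RHS](Ex_cst t.+1 0 sK) //; apply: Ex_ext => h _; rewrite take0 big_nil.
rewrite big_ord_recl subn1 /= -IH // -ExD; apply: Ex_ext => h _.
rewrite /step /mean; under eq_bigr do rewrite /= big_cons mulrDr.
by rewrite big_split /= -mulr_suml sK.2 mul1r.
Qed.

Section Coupling.
Variables (R : realType) (q n : nat) (beta : R).
Hypotheses (q2 : (2 <= q)%N) (n2 : (2 <= n)%N) (beta0 : 0 < beta).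

Definition soft_cst : R := 2 * beta ^+ 2 * expR beta / q%:R.

Let qR : (0 : R) < q%:R. Proof. by rewrite ltr0n ltnW. Qed.
Let nR : (0 : R) < n%:R. Proof. by rewrite ltr0n ltnW. Qed.

Lemma soft_cst_ge0 : 0 <= soft_cst.
Proof. by rewrite !mulr_ge0 ?invr_ge0 ?expR_ge0 // ltW. Qed.

Definition neq_pair (x : 'I_q * 'I_q) : R := (x.1 != x.2)%:R.

Definition disag (h : seq ('I_q * 'I_q)) : R := \sum_(x <- take n.-1 h) neq_pair x.

Lemma disag_ge0 h : 0 <= disag h.
Proof. by apply: sumr_ge0. Qed.

Lemma disag_le h : disag h <= n%:R.
Proof.
apply: (@le_trans _ _ (\sum_(x <- take n.-1 h) 1)).
  by apply: ler_sum => x _; rewrite /neq_pair lern1 leq_b1.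
rewrite big_const_seq count_predT iter_addr_0 -mulr_natr mul1r ler_nat size_take.
by apply: (@leq_trans n.-1); rewrite ?leq_pred //; case: ltnP => // /ltnW.
Qed.

Lemma dev_l1_le (h : seq ('I_q * 'I_q)) :
  \sum_k `|dev R n (map fst h) k - dev R n (map snd h) k| <= 2 * disag h / n%:R.
Proof.
rewrite ler_pdivlMr // mulr_suml.
apply: (@le_trans _ _ (\sum_k \sum_(x <- take n.-1 h) `|(x.1 == k)%:R - (x.2 == k)%:R : R|)).
  apply: ler_sum => k _; rewrite -[n%:R]ger0_norm // -normrM.
  have -> : (dev R n (map fst h) k - dev R n (map snd h) k) * n%:R =
     (cnt n (map fst h) k)%:R - (cnt n (map snd h) k)%:R.
    rewrite /dev; field; by rewrite !gt_eqF.
  rewrite !cnt_sum -!map_take !big_map -sumrB.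
  exact: ler_norm_sum.
rewrite exchange_big /disag mulr_sumr /=; apply: ler_sum => x _.
rewrite /neq_pair; have [e|ne] := eqVneq x.1 x.2.
  by rewrite big1 ?mulr0 // => k _; rewrite e subrr normr0.
rewrite (bigD1 x.1) //= (bigD1 x.2) /=; last by rewrite eq_sym.
rewrite !eqxx ?[x.2 == x.1]eq_sym ?(negPf ne) subr0 sub0r normrN normr1 big1; first by lra.
by move=> k /andP[k1 k2]; rewrite [x.1 == k]eq_sym [x.2 == k]eq_sym (negPf k1) (negPf k2) subrr normr0.
Qed.

Lemma gibbs_l1_le (h : seq ('I_q * 'I_q)) (M : R) : (n.-1 <= size h)%N ->
  0 <= M ->
  (forall k, `|dev R n (map fst h) k| <= M) ->
  (forall k, `|dev R n (map snd h) k| <= M) ->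
  half_l1 (gibbs n beta (map fst h)) (gibbs n beta (map snd h)) <=
  (beta / q%:R + soft_cst * M) * (disag h / n%:R).
Proof.
move=> nh M0 M1 M2.
rewrite /half_l1 mulrC ler_pdivrMr // -mulrA.
rewrite (_ : disag h / n%:R * 2 = 2 * disag h / n%:R); last by ring.
(* The softmax estimates require a bound at most 1, and [|dev| <= 1] always holds, so [M] can be
   capped. *)
pose M' := Num.min M 1.
have M'M : M' <= M by rewrite ge_min lexx.
have M'01 : 0 <= M' <= 1 by rewrite le_min M0 ler01 /= ge_min lexx orbT.
have dM (h' : seq 'I_q) : (forall k, `|dev R n h' k| <= M) -> forall k, `|dev R n h' k| <= M'.
  by move=> H k; rewrite le_min H dev_norm_le.
have sz (f : 'I_q * 'I_q -> 'I_q) : (n.-1 <= size (map f h))%N by rewrite size_map.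
have := softmax_l1_le (ltW beta0) M'01 (sum_dev R q2 n2 (sz fst)) (sum_dev R q2 n2 (sz snd)) (dM _ M1) (dM _ M2).
rewrite card_ord -/soft_cst.
under eq_bigr do rewrite -!gibbsE //.
move=> H; apply: (le_trans H); apply: ler_pM.
- apply: addr_ge0; first by rewrite divr_ge0 // ltW.
  by apply: mulr_ge0; [exact: soft_cst_ge0|case/andP: M'01].
- exact: sumr_ge0.
- by rewrite lerD2l; apply: ler_wpM2l => //; exact: soft_cst_ge0.
- exact: dev_l1_le.
Qed.

Definition chi_cst : R := 4 * (beta / q%:R + soft_cst) ^+ 2 * q%:R * expR (2 * beta).

Lemma chi_cst_ge0 : 0 <= chi_cst.
Proof.
apply: mulr_ge0; last exact: expR_ge0.
by apply: mulr_ge0 => //; apply: mulr_ge0 => //; exact: sqr_ge0.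
Qed.

Lemma gibbs_ge (h : seq 'I_q) k : (n.-1 <= size h)%N ->
  expR (- 2 * beta) / q%:R <= gibbs n beta h k.
Proof.
move=> nh; rewrite gibbsE //.
have M01 : 0 <= (1 : R) <= 1 by rewrite ler01 lexx.
by have := softmax_ge (ltW beta0) M01 (dev_norm_le R q2 n2 h) k; rewrite card_ord.
Qed.

Lemma gibbs_chi2_le (h : seq ('I_q * 'I_q)) : (n.-1 <= size h)%N ->
  \sum_k (gibbs n beta (map snd h) k - gibbs n beta (map fst h) k) ^+ 2 /
     gibbs n beta (map fst h) k <= chi_cst * (disag h / n%:R) ^+ 2.
Proof.
move=> nh; set g := gibbs _ _ _; set g' := gibbs _ _ _.
set S := disag h / n%:R; set A := beta / q%:R + soft_cst.
have S0 : 0 <= S by rewrite divr_ge0 ?disag_ge0.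
have A0 : 0 <= A by rewrite addr_ge0 ?soft_cst_ge0 // divr_ge0 // ltW.
have l1 : \sum_k `|g k - g' k| <= 2 * A * S.
  have := @gibbs_l1_le h 1 nh ler01 (dev_norm_le R q2 n2 _) (dev_norm_le R q2 n2 _).
  rewrite mulr1 /half_l1 -/g -/A -/S.
  have -> : \sum_k `|gibbs n beta [seq x.1 | x <- h] k - gibbs n beta [seq x.2 | x <- h] k| = \sum_k `|g k - g' k|.
    by apply: eq_bigr => k _; rewrite distrC.
  lra.
have c0 : 0 < expR (- 2 * beta) / q%:R by rewrite divr_gt0 ?expR_gt0.
have gc k : (g' k)^-1 <= (expR (- 2 * beta) / q%:R)^-1.
  rewrite (lef_pV2 (gibbs_gt0 _ _ _ _ : g' k \is Num.pos) (c0 : _ \is Num.pos)).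
  by apply: gibbs_ge; rewrite size_map.
apply: (@le_trans _ _ (\sum_k (2 * A * S) * `|g k - g' k| / (expR (- 2 * beta) / q%:R))).
  apply: ler_sum => k _; apply: ler_pM => //.
  - exact: sqr_ge0.
  - by rewrite invr_ge0; exact/ltW/gibbs_gt0.
  - rewrite -(real_normK (num_real _)) expr2 ler_wpM2r //.
    apply: le_trans l1; rewrite (bigD1 k) //= lerDl; exact: sumr_ge0.
rewrite -mulr_suml -mulr_sumr ler_pdivrMr //.
have -> : chi_cst * S ^+ 2 * (expR (- 2 * beta) / q%:R) = (2 * A * S) * (2 * A * S).
  rewrite /chi_cst -/A; have : expR (2 * beta) * expR (- 2 * beta) = 1.
    by rewrite -expRD mulNr subrr expR0.
  move=> E; transitivity ((2 * A * S) * (2 * A * S) * (expR (2 * beta) * expR (- 2 * beta))); last by rewrite E mulr1.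
  by field; rewrite gt_eqF.
by apply: ler_wpM2l => //; apply: mulr_ge0 => //; exact: mulr_ge0.
Qed.

(* The last scan is coupled in one block: its two laws have chi-square
   distance of order [disag h ^ 2 / n], hence total variation of order
   [disag h / sqrt n]. *)
Lemma last_scan (h : seq ('I_q * 'I_q)) (F : seq 'I_q -> R) : (n <= size h)%N ->
  (forall l, `|F l| <= 1) ->
  `|Ex (after (gibbs n beta) (map snd h)) n F - Ex (after (gibbs n beta) (map fst h)) n F|
  <= (6 * chi_cst + 2) * ((disag h + 1) / Num.sqrt n%:R).
Proof.
move=> nh F1; set S := disag h; set r := Num.sqrt n%:R.
have r0 : 0 < r by rewrite sqrtr_gt0.
have rr : r ^+ 2 = n%:R by rewrite sqr_sqrtr.
have S0 : 0 <= S := disag_ge0 h.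
have c0 := chi_cst_ge0.
set chi := chi_cst * (S / n%:R) ^+ 2.
have chi0 : 0 <= chi by rewrite mulr_ge0 // sqr_ge0.
pose s : R := (S + 1) / r.
have s0 : 0 < s by rewrite divr_gt0 // ltr_wpDl.
set v := n%:R * chi.
have vE : v = chi_cst * (S / r) ^+ 2.
  by rewrite /v /chi -rr; field; rewrite gt_eqF.
have Sr : 0 <= S / r by rewrite divr_ge0 // ltW.
have sE : s = S / r + r^-1 by rewrite /s mulrDl mul1r.
have ir0 : 0 < r^-1 by rewrite invr_gt0.
(* For [v > 1 / 3] the right-hand side is at least the trivial bound 2: by [6 * chi_cst] if
   [S / r <= 1], by the summand 2 of the constant if not. *)
have [v1|v1] := leP v 3^-1; last first.
  apply: (@le_trans _ _ 2).
    apply: (le_trans (ler_normB _ _)).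
    have B K : stochastic K -> `|Ex K n F| <= 1.
      move=> sK; apply: (le_trans (Ex_norm _ _ sK)).
      by rewrite -(Ex_cst n 1 sK); apply: Ex_le.
    have -> : 2 = 1 + 1 :> R by ring.
    by apply: lerD; apply: B; apply: stochastic_after; exact: stochastic_gibbs.
  rewrite -/s; have [r1|r1] := leP (S / r) 1.
    have : (S / r) ^+ 2 <= S / r by rewrite expr2 ler_piMl.
    move=> /(ler_wpM2l c0); rewrite -vE => X.
    have : chi_cst * (S / r) <= chi_cst * s by rewrite ler_wpM2l // sE lerDl ltW.
    lra.
  have : 0 <= chi_cst * s by rewrite mulr_ge0 // ltW.
  rewrite sE in s0 *; lra.
have K_chi (l : seq 'I_q) : (size l < n)%N ->
   \sum_x (after (gibbs n beta) (map snd h) l x - after (gibbs n beta) (map fst h) l x) ^+ 2 /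
      after (gibbs n beta) (map fst h) l x <= chi.
  (* Inside the block both laws are compared after the same new spins [l]. Read as diagonal pairs,
     these add no disagreement and push old ones out of the window, so the one-step bound stays
     valid throughout. *)
  move=> ln; pose H := [seq (a, a) | a <- l] ++ h.
  have E1 : map fst H = l ++ map fst h by rewrite map_cat -map_comp map_id.
  have E2 : map snd H = l ++ map snd h by rewrite map_cat -map_comp map_id.
  rewrite /after -E1 -E2; apply: (le_trans (@gibbs_chi2_le H _)).
    by rewrite size_cat (leq_trans (leq_pred n)) // (leq_trans nh) // leq_addl.
  rewrite ler_wpM2l // ler_pXn2r ?nnegrE ?divr_ge0 ?disag_ge0 //.
  rewrite ler_wpM2r ?invr_ge0 // /S /disag /H take_cat size_map.
  have D0 (s' : seq 'I_q) : \sum_(x <- [seq (a, a) | a <- s']) neq_pair x = 0.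
    by rewrite big_map big1 // => a _; rewrite /neq_pair /= eqxx.
  case: ltnP => nl.
    by rewrite -map_take D0 sumr_ge0.
  rewrite big_cat /= D0 add0r -[in leRHS](subnK nl) takeD big_cat /= lerDl.
  exact: sumr_ge0.
have := @Ex_diff_le _ _ (after (gibbs n beta) (map fst h)) (after (gibbs n beta) (map snd h))
  (stochastic_after _ (stochastic_gibbs n beta q2)) (stochastic_after _ (stochastic_gibbs n beta q2))
  n chi (fun l x _ => gibbs_gt0 _ _ _ _) K_chi F s F1 s0.
move=> H; apply: (le_trans H).
have E : (1 + chi) ^+ n <= 1 + 2 * v.
  apply: (@le_trans _ _ (expR v)).
    by rewrite /v mulrC expRM_natr lerXn2r ?nnegrE ?expR_ge0 ?addr_ge0 ?expR_ge1Dx.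
  have v0 : 0 <= v by rewrite /v mulr_ge0.
  apply: (le_trans (expR_le_quad _)); first by rewrite ger0_norm.
  nra.
have E2 : ((1 + chi) ^+ n - 1) / s <= 2 * chi_cst * s.
  rewrite ler_pdivrMr //; apply: (@le_trans _ _ (2 * v)); first lra.
  have -> : 2 * chi_cst * s * s = 2 * (chi_cst * s ^+ 2) by ring.
  have s0' := ltW s0.
  rewrite vE ler_pM2l // ler_wpM2l // ler_pXn2r ?nnegrE //.
  by rewrite sE lerDl ltW.
rewrite -/s; have : 0 <= chi_cst * s by rewrite mulr_ge0 // ltW.
lra.
Qed.

End Coupling.

(** * Bounds uniform in the number of sites *)

Section Uniform.
Variables (R : realType) (q : nat) (beta rho gr gam : R).
Hypotheses (q2 : (2 <= q)%N) (beta0 : 0 < beta).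
Hypothesis a_lt1 : beta / q%:R < 1.
Hypotheses (rho01 : 0 < rho < 1) (gr0 : 0 < gr) (rg : rho * (expR gr - 1) = gr).
Hypotheses (gam0 : 0 < gam) (ag : beta / q%:R * (expR gam - 1) = gam).

Let a : R := beta / q%:R.
Let c1 : R := soft_cst q beta.
Let qR : (0 : R) < q%:R. Proof. by rewrite ltr0n ltnW. Qed.
Let a0 : 0 < a. Proof. exact: divr_gt0. Qed.
Let c10 : 0 <= c1. Proof. exact: soft_cst_ge0. Qed.

(* Of order [1 / ln n]: summable over [O(ln n)] scans, yet large enough for the
   exponential bound on fluctuations to beat every power of [n]. *)
Definition fdev d0 n : R := d0 / (2 * (1 + ln n%:R)).
Definition etan d0 n t : R := eta q n rho gr d0 (fdev d0 n) t.

Lemma ln_nat_ge0 n : 0 <= ln n%:R :> R.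
Proof.
case: n => [|n]; first by rewrite ln0.
by rewrite ln_ge0 // ler1n.
Qed.

Lemma ln1_gt0 n : 0 < 1 + ln n%:R :> R.
Proof. by rewrite ltr_pwDl // ln_nat_ge0. Qed.

Lemma fdev_gt0 d0 n : 0 < d0 -> 0 < fdev d0 n.
Proof. by move=> d00; rewrite divr_gt0 // mulr_gt0 // ln1_gt0. Qed.

Lemma fdev_le d0 n : 0 < d0 <= 1 -> fdev d0 n <= 2 / 3.
Proof.
move=> /andP[d00 d01]; rewrite ler_pdivrMr ?mulr_gt0 ?ln1_gt0 //.
have := ln_nat_ge0 n; lra.
Qed.

Lemma decay_sum_le g n t : 0 < g -> (0 < n)%N ->
  \sum_(s < t) decay g n s <= 1 + n%:R / g :> R.
Proof.
move=> g0 n0; have nR : 0 < n%:R :> R by rewrite ltr0n.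
set d := g / n%:R; have d0 : 0 < d by rewrite divr_gt0.
set x := expR (- d).
have dx (s : nat) : decay g n s = x ^+ s by rewrite /decay -/d /x expRM_natr.
under eq_bigr do rewrite dx.
have x1 : d <= (1 - x) * (1 + d).
  have : x * (1 + d) <= 1.
    by rewrite /x expRN mulrC ler_pdivrMr ?expR_gt0 // mul1r expR_ge1Dx.
  lra.
have x0 : 0 <= x := expR_ge0 _.
have S0 : 0 <= \sum_(s < t) x ^+ s by apply: sumr_ge0 => s _; exact: exprn_ge0.
have := subrX1 x t; move: S0; set S := \sum_(s < t) _ => S0 E.
have S1 : (1 - x) * S <= 1.
  have : 0 <= x ^+ t by exact: exprn_ge0.
  rewrite -(opprB x 1) mulNr -E; lra.
have : d * S <= 1 + d.
  apply: le_trans (ler_wpM2r S0 x1) _; rewrite mulrAC.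
  rewrite -[leRHS]mul1r ler_wpM2r //; lra.
have -> : n%:R / g = d^-1 by rewrite /d invf_div.
move=> H; rewrite -(ler_pM2l d0) mulrDr mulr1 mulfV ?gt_eqF //; lra.
Qed.

Lemma etanE d0 n t : etan d0 n t =
  d0 * (q%:R * (expR gr / rho * decay gr n t + (2 * (1 + ln n%:R) * (1 - rho))^-1)).
Proof.
have l0 := ln1_gt0 n; have /andP[r0 r1] := rho01.
have h1 : 1 - rho != 0 by rewrite gt_eqF // subr_gt0.
have h2 : rho != 0 by rewrite gt_eqF.
have h3 : 1 + ln n%:R != 0 :> R by rewrite gt_eqF.
by rewrite /etan /eta /fdev; field; rewrite h1 h2 h3.
Qed.

Lemma etan_ge0 d0 n t : 0 < d0 -> 0 <= etan d0 n t.
Proof. by move=> d00; apply: eta_ge0 => //; [exact: ltW|exact: fdev_gt0]. Qed.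

Definition eta_cst : R := q%:R * (expR gr / rho + (2 * (1 - rho))^-1).

Lemma eta_cst_ge0 : 0 <= eta_cst.
Proof.
have /andP[r0 r1] := rho01.
rewrite mulr_ge0 // addr_ge0 // ?invr_ge0 ?mulr_ge0 ?subr_ge0 ?expR_ge0 ?invr_ge0 //; exact: ltW.
Qed.

Lemma etan_le d0 n t : 0 < d0 -> etan d0 n t <= d0 * eta_cst.
Proof.
move=> d00; have /andP[r0 r1] := rho01; have r1' : 0 < 1 - rho by rewrite subr_gt0.
rewrite etanE ler_pM2l // /eta_cst ler_pM2l // lerD //.
  rewrite ler_piMr // ?divr_ge0 ?expR_ge0 ?(ltW r0) // -[leRHS]expR0 ler_expR.
  by rewrite mulNr oppr_le0 mulr_ge0 // divr_ge0 // ltW.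
rewrite lef_pV2 ?posrE ?mulr_gt0 ?ln1_gt0 //.
rewrite ler_pM2r // -[leLHS]mulr1 ler_pM2l // lerDl ln_nat_ge0 //.
Qed.

Definition eta_sum_cst (A : R) : R :=
  q%:R * (expR gr / rho * (1 + gr^-1) + A / (2 * (1 - rho))).

Lemma eta_sum_cst_ge0 A : 0 <= A -> 0 <= eta_sum_cst A.
Proof.
move=> A0; have /andP[r0 r1] := rho01; have r1' : 0 < 1 - rho by rewrite subr_gt0.
rewrite mulr_ge0 // addr_ge0 //; last by rewrite divr_ge0 // mulr_ge0 // ltW.
apply: mulr_ge0; first by rewrite divr_ge0 ?expR_ge0 // ltW.
by rewrite addr_ge0 // invr_ge0 ltW.
Qed.

(** The decaying part sums to [O(n)]; the constant part is of order [d0 / (1 + ln n)] over at most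
    [A * n * (1 + ln n)] steps. Both contributions are [O(d0 * n)]. *)
Lemma etan_sum_le A d0 n t : 0 < d0 -> (0 < n)%N ->
  t%:R <= A * (n%:R * (1 + ln n%:R)) ->
  (\sum_(s < t) etan d0 n s) / n%:R <= d0 * eta_sum_cst A.
Proof.
move=> d00 n0 tA; have /andP[r0 r1] := rho01; have r1' : 0 < 1 - rho by rewrite subr_gt0.
have nR : 0 < n%:R :> R by rewrite ltr0n.
have n1R : 1 <= n%:R :> R by rewrite ler1n.
under eq_bigr do rewrite etanE.
rewrite -2!mulr_sumr big_split /= -mulr_sumr sumr_const card_ord.
rewrite -[_ *+ t]mulr_natr; set D := \sum_(s < t) _; set Y := _^-1 * _.
have -> : d0 * (q%:R * (expR gr / rho * D + Y)) / n%:R =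
  d0 * (q%:R * (expR gr / rho * (D / n%:R) + Y / n%:R)) by ring.
rewrite ler_pM2l // /eta_sum_cst ler_pM2l // lerD //.
  rewrite ler_wpM2l ?divr_ge0 ?expR_ge0 ?(ltW r0) //.
  rewrite ler_pdivrMr // (le_trans (decay_sum_le _ gr0 n0)) //.
  by rewrite mulrDl mul1r [n%:R / gr]mulrC lerD.
rewrite /Y ler_pdivrMr // ler_pdivrMl; last by rewrite !mulr_gt0 // ln1_gt0.
apply: (le_trans tA); rewrite le_eqVlt; apply/orP; left; apply/eqP.
have h1 : 1 - rho != 0 by rewrite gt_eqF.
by field.
Qed.

(* [u = n ^ (1/4)] turns every comparison below into a polynomial one. *)
Lemma quartic_root n : (0 < n)%N -> exists u : R, [/\ 1 <= u, u ^+ 4 = n%:R &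
  ln n%:R <= 4 * (u - 1)].
Proof.
move=> n0; exists (expR (ln n%:R / 4)); split.
- by rewrite -[leLHS]expR0 ler_expR divr_ge0 // ln_nat_ge0.
- by rewrite -expRM_natr divfK // lnK // posrE ltr0n.
- have := expR_ge1Dx (ln n%:R / 4 : R); lra.
Qed.

Lemma bad_small (d0 A : R) : 0 < d0 -> 1 <= A -> exists N, forall n, (N <= n)%N ->
  forall t, t.+1%:R <= A * (n%:R * (1 + ln n%:R)) ->
  (n%:R : R) * (t.+1%:R * (q%:R * expR (- (fdev d0 n ^+ 2 * n%:R) / 4))) <= 1.
Proof.
move=> d00 A1; pose L := ln (A * q%:R * 4) : R.
have q1 : 1 <= q%:R :> R by rewrite ler1n ltnW.
have Aq : 1 <= A * q%:R * 4 by nra.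
have L0 : 0 <= L by rewrite ln_ge0.
(* For [u >= u0] the exponent is at least [(L + 13) * u >= L + 13 * u], whereas the quantity to beat
   is at most [expR L * u ^ 9]. *)
pose u0 : R := (L + 13) * 256 / d0 ^+ 2.
have u00 : 0 <= u0.
  by apply: divr_ge0; [apply: mulr_ge0 => //; apply: addr_ge0|exact: sqr_ge0].
exists (Num.bound (u0 ^+ 4)).+1 => n nN t tA.
have n0 : (0 < n)%N by exact: leq_trans nN.
have [u [u1 u4 lnu]] := quartic_root n0.
have uu0 : u0 <= u.
  have : u0 ^+ 4 <= u ^+ 4.
    rewrite u4; apply: le_trans (ltW (archi_boundP (exprn_ge0 4 u00))) _.
    by rewrite ler_nat (leq_trans (leqnSn _)).
  by rewrite ler_pXn2r // nnegrE //; lra.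
have l0 := ln_nat_ge0 n.
set F := fdev d0 n ^+ 2 * n%:R / 4.
have F1 : d0 ^+ 2 * u ^+ 2 / 256 <= F.
  rewrite /F /fdev -[X in _ * X / 4]u4 expr_div_n.
  have -> : d0 ^+ 2 / (2 * (1 + ln n%:R)) ^+ 2 * u ^+ 4 / 4 =
     d0 ^+ 2 * u ^+ 2 * (u ^+ 2 / (16 * (1 + ln n%:R) ^+ 2)).
    by field; rewrite gt_eqF // ltr_pwDl.
  rewrite ler_wpM2l ?(mulr_ge0 (sqr_ge0 _) (sqr_ge0 _)) //.
  rewrite ler_pdivlMr; last by rewrite mulr_gt0 // exprn_gt0 // ltr_pwDl.
  have : (1 + ln n%:R) ^+ 2 <= (4 * u) ^+ 2.
    by rewrite ler_pXn2r ?nnegrE //; lra.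
  rewrite exprMn; lra.
have F2 : L + 13 * u <= F.
  apply: le_trans F1.
  have : (L + 13) * u <= d0 ^+ 2 * u ^+ 2 / 256.
    have E : d0 ^+ 2 * u0 / 256 = L + 13.
      by rewrite /u0; field; rewrite gt_eqF.
    rewrite -E; have : d0 ^+ 2 * (u0 * u) <= d0 ^+ 2 * (u * u).
      by rewrite ler_wpM2l ?sqr_ge0 // ler_wpM2r // (le_trans _ u1).
    rewrite [u ^+ 2]expr2; lra.
  apply: le_trans; nra.
have tu : t.+1%:R <= A * (4 * u ^+ 5).
  apply: (le_trans tA); rewrite ler_pM2l; last by lra.
  rewrite -u4; have u40 : 0 <= u ^+ 4 by rewrite exprn_ge0 //; lra.
  rewrite (_ : 4 * u ^+ 5 = u ^+ 4 * (4 * u)); last ring.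
  by rewrite ler_wpM2l // {1}u4; lra.
have E9 : u ^+ 9 <= expR (13 * u).
  apply: (@le_trans _ _ (expR (u * 9%:R))); last by rewrite ler_expR; lra.
  rewrite expRM_natr ler_pXn2r ?nnegrE ?expR_ge0 //; last lra.
  have := expR_ge1Dx u; lra.
have EF : A * q%:R * 4 * u ^+ 9 <= expR F.
  apply: (@le_trans _ _ (expR (L + 13 * u))); last by rewrite ler_expR.
  rewrite expRD /L lnK ?posrE //; last lra.
  by rewrite ler_wpM2l //; lra.
rewrite (_ : - _ / 4 = - F); last by rewrite /F; ring.
rewrite expRN !mulrA ler_pdivrMr ?expR_gt0 // mul1r.
apply: le_trans EF; rewrite -u4.
rewrite (_ : A * q%:R * 4 * u ^+ 9 = u ^+ 4 * (A * (4 * u ^+ 5)) * q%:R); last by ring.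
rewrite ler_wpM2r // ler_wpM2l // exprn_ge0 //; lra.
Qed.

Lemma ln_nat_unbounded (M : R) : exists N, forall n, (N <= n)%N -> M <= ln n%:R :> R.
Proof.
exists (Num.bound (expR M)).+1 => n nN.
rewrite -[leLHS]expRK ler_ln ?posrE ?expR_gt0 ?ltr0n ?(leq_trans _ nN) //.
apply: le_trans (ltW (archi_boundP (expR_ge0 M))) _.
by rewrite ler_nat (leq_trans (leqnSn _)).
Qed.

(** Since [gronwall] requires small relative errors, it is started after [k0] scans, a number that
    depends neither on [n] nor on [d0]. *)
Lemma etan_small (e : R) : 0 < e -> exists k0 N, (0 < k0)%N /\
  forall d0 n t, 0 < d0 <= 1 -> (N <= n)%N -> (0 < n)%N -> (k0 * n <= t)%N ->
    etan d0 n t <= e.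
Proof.
move=> e0; have /andP[r0 r1] := rho01; have r1' : 0 < 1 - rho by rewrite subr_gt0.
pose x : R := 2 * q%:R * expR gr / rho / e.
have x0 : 0 < x by rewrite !divr_gt0 // !mulr_gt0 // expR_gt0.
pose k0 := (Num.bound (x / gr)).+1.
have [N NP] := ln_nat_unbounded (q%:R / (1 - rho) / e).
exists k0, N; split=> // d0 n t /andP[d00 d01] nN n0 kt.
have nR : 0 < n%:R :> R by rewrite ltr0n.
rewrite etanE; apply: (@le_trans _ _ (q%:R * (expR gr / rho * decay gr n t + (2 * (1 + ln n%:R) * (1 - rho))^-1))).
  rewrite ler_piMl // mulr_ge0 // addr_ge0 //.
    by rewrite mulr_ge0 ?(ltW (decay_gt0 _ _ _)) // divr_ge0 ?expR_ge0 // ltW.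
  by rewrite invr_ge0 !mulr_ge0 // ltW // ln1_gt0.
have D : decay gr n t <= x^-1.
  rewrite /decay mulNr expRN lef_pV2 ?posrE ?expR_gt0 //.
  apply: (@le_trans _ _ (expR (gr * k0%:R))); last first.
    rewrite ler_expR mulrAC -mulrA ler_pM2l // ler_pdivlMr // -natrM ler_nat.
    by [].
  apply: le_trans (expR_ge1Dx _); apply: (@le_trans _ _ (gr * k0%:R)); last by rewrite lerDr.
  rewrite mulrC -ler_pdivrMr //.
  apply: le_trans (ltW (archi_boundP _)) _; first by rewrite divr_ge0 ?ltW.
  by rewrite ler_nat.
have L := NP n nN.
have l0 := ln_nat_ge0 n; have l1 := ln1_gt0 n.
have -> : e = q%:R * (expR gr / rho * x^-1 + e / (2 * q%:R)).
  by rewrite /x; field; rewrite !gt_eqF ?expR_gt0.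
rewrite ler_pM2l // lerD //; first by rewrite ler_wpM2l // divr_ge0 ?expR_ge0 // ltW.
rewrite -[X in X <= _]mul1r ler_pdivrMr; last by rewrite !mulr_gt0.
move: L; rewrite ler_pdivrMr // ler_pdivrMr // => L.
have -> : e / (2 * q%:R) * (2 * (1 + ln n%:R) * (1 - rho)) =
  ((1 + ln n%:R) * e * (1 - rho)) / q%:R by field; rewrite gt_eqF.
rewrite ler_pdivlMr // mul1r; apply: (le_trans L).
by rewrite ler_wpM2r ?(ltW r1') // ler_wpM2r ?(ltW e0) // lerDr.
Qed.

Lemma decay_window_le n t (i : 'I_n.-1) : (0 < n)%N -> (n.-1 <= t)%N ->
  decay gam n (t - i.+1) <= expR gam * decay gam n t.
Proof.
move=> n0 nt; have it : (i.+1 <= t)%N by apply: leq_trans (ltn_ord i) nt.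
rewrite decayB // mulrC ler_wpM2r ?(ltW (decay_gt0 _ _ _)) //.
rewrite -expRM_natr ler_expR -mulrA ler_piMr ?(ltW gam0) //.
rewrite mulrC ler_pdivrMr ?ltr0n // mul1r ler_nat.
by apply: leq_trans (ltn_ord i) (leq_pred n).
Qed.

(** The first [k0] scans cost a factor [expR (gam * k0)] and the errors the exponential of their
    bounded sum. Hence [C] may depend on [A], but not on [n], [d0] or [T]. *)
Lemma recursion_bound (A : R) : 0 <= A -> exists C, 0 < C /\ exists k0 N, (0 < k0)%N /\
  forall d0 n T (b B : R) (z : nat -> R), 0 < d0 <= 1 -> (N <= n)%N ->
  T.+1%:R <= A * (n%:R * (1 + ln n%:R)) -> 0 <= b -> 0 <= B ->
  (forall t, 0 <= z t) -> (forall t, (t < k0 * n)%N -> (t <= T)%N -> z t <= B) ->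
  (forall t, (k0 * n <= t <= T)%N ->
    z t <= (a + c1 * etan d0 n t) / n%:R * \sum_(i < n.-1) z (t - i.+1)%N + b) ->
  (forall t, (t <= T)%N -> z t <= C * (B * decay gam n t + b)) /\
  (forall t, (n.-1 <= t <= T)%N ->
     (\sum_(i < n.-1) z (t - i.+1)%N) / n%:R <= C * (B * decay gam n t + b)).
Proof.
(* For [et = c1 / a * etan], the first entry gives [8 / a * et <= 1] and the second
   [a * (1 + et) <= (1 + a) / 2 < 1]. Dividing by [c1 + 1] avoids a division by zero. *)
move=> A0; pose e : R := Num.min (a ^+ 2 / 8 / (c1 + 1)) ((1 - a) / 2 / (c1 + 1)).
have c1p : 0 < c1 + 1 by rewrite ltr_wpDl.
have a1 : 0 < 1 - a by rewrite subr_gt0.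
have e0 : 0 < e by rewrite lt_min !divr_gt0 // exprn_gt0.
have [k0 [N [k00 NP]]] := etan_small e0.
pose C0 : R := expR (gam * k0%:R) * expR (8 / a * (c1 / a) * eta_sum_cst A) + (1 - (1 + a) / 2)^-1.
have a1' : 0 < 1 - (1 + a) / 2 by lra.
have C00 : 0 < C0 by rewrite addr_gt0 ?invr_gt0 // mulr_gt0 ?expR_gt0.
have eg : 1 <= expR gam by rewrite -[leLHS]expR0 ler_expR ltW.
exists (expR gam * C0); split; first by rewrite mulr_gt0 ?expR_gt0.
exists k0, (maxn N 2); split=> // d0 n T b B z d0P; rewrite geq_max => /andP[nN n2] TA b0 B0 z0 zB zrec.
have /andP[d00 d01] := d0P.
have n0 : (0 < n)%N by exact: ltnW.
have nR : 0 < n%:R :> R by rewrite ltr0n.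
have small t : (k0 * n <= t)%N -> etan d0 n t <= e by move=> *; exact: NP.
have ce t : (k0 * n <= t)%N -> c1 * etan d0 n t <= a ^+ 2 / 8 /\ c1 * etan d0 n t <= (1 - a) / 2.
  move=> kt; have et := small t kt; have et0 := @etan_ge0 d0 n t d00.
  have H (y : R) : e <= y / (c1 + 1) -> c1 * etan d0 n t <= y.
    move=> ey; apply: (@le_trans _ _ ((c1 + 1) * etan d0 n t)).
      by rewrite mulrDl mul1r lerDl.
    by rewrite mulrC -ler_pdivlMr // (le_trans et).
  by split; apply: H; rewrite /e ge_min lexx ?orbT.
pose et t := c1 / a * etan d0 n t.
pose z' t := if (t <= T)%N then z t else 0.
have ca0 : 0 <= c1 / a by rewrite divr_ge0 // ltW.
have z'0 t : 0 <= z' t by rewrite /z'; case: ifP.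
have G : forall t, z' t <= B * expR (gam * k0%:R) * decay gam n t *
   expR (8 / a / n%:R * \sum_(s < t.+1) et s) + b / (1 - (1 + a) / 2).
  apply: (@gronwall R n (k0 * n) a) => //.
  - by apply: leq_trans (leq_pred n) _; rewrite leq_pmull.
  - by rewrite /a ag.
  - move=> s t st; rewrite /et ler_wpM2l //; apply: eta_nincr => //.
      exact: ltW.
  - by move=> t; rewrite /et mulr_ge0 // etan_ge0.
  - move=> t kt; have [H _] := ce t kt; rewrite /et.
    rewrite (_ : 8 / a * _ = c1 * etan d0 n t / (a ^+ 2 / 8)); last by field; rewrite gt_eqF.
    by rewrite ler_pdivrMr ?mul1r // divr_gt0 // exprn_gt0.
  - move=> t kt; have [_ H] := ce t kt; rewrite /et.
    rewrite (_ : a * (1 + _) = a + c1 * etan d0 n t); last by field; rewrite gt_eqF.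
    lra.
  - lra.
  - by rewrite mulr_ge0 // expR_ge0.
  - move=> t tk; rewrite /z'; have Z : 1 <= expR (gam * k0%:R) * decay gam n t.
      rewrite /decay -expRD -[leLHS]expR0 ler_expR.
      rewrite mulNr subr_ge0 mulrAC -mulrA ler_pM2l // ler_pdivrMr // -natrM ler_nat.
      exact: ltnW.
    case: ifP => tT; last by rewrite -mulrA mulr_ge0 // (le_trans ler01).
    by rewrite (le_trans (zB _ tk tT)) // -mulrA ler_peMr.
  move=> t kt; have S0 : 0 <= a * (1 + et t) / n%:R * (\sum_(i < n.-1) z' (t - i.+1)%N).
    rewrite mulr_ge0 ?sumr_ge0 // divr_ge0 // mulr_ge0 ?(ltW a0) // addr_ge0 //.
    by rewrite mulr_ge0 // etan_ge0.
  rewrite {1}/z'; case: ifP => tT; last by rewrite addr_ge0.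
  apply: (le_trans (zrec _ _)); first by rewrite kt.
  rewrite lerD2r /et (_ : a * (1 + _) = a + c1 * etan d0 n t); last by field; rewrite gt_eqF.
  apply: ler_wpM2l.
    apply: divr_ge0 => //; apply: addr_ge0; first exact: ltW.
    by apply: mulr_ge0 => //; exact: etan_ge0.
  by apply: ler_sum => i _; rewrite /z' (leq_trans (leq_subr _ _) tT).
have Z t : (t <= T)%N -> z t <= C0 * (B * decay gam n t + b).
  move=> tT; have := G t; rewrite {1}/z' tT => H; apply: (le_trans H).
  have D0 := decay_gt0 gam n t.
  have S : 8 / a / n%:R * \sum_(s < t.+1) et s <= 8 / a * (c1 / a) * eta_sum_cst A.
    rewrite /et -mulr_sumr.
    rewrite (_ : _ * (_ * _) = 8 / a * (c1 / a) * ((\sum_(s < t.+1) etan d0 n s) / n%:R)); last by ring.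
    rewrite ler_wpM2l //; first by rewrite mulr_ge0 // divr_ge0 // ltW.
    apply: (@le_trans _ _ (d0 * eta_sum_cst A)); last first.
      by rewrite ler_piMl // eta_sum_cst_ge0.
    apply: etan_sum_le => //; apply: le_trans TA; by rewrite ler_nat.
  have E : expR (8 / a / n%:R * \sum_(s < t.+1) et s) <= expR (8 / a * (c1 / a) * eta_sum_cst A).
    by rewrite ler_expR.
  have X : 0 <= B * expR (gam * k0%:R) * decay gam n t.
    by rewrite !mulr_ge0 ?expR_ge0 // ltW.
  have := ler_wpM2l X E; rewrite /C0.
  set x1 := expR (gam * k0%:R) in X *; set x2 := expR _; set y := (1 - (1 + a) / 2)^-1.
  set x3 := expR _ => Y.
  rewrite mulrDr !mulrDl; apply: lerD.
    apply: (le_trans Y); rewrite (_ : B * x1 * decay gam n t * x3 = x1 * x3 * (B * decay gam n t)); last by ring.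
    by rewrite lerDl !mulr_ge0 ?invr_ge0 // ltW.
  by rewrite mulrC lerDr mulr_ge0 // mulr_ge0 ?expR_ge0.
split=> t tT.
  apply: (le_trans (Z t tT)); rewrite -mulrA ler_peMl // mulr_ge0 ?(ltW C00) //.
  by rewrite addr_ge0 // mulr_ge0 // ltW // decay_gt0.
have /andP[nt tT'] := tT.
rewrite ler_pdivrMr //.
set V := _ * (_ + b).
apply: (@le_trans _ _ (\sum_(i < n.-1) V)).
  apply: ler_sum => i _; apply: (le_trans (Z _ (leq_trans (leq_subr _ _) tT'))).
  rewrite /V -mulrA mulrCA ler_pM2l // mulrDr lerD //; last by rewrite ler_peMl.
  by rewrite mulrCA ler_wpM2l // decay_window_le.
rewrite sumr_const card_ord -[leLHS]mulr_natr ler_wpM2l ?ler_nat ?leq_pred //.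
rewrite /V mulr_ge0 //; first by rewrite mulr_ge0 ?expR_ge0 // ltW.
by rewrite addr_ge0 // mulr_ge0 // ltW // decay_gt0.
Qed.

End Uniform.

Section CoupledKernel.
Variables (R : realType) (I : finType) (K K' : seq I -> I -> R).
Hypotheses (sK : stochastic K) (sK' : stochastic K').

Definition ckernel (h : seq (I * I)) : I * I -> R :=
  max_coupling (K (map fst h)) (K' (map snd h)).

Lemma ckernel_sum h : \sum_k K (map fst h) k = \sum_k K' (map snd h) k.
Proof. by rewrite sK.2 sK'.2. Qed.

Lemma ckernel_fst h u : \sum_(x | x.1 == u) ckernel h x = K (map fst h) u.
Proof. by apply: max_coupling_fst; exact: ckernel_sum. Qed.

Lemma ckernel_snd h u : \sum_(x | x.2 == u) ckernel h x = K' (map snd h) u.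
Proof. by apply: max_coupling_snd; exact: ckernel_sum. Qed.

Lemma stochastic_ckernel : stochastic ckernel.
Proof.
split=> [h x|h].
  by apply: max_coupling_ge0 => k; [exact: sK.1|exact: sK'.1].
rewrite (partition_big fst xpredT) //= -(sK.2 (map fst h)).
by apply: eq_bigr => u _; exact: ckernel_fst.
Qed.

Lemma Ex_ckernel_fst t f : Ex ckernel t (fun h => f (map fst h)) = Ex K t f.
Proof. by apply: Ex_map => h u; exact: ckernel_fst. Qed.

Lemma Ex_ckernel_snd t f : Ex ckernel t (fun h => f (map snd h)) = Ex K' t f.
Proof. by apply: Ex_map => h u; exact: ckernel_snd. Qed.

End CoupledKernel.

Lemma stochastic_le1 (R : realType) (T : finType) (K : seq T -> T -> R) h k :
  stochastic K -> K h k <= 1.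
Proof.
move=> [K0 K1]; rewrite -(K1 h) (bigD1 k) //= lerDl.
by apply: sumr_ge0 => j _; exact: K0.
Qed.

(** * Upper bound: expected disagreements *)

Section Upper.
Variables (R : realType) (q : nat) (beta rho gr gam : R).
Hypotheses (q2 : (2 <= q)%N) (beta0 : 0 < beta).
Hypothesis a_lt1 : beta / q%:R < 1.
Hypotheses (rho01 : 0 < rho < 1) (gr0 : 0 < gr) (rg : rho * (expR gr - 1) = gr).
Hypothesis rho_contract : forall y, y < 1 - q%:R^-1 ->
  spin_prob q (beta * y) - q%:R^-1 <= rho * Num.max 0 y.
Hypotheses (gam0 : 0 < gam) (ag : beta / q%:R * (expR gam - 1) = gam).

Lemma nEx_bad_le1 d0 n f t (K : seq 'I_q -> 'I_q -> R) : 0 < d0 <= 1 -> stochastic K ->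
  f = fdev d0 n ->
  n%:R * (t.+1%:R * (q%:R * expR (- (f ^+ 2 * n%:R) / 4))) <= 1 ->
  n%:R * Ex K t (bad n f K) <= 1.
Proof.
move=> d0P sK fE; apply: le_trans; rewrite ler_wpM2l //.
have /andP[d00 _] := d0P.
apply: Ex_bad => //; rewrite fE; first exact: fdev_gt0.
exact: fdev_le.
Qed.

Lemma upper_pair (A : R) : 1 <= A -> exists C : R, 0 < C /\ exists N, forall n t,
  (N <= n)%N -> (n <= t)%N -> t.+1%:R <= A * (n%:R * (1 + ln n%:R)) ->
  forall K1 K2 : seq 'I_q -> 'I_q -> R, stochastic K1 -> stochastic K2 ->
  (forall h, (n <= size h)%N -> K1 h =1 gibbs n beta h) ->
  (forall h, (n <= size h)%N -> K2 h =1 gibbs n beta h) ->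
  forall F : seq 'I_q -> R, (forall l, `|F l| <= 1) ->
  `|Ex K1 t (fun h => Ex (after (gibbs n beta) h) n F)
    - Ex K2 t (fun h => Ex (after (gibbs n beta) h) n F)|
  <= C * (Num.sqrt n%:R * decay gam n t + (Num.sqrt n%:R)^-1).
Proof.
move=> A1; have A0 : 0 <= A by exact: le_trans A1.
have [C0 [C00 [k0 [N0 [k00 H0]]]]] :=
  recursion_bound q2 beta0 a_lt1 rho01 gr0 gam0 ag A0.
have [N1 H1] := bad_small q2 (ltr01 : 0 < (1 : R)) A1.
set c1 := soft_cst q beta in H0; have c10 : 0 <= c1 by exact: soft_cst_ge0.
pose D : R := 6 * chi_cst q beta + 2.
have D0 : 0 < D by have := chi_cst_ge0 q beta; rewrite /D; lra.
pose C : R := D * (C0 * (1 + 2 * c1) + 1).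
have C0c : 0 <= C0 * (1 + 2 * c1) by rewrite mulr_ge0 ?(ltW C00) //; lra.
exists C; split; first by rewrite mulr_gt0 // ltr_wpDl.
exists (maxn N0 (maxn N1 2)) => n t; rewrite !geq_max => /and3P[nN0 nN1 n2] nt tA.
move=> K1 K2 sK1 sK2 K1g K2g F F1.
have nR : 0 < n%:R :> R by rewrite ltr0n ltnW.
pose KK := ckernel K1 K2; have sKK : stochastic KK by exact: stochastic_ckernel.
pose e := @neq_pair R q; pose f := fdev (1 : R) n.
have d0P : 0 < (1 : R) <= 1 by rewrite ltr01 lexx.
have f0 : 0 < f by exact: fdev_gt0.
have K_init (K : seq 'I_q -> 'I_q -> R) : stochastic K ->
    forall h k, (size h < n)%N -> K h k - q%:R^-1 <= 1.
  move=> sK h k _; have := stochastic_le1 h k sK.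
  have : 0 <= q%:R^-1 :> R by rewrite invr_ge0.
  lra.
have meanle h : mean KK e h <= half_l1 (K1 (map fst h)) (K2 (map snd h)).
  by apply: max_coupling_neq; rewrite sK1.2 sK2.2.
have mean0 h : 0 <= mean KK e h by apply: sumr_ge0 => x _; rewrite mulr_ge0 // sKK.1.
have mean1 h : mean KK e h <= 1.
  rewrite -(sKK.2 h); apply: ler_sum => x _; rewrite ler_piMr ?sKK.1 //.
  by rewrite /e /neq_pair lern1 leq_b1.
(* With the factor [n], the expected disagreements in the window are [1 / n] times a sum of past
   [z], and the two [bad] terms, of expectation at most [1 / n] each, become the constant source
   [2 * c1]. *)
pose z s := n%:R * Ex KK s (mean KK e).
have ES s : (n.-1 <= s)%N -> Ex KK s (disag R n) = (\sum_(i < n.-1) z (s - i.+1)%N) / n%:R.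
  by move=> ns; rewrite /disag (Ex_window _ sKK ns) /z -mulr_sumr mulrAC mulfV ?gt_eqF ?mul1r.
have bad1 (K : seq 'I_q -> 'I_q -> R) s : stochastic K -> (s <= t)%N -> n%:R * Ex K s (bad n f K) <= 1.
  move=> sK st; apply: (nEx_bad_le1 d0P sK erefl).
  by apply: H1 => //; apply: le_trans tA; rewrite ler_nat.
have rec s : (k0 * n <= s <= t)%N -> z s <=
    (beta / q%:R + c1 * etan q rho gr 1 n s) / n%:R * \sum_(i < n.-1) z (s - i.+1)%N + 2 * c1.
  move=> /andP[ks st].
  have ns : (n <= s)%N by apply: leq_trans ks; rewrite leq_pmull.
  have ns' : (n.-1 <= s)%N by apply: leq_trans ns; exact: leq_pred.
  set et := etan q rho gr 1 n s; set al := beta / q%:R + c1 * et.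
  have et0 : 0 <= et by exact: etan_ge0.
  pose b1 (h : seq ('I_q * 'I_q)) := bad n f K1 (map fst h).
  pose b2 (h : seq ('I_q * 'I_q)) := bad n f K2 (map snd h).
  have P h : size h = s -> mean KK e h <= al / n%:R * disag R n h + c1 * (b1 h + b2 h).
    move=> sh; apply: (le_trans (meanle h)).
    have nh : (n <= size h)%N by rewrite sh.
    have -> : half_l1 (K1 (map fst h)) (K2 (map snd h)) =
       half_l1 (gibbs n beta (map fst h)) (gibbs n beta (map snd h)).
      by congr (_ * _); apply: eq_bigr => k _; rewrite K1g ?K2g // size_map.
    have b10 : 0 <= b1 h by exact: bad_ge0.
    have b20 : 0 <= b2 h by exact: bad_ge0.
    have M1 k : `|dev R n (map fst h) k| <= et + (b1 h + b2 h).
      have := dev_bound q2 n2 rho01 gr0 rg rho_contract ler01 f0 K1g (K_init _ sK1)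
        (h := map fst h) k.
      rewrite size_map sh => /(_ ns) H; apply: (le_trans H).
      by rewrite lerD2l lerDl.
    have M2 k : `|dev R n (map snd h) k| <= et + (b1 h + b2 h).
      have := dev_bound q2 n2 rho01 gr0 rg rho_contract ler01 f0 K2g (K_init _ sK2)
        (h := map snd h) k.
      rewrite size_map sh => /(_ ns) H; apply: (le_trans H).
      by rewrite lerD2l lerDr.
    have nh' : (n.-1 <= size h)%N by rewrite sh.
    have M0 : 0 <= et + (b1 h + b2 h) by rewrite !addr_ge0.
    have := gibbs_l1_le q2 n2 beta0 nh' M0 M1 M2; rewrite -/c1 => H; apply: (le_trans H).
    have S1 : disag R n h / n%:R <= 1 by rewrite ler_pdivrMr // mul1r disag_le.
    have S0 : 0 <= disag R n h / n%:R by rewrite divr_ge0 // disag_ge0.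
    rewrite /al mulrDr addrA mulrDl [X in _ + X <= _]mulrC.
    rewrite [_ / n%:R * disag R n h]mulrAC -[_ * disag R n h / _]mulrA lerD2l.
    by rewrite ler_piMl // mulr_ge0 // addr_ge0.
  rewrite /z; apply: (@le_trans _ _ (n%:R * Ex KK s (fun h => al / n%:R * disag R n h + c1 * (b1 h + b2 h)))).
    by rewrite ler_wpM2l //; apply: Ex_le.
  rewrite ExD !ExZ ExD Ex_ckernel_fst // Ex_ckernel_snd // ES //.
  have B1 := bad1 _ _ sK1 st; have B2 := bad1 _ _ sK2 st.
  set E1 := Ex K1 s _ in B1 *; set E2 := Ex K2 s _ in B2 *; set Z := \sum_(i < n.-1) z _.
  rewrite mulrDr; apply: lerD.
    by rewrite le_eqVlt; apply/orP; left; apply/eqP; field; rewrite gt_eqF.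
  rewrite mulrCA mulrDr [2 * c1]mulrC ler_wpM2l //; lra.
have z0 s : 0 <= z s by rewrite /z mulr_ge0 // Ex_ge0.
have zn s : (s < k0 * n)%N -> (s <= t)%N -> z s <= n%:R.
  by move=> _ _; rewrite /z ler_piMr // -(Ex_cst s 1 sKK); apply: Ex_le.
have c12 : 0 <= 2 * c1 by rewrite mulr_ge0.
have [_ Hz] := H0 1 n t (2 * c1) n%:R z d0P nN0 tA c12 (ltW nR) z0 zn rec.
have nt' : (n.-1 <= t)%N by apply: leq_trans nt; exact: leq_pred.
have := Hz t; rewrite nt' leqnn => /(_ isT); rewrite -(ES _ nt') => HS.
pose u h := Ex (after (gibbs n beta) h) n F.
rewrite -/(u _) -(Ex_ckernel_fst sK1 sK2 t u) -(Ex_ckernel_snd sK1 sK2 t u) -ExB.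
apply: (le_trans (Ex_norm _ _ sKK)).
set r := Num.sqrt n%:R in HS *.
have r0 : 0 < r by rewrite sqrtr_gt0.
have rr : r ^+ 2 = n%:R by rewrite sqr_sqrtr.
apply: (@le_trans _ _ (Ex KK t (fun h => D / r * (disag R n h + 1)))).
  apply: Ex_le => // h sh; rewrite distrC.
  have := @last_scan _ _ _ _ q2 n2 beta0 h F; rewrite sh => /(_ nt F1) H.
  by apply: (le_trans H); rewrite mulrA -/r mulrAC.
rewrite ExZ ExD Ex_cst //.
have Dr : 0 <= D / r by rewrite divr_ge0 // ltW.
have d00 := decay_gt0 gam n t.
apply: (le_trans (ler_wpM2l Dr (lerD HS (lexx 1)))).
rewrite /C.
have -> : D / r * (C0 * (n%:R * decay gam n t + 2 * c1) + 1) =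
  D * (C0 * (r * decay gam n t)) + D * (C0 * (2 * c1) + 1) / r.
  by rewrite -rr; field; rewrite gt_eqF.
have X1 : 0 <= r * decay gam n t by rewrite mulr_ge0 // ltW.
have X2 : 0 <= r^-1 by rewrite invr_ge0 ltW.
have Y1 : 0 <= D * (C0 * (2 * c1) + 1) * (r * decay gam n t).
  by rewrite mulr_ge0 // mulr_ge0 ?(ltW D0) // addr_ge0 // mulr_ge0 // ltW.
have Y2 : 0 <= D * C0 * r^-1 by rewrite !mulr_ge0 // ltW.
lra.
Qed.

End Upper.

(** * The eigenfunction of the linear recursion *)

Section Eigenfunction.
Variables (R : realType) (q n : nat) (beta gam : R) (i0 i1 : 'I_q).
Hypotheses (q2 : (2 <= q)%N) (n2 : (2 <= n)%N) (beta0 : 0 < beta).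
Hypotheses (i01 : i0 != i1).
Hypotheses (gam0 : 0 < gam) (ag : beta / q%:R * (expR gam - 1) = gam).
Implicit Types (h : seq 'I_q).

Let a : R := beta / q%:R.
Let qR : (0 : R) < q%:R. Proof. by rewrite ltr0n ltnW. Qed.
Let nR : (0 : R) < n%:R. Proof. by rewrite ltr0n ltnW. Qed.
Let a0 : 0 < a. Proof. exact: divr_gt0. Qed.
Let n0 : (0 < n)%N. Proof. exact: ltnW. Qed.

(** The conditional mean of this difference is a difference of two softmax values, to which the
    relative error bound of [softmax_sub_le] applies. *)
Definition spin_diff (x : 'I_q) : R := (x == i0)%:R - (x == i1)%:R.

Definition sdiff h : R := \sum_(x <- take n.-1 h) spin_diff x.

(* Left eigenvector of the window shift with eigenvalue [expR (- (gam / n))], up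
   to a relative error [O(1 / n)] in [weight 0]. *)
Definition weight (i : nat) : R :=
  a / n%:R * \sum_(j < n.-1 - i) expR (gam / n%:R) ^+ j.+1.

Definition Phi h : R := \sum_(i < n.-1) weight i * (map spin_diff h)`_i.

Lemma spin_diff_norm x : `|spin_diff x| <= 1.
Proof.
rewrite /spin_diff; have [->|] := eqVneq x i0.
  by rewrite (negPf i01) subr0 normr1.
by case: (x == i1) => _; rewrite sub0r normrN ?normr0 ?normr1.
Qed.

Lemma sdiffE h : sdiff h = (cnt n h i0)%:R - (cnt n h i1)%:R.
Proof. by rewrite !cnt_sum -sumrB. Qed.

Lemma sdiff_dev h : sdiff h = n%:R * (dev R n h i0 - dev R n h i1).
Proof. by rewrite sdiffE /dev; field; rewrite !gt_eqF. Qed.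

Lemma sdiff_norm_le h : `|sdiff h| <= n%:R.
Proof.
have H (j : 'I_q) : (cnt n h j)%:R <= n%:R :> R.
  by rewrite ler_nat (leq_trans (cnt_le n h j)) // leq_pred.
have := H i0; have := H i1.
rewrite sdiffE ler_norml; have : 0 <= (cnt n h i0)%:R :> R by [].
have : 0 <= (cnt n h i1)%:R :> R by [].
by move=> *; apply/andP; split; lra.
Qed.

Lemma weight_ge0 i : 0 <= weight i.
Proof.
apply: mulr_ge0; first by rewrite divr_ge0 // ltW.
by apply: sumr_ge0 => j _; rewrite exprn_ge0 // expR_ge0.
Qed.

Lemma weight_out i : (n.-1 <= i)%N -> weight i = 0.
Proof. by move=> ni; rewrite /weight (eqP ni) big_ord0 mulr0. Qed.

Lemma weight_rec i : (i < n.-1)%N ->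
  weight i.+1 = expR (- (gam / n%:R)) * weight i - a / n%:R.
Proof.
move=> im; rewrite /weight.
have -> : (n.-1 - i = (n.-1 - i.+1).+1)%N by rewrite subnS prednK // subn_gt0.
set x := expR (gam / n%:R); set m := (n.-1 - i.+1)%N.
have x0 : x != 0 by rewrite gt_eqF ?expR_gt0.
rewrite big_ord_recl /= expr1 expRN -/x.
under [in RHS]eq_bigr do rewrite /bump /= add1n exprS.
rewrite -[in RHS]mulr_sumr; field.
by rewrite x0 gt_eqF.
Qed.

Lemma geo_split (x : R) : \sum_(i < n) x ^+ i = 1 + \sum_(j < n.-1) x ^+ j.+1.
Proof.
rewrite -(big_mkord xpredT (fun i => x ^+ i)) -[in LHS](prednK n0).
by rewrite big_nat_recl // expr0 big_mkord.
Qed.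

Lemma weight0_le1 : weight 0 <= 1.
Proof.
have := decay_geo n0 gam0 a0; rewrite /a ag lexx => /(_ isT); apply: le_trans.
apply: ler_wpM2l; first by rewrite divr_ge0 // ltW.
by rewrite subn0 geo_split ler_wpDl.
Qed.

Lemma weight_nincr i : weight i.+1 <= weight i.
Proof.
have [im|im] := ltnP i n.-1; last by rewrite !weight_out // (leq_trans im).
apply: ler_wpM2l; first by rewrite divr_ge0 // ltW.
have -> : (n.-1 - i = (n.-1 - i.+1).+1)%N by rewrite subnS prednK // subn_gt0.
by rewrite big_ord_recr /= lerDl exprn_ge0 // expR_ge0.
Qed.

Lemma weight_le1 i : weight i <= 1.
Proof.
elim: i => [|i IH]; first exact: weight0_le1.
exact: le_trans (weight_nincr i) IH.
Qed.

Lemma weight0_ge : 3 * gam <= n%:R -> 1 - (gam + a) / n%:R <= weight 0.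
Proof.
move=> gn; have := decay_geo_ge n0 gam0 gn a0 ag.
rewrite /weight subn0 geo_split mulrDr mulr1.
rewrite mulrDl; set y := _ * \sum_(i < n.-1) _; lra.
Qed.

Lemma weight_ge i : (i <= n.-1)%N -> a / n%:R * (n.-1 - i)%:R <= weight i.
Proof.
move=> im; apply: ler_wpM2l; first by rewrite divr_ge0 // ltW.
rewrite -[X in X%:R](card_ord (n.-1 - i)) natr_card; apply: ler_sum => j _.
by rewrite exprn_ege1 // -[leLHS]expR0 ler_expR divr_ge0 // ltW.
Qed.

Lemma sum_weight_ge : a * n%:R / 4 <= \sum_(i < n.-1) weight i.
Proof.
apply: (@le_trans _ _ (\sum_(i < n.-1) a / n%:R * (n.-1 - i)%:R)); last first.
  by apply: ler_sum => i _; apply: weight_ge; exact: ltnW.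
rewrite -mulr_sumr (reindex_inj rev_ord_inj) /=.
have -> : \sum_(j < n.-1) (n.-1 - (n.-1 - j.+1))%:R = n%:R * (n%:R - 1) / 2 :> R.
  rewrite (eq_bigr (fun j : 'I_n.-1 => j.+1%:R)); last first.
    by move=> j _; rewrite subKn.
  have -> : n%:R - 1 = n.-1%:R :> R by rewrite -subn1 natrB.
  rewrite -[n in n%:R](prednK n0) /=.
  elim: n.-1 => [|m IHm]; first by rewrite big_ord0; lra.
  by rewrite big_ord_recr /= IHm -!natr1; field.
have n2R : 2 <= n%:R :> R by rewrite ler_nat.
have -> : a / n%:R * (n%:R * (n%:R - 1) / 2) = a * ((n%:R - 1) / 2).
  by field; rewrite gt_eqF.
rewrite -mulrA ler_pM2l //; lra.
Qed.

(** [weight_rec] handles the shift, and the spin leaving the window has weight 0. On average the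
    first and last terms nearly cancel, which leaves the factor [expR (- (gam / n))]. *)
Lemma Phi_cons x h : (n.-1 <= size h)%N ->
  Phi (x :: h) = weight 0 * spin_diff x +
    expR (- (gam / n%:R)) * Phi h - a / n%:R * sdiff h.
Proof.
move=> nh.
have -> : Phi (x :: h) = weight 0 * spin_diff x + \sum_(i < n.-1) weight i.+1 * (map spin_diff h)`_i.
  rewrite /Phi; case E : n.-1 => [|m]; first by move: n2; rewrite -(prednK n0) E.
  rewrite big_ord_recl /=; congr (_ + _).
  by rewrite [RHS]big_ord_recr /= weight_out ?E // mul0r addr0.
have -> : sdiff h = \sum_(i < n.-1) (map spin_diff h)`_i.
  rewrite /sdiff -(big_map spin_diff xpredT id) map_take (big_nth 0) size_take size_map.
  rewrite (_ : (if _ then _ else _) = n.-1); last by case: ltngtP nh.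
  by rewrite big_mkord; apply: eq_bigr => i _; rewrite nth_take.
rewrite -addrA; congr (_ + _).
rewrite /Phi !mulr_sumr -sumrB; apply: eq_bigr => i _.
by rewrite weight_rec // mulrBl mulrA.
Qed.

Lemma mean_spin_diff (K : seq 'I_q -> 'I_q -> R) h :
  mean K spin_diff h = K h i0 - K h i1.
Proof.
rewrite /mean /spin_diff; under eq_bigr do rewrite mulrBr.
rewrite sumrB; congr (_ - _); [rewrite (bigD1 i0)|rewrite (bigD1 i1)] => //=.
  by rewrite eqxx mulr1 big1 ?addr0 // => j /negPf ->; rewrite mulr0.
by rewrite eqxx mulr1 big1 ?addr0 // => j /negPf ->; rewrite mulr0.
Qed.

Lemma drift_le h (M : R) : (n.-1 <= size h)%N -> 0 <= M ->
  (forall k, `|dev R n h k| <= M) ->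
  `|mean (gibbs n beta) spin_diff h - a / n%:R * sdiff h|
   <= soft_cst q beta * M * (`|sdiff h| / n%:R).
Proof.
move=> nh M0 M1.
pose M' := Num.min M 1.
have M'M : M' <= M by rewrite ge_min lexx.
have M'01 : 0 <= M' <= 1 by rewrite le_min M0 ler01 /= ge_min lexx orbT.
have dM k : `|dev R n h k| <= M' by rewrite le_min M1 dev_norm_le.
have := softmax_sub_le (ltW beta0) M'01 (sum_dev R q2 n2 nh) dM i0 i1.
rewrite -!gibbsE // -mean_spin_diff card_ord -/(soft_cst q beta).
have -> : beta / q%:R * (dev R n h i0 - dev R n h i1) = a / n%:R * sdiff h.
  by rewrite sdiff_dev /a; field; rewrite !gt_eqF.
have -> : `|dev R n h i0 - dev R n h i1| = `|sdiff h| / n%:R.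
  by rewrite sdiff_dev normrM [`|n%:R|]ger0_norm // mulrAC mulfV ?mul1r // gt_eqF.
move=> H; apply: (le_trans H); apply: ler_wpM2r; first by rewrite divr_ge0.
by apply: ler_wpM2l => //; exact: soft_cst_ge0.
Qed.

Lemma mean_norm_le h (M : R) : (n.-1 <= size h)%N -> 0 <= M ->
  (forall k, `|dev R n h k| <= M) ->
  `|mean (gibbs n beta) spin_diff h| <= 2 * (a + soft_cst q beta) * M.
Proof.
move=> nh M0 M1; have c10 := soft_cst_ge0 q beta0.
have := drift_le nh ler01 (dev_norm_le R q2 n2 h); rewrite mulr1.
set D := mean _ _ _ - _ => HD.
have -> : mean (gibbs n beta) spin_diff h = D + a / n%:R * sdiff h by rewrite /D subrK.
have SM : `|sdiff h| / n%:R <= 2 * M.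
  rewrite sdiff_dev normrM [`|n%:R|]ger0_norm // mulrAC mulfV ?mul1r ?gt_eqF //.
  apply: (le_trans (ler_normB _ _)); have := M1 i0; have := M1 i1; lra.
apply: (le_trans (ler_normD _ _)).
have -> : `|a / n%:R * sdiff h| = a * (`|sdiff h| / n%:R).
  have an0 : 0 <= a / n%:R by rewrite divr_ge0 // ltW.
  by rewrite normrM (ger0_norm an0); ring.
have X := ler_wpM2l (ltW a0) SM; have Y := ler_wpM2l c10 SM.
lra.
Qed.

Section MartingalePart.
Variable K : seq 'I_q -> 'I_q -> R.
Hypothesis sK : stochastic K.

(** The noise of [Phi], injected after time [n] and damped at the same rate. In [Phi - mart] the
    latest spin cancels, so that this difference evolves by predictable terms. *)
Fixpoint mart h : R := if h is x :: h' then
   if (size h' < n)%N then 0 else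
   expR (- (gam / n%:R)) * mart h' + weight 0 * (spin_diff x - mean K spin_diff h')
  else 0.

Let th : R := expR (- (gam / n%:R)).

(** The level [(1 + gam) / gam * n] is preserved by [V -> th * V + 1]. This bounds the second moment
    of [mart], and later the accumulated drift errors. *)
Lemma theta_gap : (1 + gam) / gam * n%:R * th + 1 <= (1 + gam) / gam * n%:R.
Proof.
have d0 : 0 < gam / n%:R by rewrite divr_gt0.
have : th * (1 + gam / n%:R) <= 1.
  by rewrite /th expRN mulrC ler_pdivrMr ?expR_gt0 // mul1r expR_ge1Dx.
move=> H; have H1 : gam / n%:R <= (1 - th) * (1 + gam / n%:R) by lra.
have th1 : 0 <= 1 - th by have : th <= 1; [rewrite /th -[leRHS]expR0 ler_expR oppr_le0 ltW|lra].
have H2 : 1 + gam / n%:R <= 1 + gam.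
  by rewrite lerD2l ler_pdivrMr // ler_peMr ?(ltW gam0) // ler1n.
have H3 := le_trans H1 (ler_wpM2l th1 H2).
have X : 0 <= n%:R / gam by rewrite divr_ge0 // ltW.
have := ler_wpM2l X H3.
have -> : n%:R / gam * (gam / n%:R) = 1 by field; rewrite !gt_eqF.
have -> : n%:R / gam * ((1 - th) * (1 + gam)) = (1 + gam) / gam * n%:R - (1 + gam) / gam * n%:R * th by ring.
lra.
Qed.

Lemma Ex_mart_sqr t : Ex K t (fun h => mart h ^+ 2) <= (1 + gam) / gam * n%:R.
Proof.
set B := (1 + gam) / gam * n%:R.
have B0 : 0 <= B by rewrite mulr_ge0 // divr_ge0 ?ltW // addr_gt0.
elim: t => [|t IH] /=; first by rewrite expr0n.
have T0 : 0 <= th by exact: expR_ge0.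
have T1 : th <= 1 by rewrite /th -[leRHS]expR0 ler_expR oppr_le0 divr_ge0 // ltW.
apply: (@le_trans _ _ (Ex K t (fun h => th * mart h ^+ 2 + 1))); last first.
  rewrite ExD ExZ Ex_cst //; apply: le_trans theta_gap.
  by rewrite lerD2r -/B mulrC ler_wpM2r.
apply: Ex_le => // h _; rewrite /step /=.
case: ltnP => _.
  rewrite big1; last by move=> x _; rewrite expr0n mulr0.
  by rewrite addr_ge0 // mulr_ge0 // sqr_ge0.
have [K0 K1] := sK; set m := mean K spin_diff h; set c := mart h; set w := weight 0.
have -> : \sum_x K h x * (th * c + w * (spin_diff x - m)) ^+ 2 =
  (th * c) ^+ 2 + w ^+ 2 * (\sum_x K h x * spin_diff x ^+ 2 - m ^+ 2).
  transitivity (\sum_x (w ^+ 2 * (K h x * spin_diff x ^+ 2)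
     + (2 * w * (th * c - w * m)) * (K h x * spin_diff x)
     + K h x * (w * m - th * c) ^+ 2)).
    by apply: eq_bigr => x _; ring.
  rewrite !big_split /= -!mulr_sumr -mulr_suml K1 -/(mean K spin_diff h) -/m; ring.
apply: lerD.
  by rewrite exprMn ler_wpM2r ?sqr_ge0 // expr2 ler_piMl.
have S1 : \sum_x K h x * spin_diff x ^+ 2 <= 1.
  rewrite -(K1 h); apply: ler_sum => x _.
  by rewrite ler_piMr // sqr_le1 // spin_diff_norm.
have w1 : w ^+ 2 <= 1 by rewrite sqr_le1 // ger0_norm ?weight_le1 ?weight_ge0.
have w0 : 0 <= w ^+ 2 := sqr_ge0 _.
have m0 : 0 <= m ^+ 2 := sqr_ge0 _.
apply: (@le_trans _ _ (w ^+ 2 * 1)); last by rewrite mulr1.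
by rewrite ler_wpM2l // lerBlDr (le_trans S1) // lerDl.
Qed.

End MartingalePart.

End Eigenfunction.

(** * Lower bound: tracking the eigenfunction *)

Section Lower.
Variables (R : realType) (q : nat) (beta rho gr gam : R) (i0 i1 : 'I_q).
Hypotheses (q2 : (2 <= q)%N) (beta0 : 0 < beta) (i01 : i0 != i1).
Hypothesis a_lt1 : beta / q%:R < 1.
Hypotheses (rho01 : 0 < rho < 1) (gr0 : 0 < gr) (rg : rho * (expR gr - 1) = gr).
Hypothesis rho_contract : forall y, y < 1 - q%:R^-1 ->
  spin_prob q (beta * y) - q%:R^-1 <= rho * Num.max 0 y.
Hypotheses (gam0 : 0 < gam) (ag : beta / q%:R * (expR gam - 1) = gam).

Let a : R := beta / q%:R.
Let c1 : R := soft_cst q beta.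
Let ec : R := eta_cst q rho gr.
Let sd := @spin_diff R q i0 i1.
Let S n := @sdiff R q n i0 i1.
Let qR : (0 : R) < q%:R. Proof. by rewrite ltr0n ltnW. Qed.
Let a0 : 0 < a. Proof. exact: divr_gt0. Qed.
Let c10 : 0 <= c1. Proof. exact: soft_cst_ge0. Qed.
Let ec0 : 0 <= ec. Proof. exact: eta_cst_ge0. Qed.

(* The hypotheses on [K] cover both a deterministic start ([d0 = 1]) and
   independent spins with a small bias [d0]. *)
Definition biased_start (d0 : R) n (K : seq 'I_q -> 'I_q -> R) :=
  [/\ stochastic K, forall h, (n <= size h)%N -> K h =1 gibbs n beta h,
      forall h k, (size h < n)%N -> K h k - q%:R^-1 <= d0 &
      forall h, (size h < n)%N -> `|mean K sd h| <= 2 * d0].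

Lemma Ex_sdiff_le n K s : (2 <= n)%N -> stochastic K -> (n.-1 <= s)%N ->
  Ex K s (fun h => `|S n h|) <=
  \sum_(i < n.-1) Ex K (s - i.+1) (fun h => `|mean K sd h|) + Num.sqrt n%:R.
Proof.
move=> n2 sK ns; pose v (i : nat) : R := (i < n.-1)%:R.
have nR : 0 < n%:R :> R by rewrite ltr0n ltnW.
set r := Num.sqrt n%:R; have r0 : 0 < r by rewrite sqrtr_gt0.
have rr : r ^+ 2 = n%:R by rewrite sqr_sqrtr.
apply: (@le_trans _ _ (Ex K s (fun h => \sum_(i < n.-1) `|mean K sd (drop i.+1 h)| + `|compsum K sd v h|))).
  apply: Ex_le => // h sh; rewrite compsum_window ?sh // -/(S n h).
  rewrite -[S n h](subrK (\sum_(i < n.-1) mean K sd (drop i.+1 h))) addrC.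
  apply: (le_trans (ler_normD _ _)).
  by rewrite lerD2r ler_norm_sum.
rewrite ExD Ex_sum; apply: lerD.
  apply: ler_sum => i _; rewrite (Ex_drop (fun h => `|mean K sd h|) sK) //.
  by apply: leq_trans (ltn_ord i) ns.
apply: (le_trans (Ex_AMGM _ _ sK r0)).
have V : Ex K s (fun h => compsum K sd v h ^+ 2) <= r ^+ 2.
  apply: (le_trans (Ex_compsum_sqr sK _ _ (spin_diff_norm R i01))).
  rewrite rr (eq_bigr (fun i : 'I_s => v i)); last first.
    by move=> i _; rewrite /v; case: (_ < _)%N; rewrite ?expr1n ?expr0n.
  rewrite /v -natr_sum ler_nat; elim: (s) => [|l IH]; first by rewrite big_ord0.
  have [ln|ln] := leqP n.-1 l.
    by rewrite big_ord_recr /= ltnNge ln addn0.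
  apply: leq_trans (_ : l.+1 <= n)%N; last by rewrite (leq_trans ln) // leq_pred.
  rewrite -[leqRHS](card_ord l.+1) -sum1_card; apply: leq_sum => j _; exact: leq_b1.
have : Ex K s (fun h => compsum K sd v h ^+ 2) / r <= r.
  by rewrite ler_pdivrMr // -expr2.
lra.
Qed.

(** The drift error is of order [eta * |sdiff| / n]. Both [eta] and the mean of [|sdiff|], up to a
    term of order [sqrt n], are proportional to [d0], whence the factor [d0 ^ 2]. The constant [C]
    precedes [d0]; only [N] depends on it. *)
Lemma lower_main (A : R) : 1 <= A -> exists C : R, 0 < C /\
  forall d0 : R, 0 < d0 <= 1 -> exists N, forall n t,
  (N <= n)%N -> (n <= t)%N -> t.+1%:R <= A * (n%:R * (1 + ln n%:R)) ->
  forall K, biased_start d0 n K -> forall m0 : R,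
  Ex K t (fun h => `|Phi n beta gam i0 i1 h - decay gam n (t - n) * m0|) <=
  decay gam n (t - n) * Ex K n (fun h => `|Phi n beta gam i0 i1 h - m0|)
  + C * (d0 ^+ 2 * (n%:R * decay gam n t) + Num.sqrt n%:R).
Proof.
move=> A1; have A0 : 0 <= A by exact: le_trans A1.
have [C0 [C00 [k0 [N0 [k00 H0]]]]] :=
  recursion_bound q2 beta0 a_lt1 rho01 gr0 gam0 ag A0.
rewrite -/c1 -/a in H0.
(* The three summands serve the first [n] steps, the remaining burn-in through [mean_norm_le], and
   the [sqrt n] source of the recursion. *)
pose P : R := 2 + 2 * (a + c1) * (ec + 1) + (a + c1 * (ec + 1)).
have P1 : 0 <= 2 * (a + c1) * (ec + 1).
  by apply: mulr_ge0; [rewrite mulr_ge0 // addr_ge0 // ltW|rewrite addr_ge0].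
have P2 : 0 <= a + c1 * (ec + 1) by rewrite addr_ge0 ?(ltW a0) // mulr_ge0 // addr_ge0.
have P0 : 0 < P by rewrite /P; lra.
pose C2 : R := 2 * (C0 * P) + 1.
have CP0 : 0 < C0 * P by rewrite mulr_gt0.
have C20 : 0 < C2 by rewrite /C2; lra.
pose Q : R := c1 * C2 * ec + c1 + (gam + a) * a.
have Q0 : 0 <= Q.
  apply: addr_ge0; first by apply: addr_ge0 => //; apply: mulr_ge0 => //; apply: mulr_ge0 => //; exact: ltW.
  by rewrite mulr_ge0 ?addr_ge0 // ltW.
pose Q' : R := (1 + gam) / gam.
have Q'0 : 0 <= Q' by rewrite divr_ge0 ?addr_ge0 // ltW.
pose es : R := eta_sum_cst q rho gr A.
have es0 : 0 <= es by exact: eta_sum_cst_ge0.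
pose C3 : R := C2 * c1 * expR gam.
have C30 : 0 <= C3.
  apply: mulr_ge0; last exact: expR_ge0.
  by apply: mulr_ge0 => //; exact: ltW.
exists (C3 * es + Q * Q' + Q' + 1); split.
  by rewrite ltr_wpDl // !addr_ge0 // mulr_ge0.
move=> d0 d0P; have /andP[d00 d01] := d0P.
have [N1 H1] := bad_small q2 d00 A1.
exists (maxn N0 (maxn N1 (maxn 2 (Num.bound (3 * gam))))) => n t.
rewrite !geq_max => /and4P[nN0 nN1 n2 ng] nt tA K [sK Kg K_init Kmean] m0.
have nR : 0 < n%:R :> R by rewrite ltr0n ltnW.
have n1R : 1 <= n%:R :> R by rewrite ler1n ltnW.
have gn : 3 * gam <= n%:R.
  apply: le_trans (ltW (archi_boundP _)) _; first by rewrite mulr_ge0 // ltW.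
  by rewrite ler_nat.
set r := Num.sqrt n%:R; have r0 : 0 < r by rewrite sqrtr_gt0.
have rr : r ^+ 2 = n%:R by rewrite sqr_sqrtr.
have r1 : 1 <= r by rewrite -[leLHS]sqrtr1 ler_sqrt.
pose f := fdev d0 n; have f0 : 0 < f by exact: fdev_gt0.
pose bd := bad n f K.
have bd0 h : 0 <= bd h by exact: bad_ge0.
have Ebd s : (s <= t)%N -> n%:R * Ex K s bd <= 1.
  move=> st; apply: (nEx_bad_le1 d0P sK erefl).
  by apply: H1 => //; apply: le_trans tA; rewrite ler_nat.
pose et s := etan q rho gr d0 n s.
have et0 s : 0 <= et s by exact: etan_ge0.
have etle s : et s <= d0 * ec by exact: etan_le.
have etec s : et s <= ec by apply: (le_trans (etle s)); rewrite ler_piMl.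
have devB h k : (n <= size h)%N -> `|dev R n h k| <= et (size h) + bd h.
  by move=> nh; exact: (dev_bound q2 n2 rho01 gr0 rg rho_contract (ltW d00) f0 Kg K_init).
have S1 h : `|S n h| / n%:R <= 1.
  by rewrite ler_pdivrMr // mul1r; exact: sdiff_norm_le.
have S0 h : 0 <= `|S n h| / n%:R by rewrite divr_ge0.
have drift h : (n <= size h)%N -> `|mean K sd h - a / n%:R * S n h| <=
    c1 * et (size h) * (`|S n h| / n%:R) + c1 * bd h.
  move=> nh; have nh' : (n.-1 <= size h)%N by apply: leq_trans nh; exact: leq_pred.
  have -> : mean K sd h = mean (gibbs n beta) sd h.
    by apply: eq_bigr => x _; rewrite Kg.
  have M0 : 0 <= et (size h) + bd h by rewrite addr_ge0.
  have H := drift_le i0 i1 q2 n2 beta0 nh' M0 (fun k => devB h k nh).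
  apply: (le_trans H); rewrite -/c1 -/(S n h) mulrDr mulrDl lerD2l.
  by rewrite ler_piMr // mulr_ge0.
pose z s := n%:R * Ex K s (fun h => `|mean K sd h|).
have z0 s : 0 <= z s by rewrite mulr_ge0 // Ex_ge0.
have ES s : (n.-1 <= s)%N ->
    Ex K s (fun h => `|S n h|) <= (\sum_(i < n.-1) z (s - i.+1)%N) / n%:R + r.
  move=> ns; apply: (le_trans (Ex_sdiff_le n2 sK ns)); rewrite lerD2r.
  by rewrite /z -mulr_sumr mulrAC mulfV ?mul1r // gt_eqF.
(* The initial level must be proportional to [d0], also during the burn-in; the trivial bound [n]
   would lose one of the two factors [d0]. *)
have zB s : (s < k0 * n)%N -> (s <= t)%N -> z s <= P * (n%:R * d0 + 1).
  move=> _ st; have X : 0 <= n%:R * d0 by rewrite mulr_ge0 // ltW.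
  have [sn|ns] := ltnP s n.
    apply: (@le_trans _ _ (n%:R * (2 * d0))).
      rewrite /z ler_wpM2l // -[leRHS](Ex_cst s _ sK); apply: Ex_le => // h sh.
      by apply: Kmean; rewrite sh.
    have PX : 0 <= (P - 2) * (n%:R * d0) by apply: mulr_ge0 => //; rewrite /P; lra.
    lra.
  have M h : size h = s -> `|mean K sd h| <= 2 * (a + c1) * (d0 * ec) + 2 * (a + c1) * bd h.
    move=> sh; have nh : (n <= size h)%N by rewrite sh.
    have nh' : (n.-1 <= size h)%N by apply: leq_trans nh; exact: leq_pred.
    have -> : mean K sd h = mean (gibbs n beta) sd h.
      by apply: eq_bigr => x _; rewrite Kg.
    have M0 : 0 <= et (size h) + bd h by rewrite addr_ge0.
    have := mean_norm_le i0 i1 q2 n2 beta0 nh' M0 (fun k => devB h k nh).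
    rewrite -/a -/c1 => H; apply: (le_trans H); rewrite mulrDr lerD2r ler_wpM2l //.
    by rewrite mulr_ge0 // addr_ge0 // ltW.
  apply: (@le_trans _ _ (n%:R * Ex K s (fun h => 2 * (a + c1) * (d0 * ec) + 2 * (a + c1) * bd h))).
    by rewrite /z ler_wpM2l //; apply: Ex_le.
  rewrite ExD Ex_cst // ExZ mulrDr.
  have ac0 : 0 <= 2 * (a + c1) by rewrite mulr_ge0 // addr_ge0 // ltW.
  have := ler_wpM2l ac0 (Ebd s st); set E := Ex K s bd => EB.
  have Y1 : 0 <= 2 * (a + c1) * (n%:R * d0) by rewrite mulr_ge0.
  have Y2 : 0 <= 2 * (a + c1) * ec by rewrite mulr_ge0.
  have Y3 : 0 <= (a + c1 * (ec + 1)) * (n%:R * d0) by rewrite mulr_ge0.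
  rewrite /P; lra.
have rec s : (k0 * n <= s <= t)%N ->
    z s <= (a + c1 * etan q rho gr d0 n s) / n%:R * \sum_(i < n.-1) z (s - i.+1)%N + P * r.
  move=> /andP[ks st]; rewrite -/(et s).
  have ns : (n <= s)%N by apply: leq_trans ks; rewrite leq_pmull.
  have ns' : (n.-1 <= s)%N by apply: leq_trans ns; exact: leq_pred.
  have al0 : 0 <= a + c1 * et s by rewrite addr_ge0 ?(ltW a0) // mulr_ge0.
  have M h : size h = s -> `|mean K sd h| <= (a + c1 * et s) / n%:R * `|S n h| + c1 * bd h.
    move=> sh; have nh : (n <= size h)%N by rewrite sh.
    have D := drift h nh; rewrite sh in D.
    rewrite -[mean K sd h](subrK (a / n%:R * S n h)).
    apply: (le_trans (ler_normD _ _)).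
    have -> : `|a / n%:R * S n h| = a * (`|S n h| / n%:R).
      have an0 : 0 <= a / n%:R by rewrite divr_ge0 // ltW.
      by rewrite normrM (ger0_norm an0); ring.
    have -> : (a + c1 * et s) / n%:R * `|S n h| = (a + c1 * et s) * (`|S n h| / n%:R) by ring.
    lra.
  apply: (@le_trans _ _ (n%:R * Ex K s (fun h => (a + c1 * et s) / n%:R * `|S n h| + c1 * bd h))).
    by rewrite /z ler_wpM2l //; apply: Ex_le.
  rewrite ExD !ExZ.
  have := ler_wpM2l al0 (ES s ns'); have := ler_wpM2l c10 (Ebd s st).
  set E := Ex K s bd; set ESs := Ex K s _; set Z := \sum_(i < n.-1) z _ => B1 B2.
  have -> : n%:R * ((a + c1 * et s) / n%:R * ESs + c1 * E) = (a + c1 * et s) * ESs + c1 * (n%:R * E).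
    by field; rewrite gt_eqF.
  have B3 : c1 * et s * r <= c1 * ec * r by rewrite ler_wpM2r ?(ltW r0) // ler_wpM2l.
  have B4 : c1 <= c1 * r by rewrite ler_peMr.
  have B5 : 0 <= (2 + 2 * (a + c1) * (ec + 1)) * r by rewrite mulr_ge0 ?(ltW r0) // addr_ge0.
  have -> : (a + c1 * et s) / n%:R * Z = (a + c1 * et s) * (Z / n%:R) by ring.
  rewrite /P; lra.
have Pr0 : 0 <= P * r by rewrite mulr_ge0 // ltW.
have Pn0 : 0 <= P * (n%:R * d0 + 1) by rewrite mulr_ge0 ?(ltW P0) // addr_ge0 // mulr_ge0 // ltW.
have [_ Hz] := H0 d0 n t _ _ z d0P nN0 tA Pr0 Pn0 z0 zB rec.
have dec1 s : decay gam n s <= 1 :> R.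
  by rewrite /decay -[leRHS]expR0 ler_expR mulNr oppr_le0 mulr_ge0 // divr_ge0 // ltW.
have ES2 s : (n <= s <= t)%N -> Ex K s (fun h => `|S n h|) <= C2 * (n%:R * d0 * decay gam n s + r).
  move=> /andP[ns st]; have ns' : (n.-1 <= s)%N by apply: leq_trans ns; exact: leq_pred.
  have := Hz s; rewrite ns' st => /(_ isT) H; apply: (le_trans (ES s ns')).
  have d1 := dec1 s; have dp := decay_gt0 gam n s.
  have X : 0 <= n%:R * d0 * decay gam n s by rewrite !mulr_ge0 // ltW.
  have Y : 0 <= C0 * P * (n%:R * d0 * decay gam n s) by rewrite mulr_ge0 // ltW.
  have Y2 : C0 * P * decay gam n s <= C0 * P * r.
    by rewrite ler_wpM2l ?(ltW CP0) // (le_trans d1).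
  rewrite /C2; lra.
pose th := expR (- (gam / n%:R)); have th0 : 0 <= th by exact: expR_ge0.
have dS s : decay gam n s.+1 = th * decay gam n s.
  by rewrite /decay /th -expRD; congr expR; rewrite -natr1; ring.
pose W := weight q n beta gam; pose Ph := Phi n beta gam i0 i1.
pose mt := mart n beta gam i0 i1 K.
pose w0 := W 0%N.
have w01 : 0 <= w0 <= 1 by rewrite weight_ge0 //= weight_le1.
have w0g : 1 - (gam + a) / n%:R <= w0 by exact: weight0_ge.
(* Distance of [Phi - mart] from the pure exponential started at [m0] at time [n], where [mart]
   still vanishes. *)
pose y s := Ex K s (fun h => `|Ph h - mt h - decay gam n (s - n) * m0|).
pose ka := Q / r.
have ka0 : 0 <= ka by rewrite divr_ge0 // ltW.
have yrec s : (n <= s <= t)%N -> y s.+1 <= th * y s + (C2 * c1 * d0 * decay gam n s * et s + ka).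
  move=> /andP[ns st]; have ns' : (n.-1 <= s)%N by apply: leq_trans ns; exact: leq_pred.
  pose rem h := w0 * mean K sd h - a / n%:R * S n h.
  apply: (@le_trans _ _ (Ex K s (fun h => th * `|Ph h - mt h - decay gam n (s - n) * m0| + `|rem h|))).
    rewrite /y /=; apply: Ex_le => // h sh.
    rewrite /step (eq_bigr (fun x => K h x * `|th * (Ph h - mt h - decay gam n (s - n) * m0) + rem h|)); last first.
      move=> x _; congr (_ * `|_|).
      rewrite /Ph Phi_cons ?sh // /mt /= sh ltnNge ns /= subSn // dS -/th -/w0.
      by rewrite /rem -/(S n h) -/a -/sd -/W -/w0; ring.
    rewrite -mulr_suml sK.2 mul1r; apply: (le_trans (ler_normD _ _)).
    by rewrite normrM (ger0_norm th0).
  rewrite ExD ExZ -/(y s) lerD2l.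
  apply: (@le_trans _ _ (Ex K s (fun h => (c1 * et s / n%:R * `|S n h| + c1 * bd h) + (gam + a) * a / n%:R))).
    apply: Ex_le => // h sh; have nh : (n <= size h)%N by rewrite sh.
    have D := drift h nh; rewrite sh in D.
    have -> : rem h = w0 * (mean K sd h - a / n%:R * S n h) - (1 - w0) * (a / n%:R * S n h) by rewrite /rem; ring.
    apply: (le_trans (ler_normB _ _)); case/andP: w01 => w00 w11.
    apply: lerD.
      rewrite normrM (ger0_norm w00); apply: (le_trans (ler_piMl _ w11)) => //.
      by apply: (le_trans D); rewrite le_eqVlt; apply/orP; left; apply/eqP; ring.
    have w1' : 0 <= 1 - w0 by rewrite subr_ge0.
    have -> : `|(1 - w0) * (a / n%:R * S n h)| = (1 - w0) * (a * (`|S n h| / n%:R)).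
      have an0 : 0 <= a / n%:R by rewrite divr_ge0 // ltW.
      by rewrite normrM (ger0_norm w1') normrM (ger0_norm an0); ring.
    have -> : (gam + a) * a / n%:R = (gam + a) / n%:R * a by ring.
    apply: ler_pM => //; first by rewrite mulr_ge0 // ltW.
      by lra.
    by rewrite ler_piMr // ltW.
  rewrite !ExD !ExZ Ex_cst //.
  have E1 := ES2 s; rewrite ns st in E1; have {}E1 := E1 isT.
  have cn0 : 0 <= c1 * et s / n%:R by rewrite divr_ge0 // mulr_ge0.
  have B1 := ler_wpM2l cn0 E1.
  have B2 : c1 * Ex K s bd <= c1 / r.
    rewrite ler_wpM2l // -[leRHS]mul1r ler_pdivlMr //.
    apply: le_trans (Ebd s st); rewrite mulrC ler_wpM2r ?Ex_ge0 //.
    by rewrite -rr expr2 ler_peMl // ltW.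
  have B3 : (gam + a) * a / n%:R <= (gam + a) * a / r.
    rewrite ler_wpM2l //; first by rewrite mulr_ge0 ?addr_ge0 // ltW.
    by rewrite lef_pV2 ?posrE // -rr expr2 ler_peMl // ltW.
  have E4 : c1 * et s / n%:R * (C2 * (n%:R * d0 * decay gam n s + r)) =
     C2 * c1 * d0 * decay gam n s * et s + c1 * C2 * et s / r.
    by rewrite -rr; field; rewrite gt_eqF.
  rewrite E4 in B1.
  have B5 : c1 * C2 * et s / r <= c1 * C2 * ec / r.
    rewrite ler_wpM2r ?invr_ge0 ?(ltW r0) // ler_wpM2l //.
    by rewrite mulr_ge0 // ltW.
  have -> : ka = c1 * C2 * ec / r + c1 / r + (gam + a) * a / r by rewrite /ka /Q; ring.
  apply: (le_trans (lerD (lerD B1 B2) B3)).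
  by rewrite -!addrA lerD2l lerD2r.
have yB s : (n <= s)%N -> (s <= t)%N -> y s <= decay gam n (s - n) * y n +
    C3 * d0 * decay gam n s * (\sum_(j < s) et j) + ka * (Q' * n%:R).
  elim: s => [|s IH]; first by rewrite leqn0 => /eqP E; move: n2; rewrite E.
  move=> ns st; have se0 (m : nat) : 0 <= \sum_(j < m) et j by exact: sumr_ge0.
  have KQ : 0 <= ka * (Q' * n%:R) by apply: mulr_ge0 => //; apply: mulr_ge0.
  have [en|sn] := leqP s.+1 n.
    have -> : s.+1 = n by apply/eqP; rewrite eqn_leq en ns.
    rewrite subnn {1}/decay mulr0 expR0 mul1r -addrA lerDl; apply: addr_ge0 => //.
    apply: mulr_ge0 => //; apply: mulr_ge0; last exact/ltW/decay_gt0.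
    by apply: mulr_ge0 => //; exact: ltW.
  have ns' : (n <= s)%N by [].
  have st' : (s <= t)%N by exact: ltnW.
  have := yrec s; rewrite ns' st' => /(_ isT) Y; apply: (le_trans Y).
  have := ler_wpM2l th0 (IH ns' st').
  rewrite subSn // !dS big_ord_recr /=.
  have T := theta_gap n2 gam0; rewrite -/th -/Q' in T.
  have {}T := ler_wpM2l ka0 (T : Q' * n%:R * th + 1 <= Q' * n%:R).
  have G : C2 * c1 * d0 * decay gam n s * et s <= C3 * d0 * (th * decay gam n s) * et s.
    rewrite ler_wpM2r // /C3.
    have e1 : 1 <= expR gam * th.
      rewrite /th -expRD -[leLHS]expR0 ler_expR subr_ge0 ler_pdivrMr //.
      by rewrite ler_peMr // ltW.
    have cc : 0 <= C2 * c1 * d0 * decay gam n s.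
      apply: mulr_ge0; last exact/ltW/decay_gt0.
      by apply: mulr_ge0; [apply: mulr_ge0 => //|]; exact: ltW.
    have := ler_wpM2l cc e1; lra.
  set U := \sum_(j < s) et j; set Y0 := y n => H.
  lra.
have yt := yB t nt (leqnn t).
have yn : y n = Ex K n (fun h => `|Ph h - m0|).
  apply: Ex_ext => h sh; rewrite subnn /decay mulr0 expR0 mul1r.
  rewrite /mt (_ : mart _ _ _ _ _ _ _ = 0) ?subr0 //.
  by case: h sh => //= x h [sh]; rewrite sh leqnn.
rewrite yn in yt.
have Em : Ex K t (fun h => `|mt h|) <= (Q' + 1) * r.
  apply: (le_trans (Ex_AMGM _ _ sK r0)).
  have V := Ex_mart_sqr q2 n2 beta0 i01 gam0 ag sK t.
  have V2 : Ex K t (fun h => mt h ^+ 2) / r <= Q' * r.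
    by rewrite ler_pdivrMr // -mulrA -expr2 rr.
  have : 0 <= Q' * r by rewrite mulr_ge0 // ltW.
  lra.
apply: (@le_trans _ _ (Ex K t (fun h => `|Ph h - mt h - decay gam n (t - n) * m0| + `|mt h|))).
  apply: Ex_le => // h _; rewrite -/(Ph h) -[X in `|X|](_ : (Ph h - mt h - decay gam n (t - n) * m0) + mt h = _).
    exact: ler_normD.
  ring.
rewrite ExD -/(y t).
have Su : C3 * d0 * decay gam n t * (\sum_(j < t) et j) <= C3 * es * (d0 ^+ 2 * (n%:R * decay gam n t)).
  have := etan_sum_le q2 rho01 gr0 d00 (ltnW n2) (le_trans _ tA : t%:R <= _).
  rewrite ler_nat leqnSn => /(_ isT).
  rewrite ler_pdivrMr // => H.
  have cc : 0 <= C3 * d0 * decay gam n t.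
    apply: mulr_ge0; last exact/ltW/decay_gt0.
    by apply: mulr_ge0 => //; exact: ltW.
  have := ler_wpM2l cc H; rewrite -/es; set U := \sum_(j < t) _ => H'.
  by apply: (le_trans H'); rewrite le_eqVlt; apply/orP; left; apply/eqP; ring.
have ke : ka * (Q' * n%:R) = Q * Q' * r by rewrite /ka -rr; field; rewrite gt_eqF.
rewrite ke in yt.
set V := decay gam n (t - n) * _ in yt *.
have X1 : 0 <= d0 ^+ 2 * (n%:R * decay gam n t).
  by rewrite mulr_ge0 ?sqr_ge0 // mulr_ge0 //; exact/ltW/decay_gt0.
have X2 : 0 <= (Q * Q' + Q' + 1) * (d0 ^+ 2 * (n%:R * decay gam n t)).
  by apply: mulr_ge0 => //; apply: addr_ge0 => //; apply: addr_ge0 => //; exact: mulr_ge0.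
have X3 : 0 <= C3 * es * r by apply: mulr_ge0; [exact: mulr_ge0|exact: ltW].
lra.
Qed.

End Lower.

(** * Full scans *)

Section Starts.
Variables (R : realType) (q n : nat) (beta : R).
Hypotheses (q2 : (2 <= q)%N) (n2 : (2 <= n)%N).

Let qR : (0 : R) < q%:R. Proof. by rewrite ltr0n ltnW. Qed.

Definition start_kernel (K0 : seq 'I_q -> 'I_q -> R) h k :=
  if (size h < n)%N then K0 h k else gibbs n beta h k.

Lemma start_kernel_gibbs K0 h : (n <= size h)%N -> start_kernel K0 h =1 gibbs n beta h.
Proof. by move=> nh k; rewrite /start_kernel ltnNge nh. Qed.

Lemma stochastic_start K0 :
  (forall h k, (size h < n)%N -> 0 <= K0 h k) ->
  (forall h, (size h < n)%N -> \sum_k K0 h k = 1) ->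
  stochastic (start_kernel K0).
Proof.
move=> K00 K01; have [g0 g1] := stochastic_gibbs n beta q2.
split=> [h k|h]; rewrite /start_kernel; case: ltnP => hn //.
- exact: K00.
- exact: K01.
Qed.

Lemma Ex_start_add K0 m f :
  Ex (start_kernel K0) (n + m) f =
  Ex (start_kernel K0) n (fun x => Ex (after (gibbs n beta) x) m (fun l => f (l ++ x))).
Proof.
rewrite Ex_add; apply: Ex_ext => x sx; apply: Ex_kernel_ext => l _ k.
by rewrite /after start_kernel_gibbs // size_cat sx leq_addl.
Qed.

(** A fixed start is encoded as a degenerate kernel, so that fixed and random starts fall under the
    same estimates. The reversal is due to histories listing the most recent spin first. *)
Definition det_start (x : seq 'I_q) := start_kernel (fun h k => (k == nth k (rev x) (size h))%:R).

Lemma nth_det (x : seq 'I_q) i (k0 k : 'I_q) : (i < size x)%N ->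
  (k == nth k (rev x) i) = (k == nth k0 (rev x) i).
Proof. by move=> ix; rewrite (set_nth_default k0) // size_rev. Qed.

Lemma stochastic_det x : size x = n -> stochastic (det_start x).
Proof.
move=> sx; apply: stochastic_start => // h hn.
have k0 : 'I_q := Ordinal (ltnW q2).
under eq_bigr do rewrite (nth_det k0) ?sx //.
by rewrite (bigD1 (nth k0 (rev x) (size h))) //= eqxx big1 ?addr0 // => k /negPf ->.
Qed.

Lemma Ex_det x t f : size x = n -> (t <= n)%N ->
  Ex (det_start x) t f = f (drop (n - t) x).
Proof.
move=> sx; elim: t f => [|t IH] f tn /=; first by rewrite subn0 -sx drop_size.
rewrite IH 1?ltnW // /step.
have k0 : 'I_q := Ordinal (ltnW q2).
have sz : size (drop (n - t) x) = t by rewrite size_drop sx subKn // ltnW.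
rewrite (bigD1 (nth k0 x (n - t.+1))) //= /det_start /start_kernel sz tn.
have E : nth k0 (rev x) t = nth k0 x (n - t.+1) by rewrite nth_rev sx.
rewrite (nth_det k0) ?sx // E eqxx mul1r big1 ?addr0; last first.
  by move=> k /negPf kk; rewrite (nth_det k0) ?sx // E kk mul0r.
rewrite (drop_nth k0 (n := n - t.+1)); last by rewrite sx ltn_subrL (leq_trans _ tn).
by rewrite -subSn.
Qed.

Lemma Ex_det_full x m f : size x = n ->
  Ex (det_start x) (n + m) f = Ex (after (gibbs n beta) x) m (fun l => f (l ++ x)).
Proof. by move=> sx; rewrite Ex_start_add Ex_det // subnn drop0. Qed.

Variables (i0 i1 : 'I_q) (i01 : i0 != i1).
Let sd := @spin_diff R q i0 i1.

Lemma det_biased x : size x = n -> biased_start beta i0 i1 1 n (det_start x).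
Proof.
move=> sx; have sK := stochastic_det sx; split=> //.
- exact: start_kernel_gibbs.
- move=> h k _; have := stochastic_le1 h k sK.
  have : 0 <= q%:R^-1 :> R by rewrite invr_ge0.
  lra.
move=> h _; rewrite mean_spin_diff //.
have := stochastic_le1 h i0 sK; have := stochastic_le1 h i1 sK.
have := sK.1 h i0; have := sK.1 h i1.
by rewrite ler_norml => *; apply/andP; split; lra.
Qed.

Definition iid_start (d : R) := start_kernel (fun _ k => q%:R^-1 + d * sd k).

Lemma sum_sd : \sum_k sd k = 0.
Proof.
rewrite /sd /spin_diff sumrB (bigD1 i0) //= eqxx big1 ?addr0; last by move=> j /negPf ->.
rewrite (bigD1 i1) //= eqxx big1 ?addr0 ?subrr //; by move=> j /negPf ->.
Qed.

Lemma sum_sd_sqr : \sum_k sd k * sd k = 2.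
Proof.
rewrite (bigD1 i0) //= (bigD1 i1) 1?eq_sym //= big1; last first.
  by move=> j /andP[/negPf j0 /negPf j1]; rewrite /sd /spin_diff j0 j1 subrr mul0r.
by rewrite /sd /spin_diff !eqxx [i1 == i0]eq_sym (negPf i01) /=; ring.
Qed.

Lemma sum_qinv : \sum_(k < q) q%:R^-1 = 1 :> R.
Proof. by rewrite sumr_const card_ord -[LHS]mulr_natr mulVf // gt_eqF. Qed.

Lemma mean_iid d h : (size h < n)%N -> mean (iid_start d) sd h = 2 * d.
Proof.
move=> hn; rewrite /mean /iid_start /start_kernel hn.
under eq_bigr do rewrite mulrDl -mulrA.
by rewrite big_split /= -!mulr_sumr sum_sd sum_sd_sqr mulr0 add0r mulrC.
Qed.

Lemma iid_biased d : 0 < d <= q%:R^-1 -> biased_start beta i0 i1 d n (iid_start d).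
Proof.
move=> /andP[d0 d1].
have sdn k : -1 <= sd k <= 1 by have := spin_diff_norm R i01 k; rewrite ler_norml.
have dsd k : - d <= d * sd k <= d.
  by have /andP[u v] := sdn k; apply/andP; split; nra.
have sK : stochastic (iid_start d).
  apply: stochastic_start => [h k _|h _]; first by have := dsd k; lra.
  by rewrite big_split /= -mulr_sumr sum_sd mulr0 addr0 sum_qinv.
split=> //.
- exact: start_kernel_gibbs.
- move=> h k hn; rewrite /iid_start /start_kernel hn; have := dsd k; lra.
- by move=> h hn; rewrite mean_iid // ger0_norm // mulr_ge0 // ltW.
Qed.

Variable gam : R.
Hypotheses (beta0 : 0 < beta) (gam0 : 0 < gam) (ag : beta / q%:R * (expR gam - 1) = gam).
Let W := weight q n beta gam.

Lemma iid_Phi d : 0 < d <= q%:R^-1 ->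
  Ex (iid_start d) n (fun h => `|Phi n beta gam i0 i1 h - 2 * d * \sum_(i < n.-1) W i|)
  <= Num.sqrt n%:R.
Proof.
move=> dP; have [sK _ _ _] := iid_biased dP.
have nR : 0 < n%:R :> R by rewrite ltr0n ltnW.
set r := Num.sqrt n%:R; have r0 : 0 < r by rewrite sqrtr_gt0.
have rr : r ^+ 2 = n%:R by rewrite sqr_sqrtr.
rewrite (@Ex_ext _ _ _ _ _ (fun h => `|compsum (iid_start d) sd W h|)); last first.
  move=> h sh; congr `|_|; rewrite /compsum sh.
  (* The history has [n] spins and [Phi] reads [n - 1]; the extra term has weight 0. *)
  transitivity (\sum_(i < n) (W i * (map sd h)`_i - 2 * d * W i)).
    rewrite sumrB [in LHS]mulr_sumr -[in RHS](prednK (ltnW n2)) !big_ord_recr /=.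
    by rewrite /W weight_out // mul0r mulr0 !addr0.
  apply: eq_bigr => i _; rewrite mean_iid ?size_drop ?sh ?ltn_subrL ?(ltnW n2) //.
  by ring.
apply: (le_trans (Ex_AMGM _ _ sK r0)).
have V : Ex (iid_start d) n (fun h => compsum (iid_start d) sd W h ^+ 2) <= r ^+ 2.
  apply: (le_trans (Ex_compsum_sqr sK _ _ (spin_diff_norm R i01))).
  rewrite rr -[leRHS](_ : \sum_(i < n) 1 = n%:R).
    apply: ler_sum => i _; have w0 := weight_ge0 n gam q2 beta0 i.
    have w1 := weight_le1 q2 n2 beta0 gam0 ag i.
    by apply: sqr_le1; rewrite (ger0_norm w0).
  by rewrite sumr_const card_ord.
have : Ex (iid_start d) n (fun h => compsum (iid_start d) sd W h ^+ 2) / r <= r.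
  by rewrite ler_pdivrMr // -expr2.
lra.
Qed.

Lemma Phi_norm_le h : `|Phi n beta gam i0 i1 h| <= n%:R.
Proof.
apply: (le_trans (ler_norm_sum _ _ _)).
apply: (@le_trans _ _ (\sum_(i < n.-1) 1)); last first.
  by rewrite sumr_const card_ord ler_nat leq_pred.
apply: ler_sum => i _; rewrite normrM ger0_norm; last exact: weight_ge0.
rewrite -[leRHS]mulr1; apply: ler_pM => //.
- exact: weight_ge0.
- exact: weight_le1.
have [ih|ih] := ltnP i (size h); last by rewrite nth_default ?normr0 // size_map.
by rewrite (nth_map i0) // spin_diff_norm.
Qed.

Lemma Phi_take h : Phi n beta gam i0 i1 (take n h) = Phi n beta gam i0 i1 h.
Proof.
apply: eq_bigr => i _; rewrite map_take nth_take //.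
by apply: leq_trans (ltn_ord i) (leq_pred n).
Qed.

Lemma decay_scan (k : nat) : decay gam n (k * n) = expR (- (gam * k%:R)).
Proof.
have nR : n%:R != 0 :> R by rewrite gt_eqF // ltr0n ltnW.
by rewrite /decay natrM; congr expR; field.
Qed.

End Starts.

(** [take n] keeps the current spin of every site; for [k = 0] this is the start itself. *)
Definition scan_avg (R : realType) q n (beta : R) (k : nat) (x : seq 'I_q)
    (F : seq 'I_q -> R) : R :=
  Ex (after (gibbs n beta) x) (k * n) (fun l => F (take n (l ++ x))).

Section ScanBounds.
Variables (R : realType) (q : nat) (beta rho gr gam : R) (i0 i1 : 'I_q).
Hypotheses (q2 : (2 <= q)%N) (beta0 : 0 < beta) (i01 : i0 != i1).
Hypothesis a_lt1 : beta / q%:R < 1.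
Hypotheses (rho01 : 0 < rho < 1) (gr0 : 0 < gr) (rg : rho * (expR gr - 1) = gr).
Hypothesis rho_contract : forall y, y < 1 - q%:R^-1 ->
  spin_prob q (beta * y) - q%:R^-1 <= rho * Num.max 0 y.
Hypotheses (gam0 : 0 < gam) (ag : beta / q%:R * (expR gam - 1) = gam).

Lemma scan_upper (A : R) : 1 <= A -> exists C : R, 0 < C /\ exists N, forall n k,
  (N <= n)%N -> (k.+2 * n)%:R <= A * (n%:R * (1 + ln n%:R)) ->
  forall x y : seq 'I_q, size x = n -> size y = n ->
  forall F : seq 'I_q -> R, (forall l, `|F l| <= 1) ->
  `|scan_avg n beta k.+1 x F - scan_avg n beta k.+1 y F|
  <= C * (Num.sqrt n%:R * expR (- (gam * k.+1%:R)) + (Num.sqrt n%:R)^-1).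
Proof.
move=> A1; have [C [C0 [N H]]] := upper_pair q2 beta0 a_lt1 rho01 gr0 rg rho_contract gam0 ag A1.
exists C; split=> //; exists (maxn N 2) => n k; rewrite geq_max => /andP[nN n2] kA x y sx sy F F1.
have E (z : seq 'I_q) : size z = n -> scan_avg n beta k.+1 z F =
   Ex (det_start n beta z) (n + k * n) (fun h => Ex (after (gibbs n beta) h) n F).
  move=> sz; rewrite Ex_det_full // /scan_avg mulSn addnC Ex_add; apply: Ex_ext => l _.
  rewrite (@Ex_kernel_ext _ _ _ (after (gibbs n beta) (l ++ z))); last first.
    by move=> l' _ j; rewrite /after catA.
  by apply: Ex_ext => l' sl'; rewrite -catA take_size_cat.
rewrite !E // -(decay_scan n2).
apply: H => //.
- exact: leq_addr.
- by apply: le_trans kA; rewrite ler_nat !mulSn -add1n leq_add2r ltnW.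
- exact: stochastic_det.
- exact: stochastic_det.
- exact: start_kernel_gibbs.
- exact: start_kernel_gibbs.
Qed.

(** The first bound takes [m0 = 0] and will be averaged over equilibrium. The second starts from
    biased independent spins, out of which [Ex_exists] extracts one configuration [x]. As [C]
    precedes [d], the bias can be chosen small relative to [C]. *)
Lemma scan_lower (A : R) : 1 <= A -> exists C : R, 0 < C /\
  (exists N, forall n k, (N <= n)%N -> (k.+2 * n)%:R <= A * (n%:R * (1 + ln n%:R)) ->
     forall y, size y = n ->
     scan_avg n beta k y (fun x => `|Phi n beta gam i0 i1 x|) <=
     (1 + C) * (n%:R * expR (- (gam * k%:R))) + C * Num.sqrt n%:R) /\
  (forall d : R, 0 < d <= q%:R^-1 -> exists N, forall n k, (N <= n)%N ->
     (k.+2 * n)%:R <= A * (n%:R * (1 + ln n%:R)) ->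
     exists2 m : R, beta / q%:R * d * n%:R / 2 <= m & exists2 x, size x = n &
     scan_avg n beta k x (fun x => `|Phi n beta gam i0 i1 x - expR (- (gam * k%:R)) * m|) <=
     C * (d ^+ 2 * (n%:R * expR (- (gam * k%:R)))) + (1 + C) * Num.sqrt n%:R).
Proof.
move=> A1; have [C [C0 H]] := lower_main q2 beta0 i01 a_lt1 rho01 gr0 rg rho_contract gam0 ag A1.
exists C; split=> //.
have dk n k : (2 <= n)%N -> decay gam n (n + k * n) <= expR (- (gam * k%:R)).
  move=> n2; rewrite -mulSn (decay_scan n2) ler_expR lerN2 ler_pM2l // ler_nat //.
have tA n k : (1 <= n)%N -> (k.+2 * n)%:R <= A * (n%:R * (1 + ln n%:R)) ->
    (n + k * n).+1%:R <= A * (n%:R * (1 + ln n%:R)).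
  by move=> n1; apply: le_trans; rewrite ler_nat !mulSn -add1n leq_add2r.
split=> [|d dP].
  have d0P : 0 < (1 : R) <= 1 by rewrite ltr01 lexx.
  have [N HN] := H 1 d0P.
  exists (maxn N 2) => n k; rewrite geq_max => /andP[nN n2] kA y sy.
  have := HN n (n + k * n)%N nN (leq_addr _ _) (tA _ _ (ltnW n2) kA) _
    (det_biased beta q2 i0 i1 sy) 0.
  rewrite Ex_det_full // Ex_det // addKn (decay_scan n2) expr1n mul1r.
  set e := expR _ => HH.
  have e0 : 0 <= e := expR_ge0 _.
  rewrite /scan_avg; apply: (@le_trans _ _ (Ex (after (gibbs n beta) y) (k * n)
     (fun l => `|Phi n beta gam i0 i1 (l ++ y) - e * 0|))).
    rewrite le_eqVlt; apply/orP; left; apply/eqP; apply: Ex_ext => l _.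
    by rewrite Phi_take mulr0 subr0.
  apply: (le_trans HH).
  have X : e * `|Phi n beta gam i0 i1 (drop (n - n) y) - 0| <= e * n%:R.
    by rewrite ler_wpM2l // subr0; apply: Phi_norm_le.
  have Y : C * (n%:R * decay gam n (n + k * n)) <= C * (n%:R * e).
    by rewrite ler_pM2l // ler_wpM2l // dk.
  lra.
have /andP[d0 d1] := dP.
have q1 : q%:R^-1 <= 1 :> R by rewrite invf_le1 ?ler1n ?ltr0n ltnW.
have d0P : 0 < d <= 1 by rewrite d0 (le_trans d1).
have [N HN] := H d d0P.
exists (maxn N 2) => n k; rewrite geq_max => /andP[nN n2] kA.
pose m : R := 2 * d * \sum_(i < n.-1) weight q n beta gam i.
exists m.
  have := sum_weight_ge q2 n2 beta0 gam0.
  have d2 : 0 <= 2 * d by rewrite mulr_ge0 // ltW.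
  by move=> /(ler_wpM2l d2); rewrite /m; lra.
have sB := iid_biased n beta q2 i01 dP.
have [sK _ _ _] := sB.
have HH := HN n (n + k * n)%N nN (leq_addr _ _) (tA _ _ (ltnW n2) kA) _ sB m.
have HI := iid_Phi q2 n2 i01 beta0 gam0 ag dP.
rewrite addKn (decay_scan n2) in HH; set e := expR _ in HH *.
have e0 : 0 <= e := expR_ge0 _.
have e1 : e <= 1 by rewrite /e -[leRHS]expR0 ler_expR oppr_le0 mulr_ge0 // ltW.
set B := C * _ + _; set r := Num.sqrt n%:R in HH HI B *.
have r0 : 0 <= r by exact: sqrtr_ge0.
have {}HH : Ex (iid_start n beta i0 i1 d) (n + k * n) (fun h => `|Phi n beta gam i0 i1 h - e * m|) <= B.
  apply: (le_trans HH).
  have X := ler_wpM2l e0 HI; rewrite -/m in X.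
  have Y : C * (d ^+ 2 * (n%:R * decay gam n (n + k * n))) <= C * (d ^+ 2 * (n%:R * e)).
    by rewrite ler_pM2l // ler_wpM2l ?sqr_ge0 // ler_wpM2l // dk.
  have Z : e * r <= r by rewrite ler_piMl.
  rewrite /B; lra.
rewrite Ex_start_add in HH.
(* The sign is changed because [Ex_exists] finds a value above the mean, and a small error is
   wanted. *)
have HN' : - B <= Ex (iid_start n beta i0 i1 d) n (fun x => - Ex (after (gibbs n beta) x) (k * n)
     (fun l => `|Phi n beta gam i0 i1 (l ++ x) - e * m|)).
  under Ex_ext => h _ do rewrite -mulN1r.
  by rewrite ExZ mulN1r lerN2.
have [x sx] := Ex_exists sK HN'; rewrite lerN2 => Hx.
exists x => //; apply: le_trans Hx; rewrite le_eqVlt; apply/orP; left; apply/eqP.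
by apply: Ex_ext => l _; rewrite Phi_take.
Qed.

End ScanBounds.

(** * From histories to the scan matrix *)

Section MatrixAction.
Variables (R : realType) (T : finType).
Implicit Types (A B : 'M[R]_#|T|) (F : T -> R).

Definition act A F (x : T) : R := \sum_y mx_kernel A x y * F y.

Lemma act1 F x : act 1 F x = F x.
Proof.
rewrite /act (bigD1 x) //= big1 ?addr0 => [|y yx].
  by rewrite /mx_kernel mxE eqxx mul1r.
by rewrite /mx_kernel mxE (inj_eq enum_rank_inj) eq_sym (negPf yx) mul0r.
Qed.

Lemma act_mul A B F x : act (A * B) F x = act A (act B F) x.
Proof.
rewrite /act; under [RHS]eq_bigr do rewrite mulr_sumr.
rewrite exchange_big /=; apply: eq_bigr => y _.
under [RHS]eq_bigr do rewrite mulrA.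
rewrite -mulr_suml; congr (_ * _).
rewrite /mx_kernel -mulmxE mxE (reindex (@enum_rank T)) //=.
by exists enum_val => i _; rewrite ?enum_rankK ?enum_valK.
Qed.

Lemma act_kernel K F x : act (kernel_mx K) F x = \sum_y K x y * F y.
Proof. by apply: eq_bigr => y _; rewrite /mx_kernel mxE !enum_rankK. Qed.

End MatrixAction.

Section SiteUpdate.
Variables (R : realType) (n q : nat) (beta : R).
Hypothesis q0 : (0 < q)%N.
Implicit Types (s r : config n q) (v : 'I_n) (k : 'I_q) (F : config n q -> R).

Definition upd s v k : config n q := [ffun u => if u == v then k else s u].

Lemma upd_same s v k : upd s v k v = k.
Proof. by rewrite ffunE eqxx. Qed.

Lemma upd_upd s v k k' : upd (upd s v k) v k' = upd s v k'.
Proof. by apply/ffunP => u; rewrite !ffunE; case: eqP. Qed.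

Lemma upd_id s v : upd s v (s v) = s.
Proof. by apply/ffunP => u; rewrite !ffunE; case: eqP => // ->. Qed.

Lemma agree_offP v s r : (r \in agree_off v s) = (r == upd s v (r v)).
Proof.
rewrite inE; apply/forallP/eqP => [H|-> u].
  apply/ffunP => u; rewrite ffunE; case: eqVneq => [->//|uv].
  by have := H u; rewrite uv => /eqP.
by rewrite ffunE; case: (u == v) => /=.
Qed.

Lemma sum_agree v s F : \sum_(r in agree_off v s) F r = \sum_k F (upd s v k).
Proof.
rewrite (reindex_onto (upd s v) (fun r => r v)) /=; last first.
  by move=> r; rewrite agree_offP => /eqP.
by apply: eq_bigl => k; rewrite agree_offP upd_same !eqxx.
Qed.

Definition energy s : R := \sum_(u < n) \sum_(v < n | (u < v)%N) (s u == s v)%:R.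

Definition nbr v s k : R := \sum_(u | u != v) (s u == k)%:R.

Lemma energyE v s : energy s =
  \sum_(u < n | u != v) \sum_(w < n | (u < w)%N && (w != v)) (s u == s w)%:R + nbr v s (s v).
Proof.
rewrite /energy (bigD1 v) //= addrC.
under eq_bigr => u uv.
  rewrite (bigID (fun w => w == v)) /=.
over.
rewrite big_split /= addrAC addrC; congr (_ + _).
rewrite /nbr [RHS](bigID (fun u : 'I_n => (u < v)%N)) /=; congr (_ + _).
  rewrite [RHS]big_mkcondr /=; apply: eq_bigr => u uv.
  case: ifP => h.
    rewrite (bigD1 v) /= ?h ?eqxx // big1 ?addr0 // => w /andP[/andP[_ /eqP ->]].
    by rewrite eqxx.
  by rewrite big1 // => w /andP[uw /eqP wv]; rewrite -wv uw in h.
apply: eq_big => [w|w _]; last by rewrite eq_sym.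
rewrite -leqNgt andbC; case: eqVneq => [->|wv]; first by rewrite ltnn andbF.
by rewrite andbT ltn_neqAle eq_sym -(inj_eq val_inj) in wv *; rewrite wv.
Qed.

Lemma nbr_upd v s k j : nbr v (upd s v k) j = nbr v s j.
Proof. by apply: eq_bigr => u uv; rewrite ffunE (negPf uv). Qed.

(** Only the pairs containing [v] see the new spin; the remaining energy [c] and the partition
    function cancel in the quotient. *)
Lemma potts_upd v s k :
  potts beta (upd s v k) / (\sum_j potts beta (upd s v j)) =
  softmax (fun k => beta / n%:R * nbr v s k) k.
Proof.
pose c : R := \sum_(u < n | u != v) \sum_(w < n | (u < w)%N && (w != v)) (s u == s w)%:R.
have E j : potts_weight beta (upd s v j) = expR (beta / n%:R * nbr v s j + beta / n%:R * c).
  rewrite /potts_weight -/(energy (upd s v j)) (energyE v) upd_same nbr_upd.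
  rewrite -mulrDr addrC; congr (expR (_ * (_ + _))).
  apply: eq_bigr => u uv; apply: eq_bigr => w /andP[_ wv].
  by rewrite !ffunE (negPf uv) (negPf wv).
rewrite -(softmax_shift _ (beta / n%:R * c)) /softmax /potts -mulr_suml.
have Z0 : potts_Z n q beta != 0.
  rewrite gt_eqF // /potts_Z (bigD1 s) //= ltr_pwDl ?expR_gt0 //.
  by apply: sumr_ge0 => r _; exact: expR_ge0.
rewrite -mulf_div divff // ?invr_neq0 // mulr1 E.
by under eq_bigr do rewrite E.
Qed.

Lemma site_update_act v s F :
  \sum_r site_update beta v s r * F r =
  \sum_k softmax (fun k => beta / n%:R * nbr v s k) k * F (upd s v k).
Proof.
rewrite (eq_bigr (fun r => if r \in agree_off v s then
   cond_prob (potts beta) [set r' : config n q | r' v == r v] (agree_off v s) * F r else 0)); last first.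
  by move=> r _; rewrite /site_update; case: ifP; rewrite ?mul0r.
rewrite -big_mkcond sum_agree; apply: eq_bigr => k _; congr (_ * _).
rewrite /cond_prob /prob sum_agree -potts_upd; congr (_ / _).
rewrite (_ : _ :&: _ = [set upd s v k])%SET ?big_set1 //.
apply/finset.setP => r; rewrite finset.in_setI agree_offP finset.inE upd_same finset.in_set1.
apply/andP/eqP => [[/eqP e /eqP rk]|->]; first by rewrite rk e.
by rewrite upd_same !eqxx.
Qed.

Lemma potts_sum1 : \sum_(s : config n q) potts beta s = 1.
Proof.
rewrite /potts -mulr_suml mulfV // gt_eqF //.
have k0 : 'I_q := Ordinal q0; pose s0 : config n q := [ffun=> k0].
rewrite /potts_Z (bigD1 s0) //= ltr_pwDl ?expR_gt0 //.
by apply: sumr_ge0 => r _; exact: expR_ge0.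
Qed.

Lemma potts_gt0 s : 0 < potts beta s.
Proof.
rewrite divr_gt0 ?expR_gt0 // /potts_Z (bigD1 s) //= ltr_pwDl ?expR_gt0 //.
by apply: sumr_ge0 => r _; exact: expR_ge0.
Qed.

(* The involution [(s, k) |-> (upd s v k, s v)] expresses reversibility. *)
Lemma site_update_stationary v F :
  \sum_s potts beta s * (\sum_r site_update beta v s r * F r) =
  \sum_s potts beta s * F s.
Proof.
under eq_bigr do rewrite site_update_act mulr_sumr.
rewrite pair_big /=.
rewrite (reindex_inj (h := fun x : config n q * 'I_q => (upd x.1 v x.2, x.1 v))) /=; last first.
  apply: (can_inj (g := fun x => (upd x.1 v x.2, x.1 v))) => -[s k] /=.
  by rewrite upd_upd upd_id upd_same.
rewrite -(pair_big xpredT xpredT (fun s k => potts beta (upd s v k) *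
  (softmax (fun j => beta / n%:R * nbr v (upd s v k) j) (s v) * F (upd (upd s v k) v (s v))))) /=.
apply: eq_bigr => s _.
have S0 : \sum_j potts beta (upd s v j) != 0.
  rewrite gt_eqF // (bigD1 (s v)) //= ltr_pwDl ?potts_gt0 //.
  by apply: sumr_ge0 => j _; exact/ltW/potts_gt0.
transitivity (\sum_k potts beta (upd s v k) * (potts beta s / (\sum_j potts beta (upd s v j)) * F s)).
  apply: eq_bigr => k _; rewrite upd_upd upd_id.
  rewrite -potts_upd upd_upd upd_id.
  by under [X in _ * (_ / X * _)]eq_bigr do rewrite upd_upd.
by rewrite -mulr_suml; field.
Qed.

End SiteUpdate.

Section Scan.
Variables (R : realType) (n q : nat) (beta : R) (o : 'S_n) (x0 : 'I_q).
Hypotheses (q2 : (2 <= q)%N) (n2 : (2 <= n)%N).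

Let n0 : (0 < n)%N. Proof. exact: ltnW. Qed.
Let q0 : (0 < q)%N. Proof. exact: ltnW. Qed.

Definition site (t : nat) : 'I_n := o (Ordinal (ltn_pmod t n0)).

(** The number of updates made after the latest update of [v], hence the index of its spin in the
    history. The start counts as a scan that has just ended. *)
Definition age (t : nat) (v : 'I_n) : nat := (t + n.-1 - (o^-1)%g v) %% n.

Definition dec (t : nat) (h : seq 'I_q) : config n q := [ffun v => nth x0 h (age t v)].

Definition hist (s : config n q) : seq 'I_q := rev [seq s (o i) | i <- enum 'I_n].

Lemma age_lt t v : (age t v < n)%N.
Proof. exact: ltn_pmod. Qed.

Lemma invo_le v : ((o^-1)%g v <= n.-1)%N.
Proof. by rewrite -ltnS prednK // ltn_ord. Qed.

Lemma siteP t v : (v == site t) = ((o^-1)%g v == (t %% n)%N :> nat).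
Proof.
rewrite /site; apply/eqP/eqP => [->|E]; first by rewrite permK.
by rewrite -[v](permKV o); congr (o _); exact: val_inj.
Qed.

Lemma age_succ t v : age t.+1 v = if v == site t then 0%N else (age t v).+1.
Proof.
rewrite /age siteP; set j := (o^-1)%g v.
have jn : (j <= t + n.-1)%N by rewrite (leq_trans (invo_le v)) // leq_addl.
rewrite addSn subSn // modnS -subSn // -addnS prednK //.
rewrite -eqn_mod_dvd; last by rewrite (leq_trans (ltnW (ltn_ord j))) // leq_addl.
by rewrite modnDr [(j %% n)%N]modn_small // eq_sym.
Qed.

(** The site about to be updated holds the oldest spin of the configuration, exactly the one that
    [cnt] omits. *)
Lemma age_site t : age t (site t) = n.-1.
Proof.
have := age_succ t (site t); rewrite eqxx /age.
set j := (o^-1)%g _.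
have jn : (j <= t + n.-1)%N by rewrite (leq_trans (invo_le _)) // leq_addl.
rewrite addSn subSn // modnS; case: ifP => // d _.
set m := (_ - _)%N in d *.
have : (m.+1 %% n = 0)%N by apply/eqP.
have lm := ltn_pmod m n0.
move=> E; apply/eqP; rewrite eqn_leq -ltnS prednK // lm /= leqNgt; apply/negP => lt.
move: E; rewrite -addn1 -modnDml addn1 modn_small //.
by rewrite -[X in (_ < X)%N](prednK n0) ltnS.
Qed.

Lemma age_inj t : injective (fun v => Ordinal (age_lt t v)).
Proof.
move=> u v /(congr1 val) /=; rewrite /age => E.
apply: (@perm_inj _ (o^-1)%g); apply: val_inj => /=.
set i := (o^-1)%g u in E *; set j := (o^-1)%g v in E *.
have ile : (i <= t + n.-1)%N by rewrite (leq_trans (invo_le _)) // leq_addl.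
have jle : (j <= t + n.-1)%N by rewrite (leq_trans (invo_le _)) // leq_addl.
have : (i + (t + n.-1 - i) = j + (t + n.-1 - i) %[mod n])%N.
  by rewrite subnKC // -[in RHS]modnDmr E modnDmr subnKC.
by move/eqP; rewrite eqn_modDr !modn_small // => /eqP.
Qed.

Lemma dec_cons t k h : dec t.+1 (k :: h) = upd (dec t h) (site t) k.
Proof.
by apply/ffunP => v; rewrite !ffunE age_succ; case: eqP.
Qed.

Lemma dec_take t h : dec t (take n h) = dec t h.
Proof. by apply/ffunP => v; rewrite !ffunE nth_take // age_lt. Qed.

Lemma dec_period k : dec (k * n) =1 dec 0.
Proof.
move=> h; apply/ffunP => v; rewrite !ffunE /age add0n -addnBA ?invo_le //.
by rewrite modnMDl.
Qed.

Lemma size_hist s : size (hist s) = n.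
Proof. by rewrite size_rev size_map size_enum_ord. Qed.

Lemma nth_hist s (i : 'I_n) : nth x0 (hist s) (n.-1 - i) = s (o i).
Proof.
have ni : (n.-1 - i < n)%N by rewrite -[X in (_ < X)%N](prednK n0) ltnS leq_subr.
rewrite /hist nth_rev size_map size_enum_ord //.
have -> : (n - (n.-1 - i).+1 = i)%N.
  by rewrite -subn1 -subnDA -subSn ?subn1 //; have := ltn_ord i; lia.
by rewrite (nth_map i) ?size_enum_ord // nth_ord_enum.
Qed.

Lemma dec_hist s : dec 0 (hist s) = s.
Proof.
apply/ffunP => v; rewrite ffunE /age add0n modn_small; last first.
  by rewrite -[X in (_ < X)%N](prednK n0) ltnS leq_subr.
by rewrite nth_hist permKV.
Qed.

Lemma hist_dec h : size h = n -> hist (dec 0 h) = h.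
Proof.
move=> sh; apply: (@eq_from_nth _ x0); rewrite ?size_hist ?sh // => i ni.
have ni' : (i <= n.-1)%N by rewrite -ltnS prednK.
have lt : (n.-1 - i < n)%N by rewrite -[X in (_ < X)%N](prednK n0) ltnS leq_subr.
have := nth_hist (dec 0 h) (Ordinal lt); rewrite /= subKn // => ->.
rewrite ffunE /age permK /= add0n subKn // modn_small //.
Qed.

Lemma cnt_nbr t h k : (n <= size h)%N ->
  (cnt n h k)%:R = nbr R (site t) (dec t h) k.
Proof.
move=> nh; pose G (i : nat) : R := (nth x0 h i == k)%:R.
have -> : nbr R (site t) (dec t h) k = \sum_(i : 'I_n | i != n.-1 :> nat) G i.
  rewrite (reindex_inj (@age_inj t)) /=; apply: eq_big => [v|v _]; last by rewrite ffunE.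
  rewrite -(age_site t); apply/idP/idP; apply: contraNN => /eqP.
    by move=> E; apply/eqP; apply: (@age_inj t); exact: val_inj.
  by move=> ->.
have -> : \sum_(i : 'I_n | i != n.-1 :> nat) G i = \sum_(i < n.-1) G i.
  have H m : \sum_(i : 'I_m.+1 | i != m :> nat) G i = \sum_(i < m) G i.
    rewrite big_mkcond big_ord_recr /= eqxx addr0; apply: eq_bigr => i _.
    by rewrite neq_ltn ltn_ord.
  by have := H n.-1; rewrite (prednK n0).
rewrite cnt_sum (big_nth x0) size_take.
rewrite (_ : (if _ then _ else _) = n.-1); last first.
  by case: ltngtP (leq_trans (leq_pred n) nh).
by rewrite big_mkord; apply: eq_bigr => i _; rewrite /G nth_take.
Qed.

Definition scan_step (t : nat) : 'M[R]_#|config n q| :=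
  kernel_mx (site_update beta (site t)).

(** The order of the sites enters only through [dec] and [hist]: the law of a new spin depends on
    counts alone, so all orders share one history process and all bounds are uniform in [o]. *)
Lemma act_steps m F s :
  act (\prod_(0 <= t < m) scan_step t) F s =
  Ex (after (gibbs n beta) (hist s)) m (fun l => F (dec m (l ++ hist s))).
Proof.
elim: m F => [|m IH] F; first by rewrite big_nil act1 /= dec_hist.
rewrite big_nat_recr //= act_mul IH; apply: Ex_ext => l _.
rewrite /scan_step act_kernel site_update_act /step; apply: eq_bigr => k _.
rewrite dec_cons; congr (_ * _); rewrite /after /gibbs; apply: eq_softmax => j.
by rewrite -(@cnt_nbr m) // size_cat size_hist leq_addl.
Qed.

Lemma scan_mxE k : scan_mx q beta o ^+ k = \prod_(0 <= t < k * n) scan_step t.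
Proof.
elim: k => [|k IH]; first by rewrite expr0 big_nil.
rewrite exprSr IH mulSn addnC [RHS](@big_cat_nat _ _ _ (k * n)) ?leq_addr //=; congr (_ * _).
rewrite -{1}[(k * n)%N]add0n big_addn addKn big_mkord; apply: eq_bigr => i _.
rewrite /scan_step /site; congr (kernel_mx (site_update _ (o _))).
by apply: val_inj; rewrite /= addnC modnMDl modn_small.
Qed.

Lemma act_scan k F s : act (scan_mx q beta o ^+ k) F s =
  scan_avg n beta k (hist s) (fun h => F (dec 0 h)).
Proof.
rewrite scan_mxE act_steps; apply: Ex_ext => l _.
by rewrite dec_period dec_take.
Qed.

Lemma act_steps_stationary m F :
  \sum_s potts beta s * act (\prod_(0 <= t < m) scan_step t) F s =
  \sum_s potts beta s * F s.
Proof.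
elim: m F => [|m IH] F.
  by apply: eq_bigr => s _; rewrite big_nil act1.
rewrite big_nat_recr //=; under eq_bigr do rewrite act_mul.
rewrite IH -[RHS](site_update_stationary beta (site m)).
by apply: eq_bigr => s _; rewrite /scan_step act_kernel.
Qed.

Lemma act_scan_stationary k F :
  \sum_s potts beta s * act (scan_mx q beta o ^+ k) F s =
  \sum_s potts beta s * F s.
Proof. by rewrite scan_mxE act_steps_stationary. Qed.

End Scan.

(** * Cutoff *)

Section TotalVariation.
Variables (R : realType) (T : finType).
Implicit Types (p r F : T -> R) (P : 'M[R]_#|T|).

Lemma tv_dist_le p r (B : R) :
  (forall F, (forall x, `|F x| <= 1) -> \sum_x F x * (p x - r x) <= 2 * B) ->
  tv_dist p r <= B.
Proof.
move=> H; rewrite /tv_dist mulrC ler_pdivrMr // mulrC.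
have := H (fun x => Num.sg (p x - r x)) _.
under eq_bigr do rewrite -normrEsg.
by apply=> x; rewrite normr_sg; case: (_ != 0).
Qed.

Lemma tv_dist_ge p r F : \sum_x p x = \sum_x r x -> (forall x, 0 <= F x <= 1) ->
  \sum_x F x * (p x - r x) <= tv_dist p r.
Proof.
move=> pr F01; have E : \sum_x 2^-1 * (p x - r x) = 0 by rewrite -mulr_sumr sumrB pr subrr mulr0.
(* Equal masses allow subtracting 1/2 from [F], after which it is at most 1/2 in absolute value. *)
rewrite -[leLHS]subr0 -[X in _ - X]E -sumrB /tv_dist mulr_sumr.
apply: ler_sum => x _; rewrite -mulrBl; apply: (le_trans (ler_norm _)).
rewrite normrM ler_wpM2r //; have := F01 x.
by rewrite ler_norml => /andP[f0 f1]; apply/andP; split; lra.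
Qed.

Lemma worst_tv_le P pi t (B : R) : 0 <= B ->
  (forall x, tv_dist (mx_kernel (P ^+ t) x) pi <= B) -> worst_tv P pi t <= B.
Proof.
move=> B0 H; rewrite /worst_tv; elim/big_ind: _ => // u v uB vB.
by rewrite ge_max uB.
Qed.

Lemma worst_tv_ge P pi t x : tv_dist (mx_kernel (P ^+ t) x) pi <= worst_tv P pi t.
Proof. by rewrite /worst_tv (bigD1 x) //= le_max lexx. Qed.

Lemma mixing_timeP P pi (eps : R) t : worst_tv P pi t <= eps ->
  exists m, [/\ mixing_time P pi eps = (m%:R)%:E, (m <= t)%N & worst_tv P pi m <= eps].
Proof.
move=> ht; rewrite /mixing_time; case: pselect => [ex|[]]; last by exists t.
by case: ex_minnP => m hm min; exists m; split=> //; exact: min.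
Qed.

Lemma act_sub_stationary P pi F x : \sum_y pi y = 1 ->
  \sum_y pi y * act P F y = \sum_y pi y * F y ->
  \sum_y F y * (mx_kernel P x y - pi y) = \sum_y pi y * (act P F x - act P F y).
Proof.
move=> pi1 piP; under eq_bigr do rewrite mulrBr [F _ * _]mulrC [F _ * pi _]mulrC.
rewrite sumrB -/(act P F x) -piP; move: (act P F x) (act P F) => z g.
under [RHS]eq_bigr do rewrite mulrBr.
by rewrite sumrB -mulr_suml pi1 mul1r.
Qed.

Lemma act_sub P pi F x :
  \sum_y F y * (mx_kernel P x y - pi y) = act P F x - \sum_y pi y * F y.
Proof.
under eq_bigr do rewrite mulrBr [F _ * _]mulrC [F _ * pi _]mulrC.
by rewrite sumrB.
Qed.

Lemma average_le p (g : T -> R) (B : R) : \sum_x p x = 1 -> (forall x, 0 <= p x) ->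
  (forall x, g x <= B) -> \sum_x p x * g x <= B.
Proof.
move=> p1 p0 gB; rewrite -[leRHS]mul1r -p1 mulr_suml.
by apply: ler_sum => x _; rewrite ler_wpM2l.
Qed.

End TotalVariation.

Section Cutoff.
Variables (R : realType) (q : nat) (beta rho gr gam : R).
Hypotheses (q2 : (2 <= q)%N) (beta0 : 0 < beta).
Hypothesis a_lt1 : beta / q%:R < 1.
Hypotheses (rho01 : 0 < rho < 1) (gr0 : 0 < gr) (rg : rho * (expR gr - 1) = gr).
Hypothesis rho_contract : forall y, y < 1 - q%:R^-1 ->
  spin_prob q (beta * y) - q%:R^-1 <= rho * Num.max 0 y.
Hypotheses (gam0 : 0 < gam) (ag : beta / q%:R * (expR gam - 1) = gam).

Let qR : (0 : R) < q%:R. Proof. by rewrite ltr0n ltnW. Qed.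
Let a : R := beta / q%:R.
Let a0 : 0 < a. Proof. exact: divr_gt0. Qed.
Let c : R := (2 * gam)^-1.
Let c0 : 0 < c. Proof. by rewrite invr_gt0 mulr_gt0. Qed.
Let A : R := c + 1.
Let A1 : 1 <= A. Proof. by rewrite lerDr ltW. Qed.
Let i0 : 'I_q := Ordinal (ltnW q2).
Let i1 : 'I_q := Ordinal q2.
Let i01 : i0 != i1. Proof. by []. Qed.

(** The summand 1 in [A = c + 1] absorbs [K + 2] additional scans once [ln n >= K + 2]. *)
Lemma horizon (K : R) : exists N, forall n k, (N <= n)%N ->
  k%:R <= c * ln n%:R + K -> (k.+2 * n)%:R <= A * (n%:R * (1 + ln n%:R)).
Proof.
have [N HN] := ln_nat_unbounded (K + 2).
exists N => n k nN kK; have l := HN n nN.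
have -> : (k.+2 * n)%:R = (k%:R + 2) * n%:R :> R by rewrite natrM -natr1 -natr1; ring.
rewrite mulrCA mulrC ler_wpM2l //.
have := c0; rewrite /A; nra.
Qed.

Lemma sqrt_window n (x : R) : (0 < n)%N ->
  expR (- (gam * (c * ln n%:R + x))) = (Num.sqrt n%:R)^-1 * expR (- (gam * x)).
Proof.
move=> n0; have nR : 0 < n%:R :> R by rewrite ltr0n.
have -> : - (gam * (c * ln n%:R + x)) = - (ln n%:R / 2) + - (gam * x).
  by rewrite /c; field; rewrite gt_eqF.
rewrite expRD; congr (_ * _); rewrite expRN; congr (_^-1).
apply: (@pexpIrn _ 2); rewrite ?nnegrE ?expR_ge0 ?sqrtr_ge0 //.
rewrite sqr_sqrtr // expr2 -expRD (_ : _ + _ = ln n%:R); first by rewrite lnK.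
by field.
Qed.

Lemma worst_tv_upper (eps : R) : 0 < eps -> exists K N, forall n (o : 'S_n), (N <= n)%N ->
  exists2 t : nat, t%:R <= c * ln n%:R + K &
    worst_tv (scan_mx q beta o) (potts beta) t <= eps.
Proof.
move=> e0.
have [C [C0 [N HC]]] := scan_upper q2 beta0 a_lt1 rho01 gr0 rg rho_contract gam0 ag A1.
(* By [1 + y <= expR y] at [y = gam * K = C / eps], the decaying term is at most [eps / C]; [N2]
   ensures the same for [1 / sqrt n]. *)
pose K : R := C / eps / gam.
have K0 : 0 < K by rewrite !divr_gt0.
have [N1 H1] := horizon (K + 1).
pose N2 := (Num.bound ((C / eps) ^+ 2)).+2.
exists (K + 1), (maxn N (maxn N1 N2)) => n o; rewrite !geq_max => /and3P[nN nN1 nN2].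
have n2 : (2 <= n)%N by exact: leq_trans nN2.
have n0 : (0 < n)%N by exact: ltnW.
have nR : 0 < n%:R :> R by rewrite ltr0n.
pose r : R := Num.sqrt n%:R; have r0 : 0 < r by rewrite sqrtr_gt0.
have Cr : C / eps <= r.
  have ce0 : 0 <= C / eps by rewrite divr_ge0 // ltW.
  rewrite -[leLHS](ger0_norm ce0) -sqrtr_sqr /r ler_sqrt //.
  apply: le_trans (ltW (archi_boundP (sqr_ge0 _))) _.
  by rewrite ler_nat; apply: leq_trans nN2; rewrite /N2 ltnW // ltnW.
have y0 : 0 <= c * ln n%:R + K by apply: addr_ge0; [apply: mulr_ge0; [exact: ltW|exact: ln_nat_ge0]|exact: ltW].
pose k := Num.truncn (c * ln n%:R + K).
have /andP[k1 k2] := truncn_itv y0; rewrite -/k in k1 k2.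
have kK : k.+1%:R <= c * ln n%:R + (K + 1) by rewrite -natr1 addrA lerD2r.
exists k.+1 => //.
have kA : (k.+2 * n)%:R <= A * (n%:R * (1 + ln n%:R)).
  by apply: H1 => //; apply: le_trans kK; rewrite ler_nat.
have B : C * (r * expR (- (gam * k.+1%:R)) + r^-1) <= 2 * eps.
  have X : expR (- (gam * k.+1%:R)) <= r^-1 * expR (- (gam * K)).
    by rewrite -sqrt_window // ler_expR lerN2 ler_pM2l // ltW.
  have Y : expR (- (gam * K)) <= eps / C.
    rewrite expRN -[leRHS]invf_div lef_pV2 ?posrE ?expR_gt0 ?divr_gt0 //.
    apply: le_trans (expR_ge1Dx _); rewrite /K (_ : gam * (C / eps / gam) = C / eps).
      by rewrite lerDr.
    by field; rewrite !gt_eqF.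
  have Z : r^-1 <= eps / C by rewrite -[leRHS]invf_div lef_pV2 ?posrE ?divr_gt0.
  have W : r * expR (- (gam * k.+1%:R)) <= expR (- (gam * K)).
    by rewrite -(ler_pM2l (_ : 0 < r^-1)) ?invr_gt0 // mulKf ?gt_eqF.
  have V : r * expR (- (gam * k.+1%:R)) + r^-1 <= 2 * (eps / C) by lra.
  have := ler_wpM2l (ltW C0) V.
  by rewrite (_ : C * (2 * (eps / C)) = 2 * eps) //; field; rewrite gt_eqF.
apply: worst_tv_le; first exact: ltW.
move=> s; apply: tv_dist_le => F F1.
pose P := scan_mx q beta o ^+ k.+1.
have p1 : \sum_(t : config n q) potts beta t = 1 by apply: potts_sum1; exact: ltnW.
rewrite act_sub_stationary //; last exact: act_scan_stationary.
apply: average_le => // [t|t]; first exact/ltW/potts_gt0.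
apply: (le_trans (ler_norm _)); apply: le_trans B.
rewrite /P !(act_scan beta o i0 q2 n2).
by apply: HC => //; exact: size_hist.
Qed.

Lemma worst_tv_lower (eps : R) : 0 < eps < 1 -> exists K N, forall n (o : 'S_n), (N <= n)%N ->
  forall t : nat, t%:R < c * ln n%:R - K ->
    eps < worst_tv (scan_mx q beta o) (potts beta) t.
Proof.
move=> /andP[e0 e1].
have [C [C0 [[N1 H1] H2]]] := scan_lower q2 beta0 i01 a_lt1 rho01 gr0 rg rho_contract gam0 ag A1.
(* After Markov's inequality at distance [M / 2], the nonlinear error contributes [4 * C * d / a],
   at most a third of [1 - eps]. *)
pose d : R := Num.min q%:R^-1 (a * (1 - eps) / (12 * C)).
have e1' : 0 < 1 - eps by rewrite subr_gt0.
have iq : 0 < q%:R^-1 :> R by rewrite invr_gt0.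
have dP : 0 < d <= q%:R^-1.
  rewrite lt_min iq ge_min lexx /= andbT.
  by rewrite divr_gt0 ?mulr_gt0.
have /andP[d0 dq] := dP.
have dC : 4 * C * d / a <= (1 - eps) / 3.
  have : d <= a * (1 - eps) / (12 * C) by rewrite /d ge_min lexx orbT.
  rewrite ler_pdivlMr ?mulr_gt0 // => H.
  rewrite ler_pdivrMr //; lra.
have [N2 HN2] := H2 d dP.
(* With [M >= r * B * (a * d / 2)], the fluctuations of order [sqrt n], along the chain and at
   equilibrium together, contribute at most another third of [1 - eps]. *)
pose B : R := 4 * (2 + 3 * C) / (d * a) * 3 / (1 - eps).
have B0 : 0 < B.
  apply: divr_gt0 => //; apply: mulr_gt0 => //; apply: divr_gt0; last exact: mulr_gt0.
  by apply: mulr_gt0 => //; lra.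
pose K : R := B / gam; have K0 : 0 < K by exact: divr_gt0.
have [N3 HN3] := horizon 1.
exists K, (maxn N1 (maxn N2 (maxn N3 2))) => n o.
rewrite !geq_max => /and4P[nN1 nN2 nN3 n2] t tK.
have n0 : (0 < n)%N by exact: ltnW.
have nR : 0 < n%:R :> R by rewrite ltr0n.
pose r : R := Num.sqrt n%:R; have r0 : 0 < r by rewrite sqrtr_gt0.
have rr : r ^+ 2 = n%:R by rewrite sqr_sqrtr.
have tA : (t.+2 * n)%:R <= A * (n%:R * (1 + ln n%:R)).
  by apply: HN3 => //; lra.
have [m ma [x sx Hx]] := HN2 n t nN2 tA.
pose Ph := Phi n beta gam i0 i1.
set e := expR (- (gam * t%:R)) in Hx; have ep : 0 < e := expR_gt0 _.
pose M := e * m.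
have eK : r^-1 * expR (gam * K) <= e.
  have := sqrt_window (- K) n0; rewrite mulrN opprK => <-.
  by rewrite ler_expR lerN2 ler_pM2l // ltW.
have MB : r * B * (a * d / 2) <= M.
  have X : B <= expR (gam * K).
    apply: le_trans (expR_ge1Dx _); rewrite /K (_ : gam * (B / gam) = B).
      by rewrite lerDr.
    by field; rewrite gt_eqF.
  have X2 : r^-1 * B <= e by apply: le_trans eK; rewrite ler_pM2l ?invr_gt0.
  have ad : 0 <= a * d * n%:R / 2 by rewrite divr_ge0 // !mulr_ge0 // ltW.
  apply: (@le_trans _ _ ((r^-1 * B) * (a * d * n%:R / 2))).
    rewrite le_eqVlt; apply/orP; left; apply/eqP; rewrite -rr.
    by field; rewrite gt_eqF.
  apply: ler_pM => //; first by rewrite mulr_ge0 ?invr_ge0 ?ltW.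
have M0 : 0 < M.
  by apply: lt_le_trans MB; apply: mulr_gt0; [exact: mulr_gt0|rewrite divr_gt0 ?mulr_gt0].
have nM : n%:R * e <= 2 / (a * d) * M.
  have : a * d * n%:R / 2 * e <= M by rewrite /M mulrC ler_pM2l.
  have ad : 0 < a * d by exact: mulr_gt0.
  rewrite (_ : 2 / (a * d) * M = 2 * M / (a * d)); last by ring.
  rewrite ler_pdivlMr //; lra.
have E1 : scan_avg n beta t x (fun x => `|Ph x - M|) <= 2 * C * d / a * M + (1 + C) * r.
  apply: (le_trans Hx); rewrite lerD2r.
  have dd : 0 <= C * d ^+ 2 by rewrite mulr_ge0 ?sqr_ge0 // ltW.
  rewrite [C * (d ^+ 2 * _)]mulrA; apply: (le_trans (ler_wpM2l dd nM)).
  by rewrite le_eqVlt; apply/orP; left; apply/eqP; field; rewrite !gt_eqF.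
have p1 : \sum_(s : config n q) potts beta s = 1 by apply: potts_sum1; exact: ltnW.
pose P := scan_mx q beta o.
pose f (s : config n q) : R := `|Ph (hist o s)|.
(* By stationarity the equilibrium mean of [|Phi|] is an average, over fixed starts, of its mean
   after slightly more than [c * ln n] scans, where the first bound of [scan_lower] is of order
   [sqrt n]. *)
have E2 : \sum_s potts beta s * f s <= (1 + 2 * C) * r.
  have y0 : 0 <= c * ln n%:R by apply: mulr_ge0; [exact: ltW|exact: ln_nat_ge0].
  pose k := (Num.truncn (c * ln n%:R)).+1.
  have /andP[k1 k2] := truncn_itv y0; rewrite -/k in k2.
  have kA : (k.+2 * n)%:R <= A * (n%:R * (1 + ln n%:R)).
    by apply: HN3 => //; rewrite /k -natr1 lerD2r.
  have ek : n%:R * expR (- (gam * k%:R)) <= r.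
    have -> : r = n%:R * (r^-1 * expR (- (gam * 0))).
      by rewrite mulr0 oppr0 expR0 mulr1 -rr; field; rewrite gt_eqF.
    by rewrite -sqrt_window // ler_pM2l // ler_expR lerN2 ler_pM2l // addr0 ltW.
  rewrite -(act_scan_stationary beta o n2 k).
  apply: average_le => // [s|s]; first exact/ltW/potts_gt0.
  rewrite (act_scan beta o i0 q2 n2).
  have := H1 n k nN1 kA (hist o s) (size_hist _ _).
  have -> : scan_avg n beta k (hist o s) (fun h => f (dec o i0 0 h)) =
      scan_avg n beta k (hist o s) (fun x => `|Phi n beta gam i0 i1 x|).
    apply: Ex_ext => l _; rewrite /f hist_dec // size_takel // size_cat size_hist leq_addl //.
  move=> H; apply: (le_trans H).
  have C1 : 0 <= 1 + C by lra.
  have := ler_wpM2l C1 ek; rewrite -/r; lra.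
pose s := dec o i0 0 x.
apply: lt_le_trans (worst_tv_ge _ _ _ s).
(* The distinguishing event is [Phi >= M / 2]: Markov's inequality bounds its complement after [t]
   scans and the event itself at equilibrium. *)
pose F (u : config n q) : R := (M / 2 <= Ph (hist o u))%R%:R.
have F01 u : 0 <= F u <= 1 by rewrite /F ler0n lern1 leq_b1.
have rowsum : \sum_y mx_kernel (P ^+ t) s y = \sum_(y : config n q) potts beta y.
  rewrite p1.
  have := act_scan beta o i0 q2 n2 t (fun=> 1) s.
  rewrite /scan_avg Ex_cst; last by apply: stochastic_after; exact: stochastic_gibbs.
  by rewrite /act; under eq_bigr do rewrite mulr1.
apply: lt_le_trans (tv_dist_ge rowsum F01).
rewrite act_sub.
have G1 : 1 - act (P ^+ t) F s <= 2 / M * (2 * C * d / a * M + (1 + C) * r).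
  apply: (@le_trans _ _ (2 / M * scan_avg n beta t x (fun x => `|Ph x - M|))); last first.
    by rewrite ler_wpM2l // divr_ge0 // ltW.
  rewrite (act_scan beta o i0 q2 n2) /s hist_dec // /scan_avg.
  have sK : stochastic (after (gibbs n beta) x) by apply: stochastic_after; exact: stochastic_gibbs.
  rewrite -{1}(Ex_cst (t * n) 1 sK) -ExB -ExZ; apply: Ex_le => // l _.
  set h := take n (l ++ x).
  have sh : size h = n by rewrite size_takel // size_cat sx leq_addl.
  rewrite /F (hist_dec o i0 q2 n2 sh); case: (leP (M / 2) (Ph h)) => hM.
    by rewrite subrr; apply: mulr_ge0 => //; rewrite divr_ge0 // ltW.
  rewrite subr0 mulrC mulrA ler_pdivlMr // mul1r ltr0_norm; lra.
have G2 : \sum_u potts beta u * F u <= 2 / M * ((1 + 2 * C) * r).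
  apply: (@le_trans _ _ (2 / M * \sum_u potts beta u * f u)); last first.
    by rewrite ler_wpM2l // divr_ge0 // ltW.
  rewrite mulr_sumr; apply: ler_sum => u _; rewrite mulrCA ler_wpM2l //; first exact/ltW/potts_gt0.
  rewrite /F /f; case: (leP (M / 2) (Ph (hist o u))) => hM; last first.
    by apply: mulr_ge0 => //; rewrite divr_ge0 // ltW.
  rewrite mulrC mulrA ler_pdivlMr // mul1r; have := ler_norm (Ph (hist o u)); lra.
have G3 : 2 / M * (2 * C * d / a * M + (1 + C) * r) + 2 / M * ((1 + 2 * C) * r) =
   4 * C * d / a + 2 * (2 + 3 * C) * (r / M).
  by field; rewrite !gt_eqF.
have G4 : 2 * (2 + 3 * C) * (r / M) <= (1 - eps) / 3.
  rewrite mulrA ler_pdivrMr //.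
  have := MB; rewrite /B => H.
  have E : r * B * (a * d / 2) * ((1 - eps) / 3) = 2 * (2 + 3 * C) * r.
    by rewrite /B; field; rewrite !gt_eqF.
  rewrite -E mulrC ler_pM2l // divr_gt0 //.
lra.
Qed.

Lemma cutoff_window (eps : R) : 0 < eps < 1 -> exists K N, forall n (o : 'S_n), (N <= n)%N ->
  exists2 m : nat, scan_tmix q beta o eps = (m%:R)%:E &
    c * ln n%:R - K <= m%:R <= c * ln n%:R + K.
Proof.
move=> eP; have /andP[e0 e1] := eP.
have [K1 [N1 H1]] := worst_tv_upper e0.
have [K2 [N2 H2]] := worst_tv_lower eP.
exists (Num.max K1 K2), (maxn N1 N2) => n o; rewrite geq_max => /andP[nN1 nN2].
have [t tK ht] := H1 n o nN1.
have [m [mE mt hm]] := mixing_timeP ht.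
exists m => //; apply/andP; split.
  have K2m : K2 <= Num.max K1 K2 by rewrite le_max lexx orbT.
  rewrite leNgt; apply/negP => lt.
  have mK : m%:R < c * ln n%:R - K2 by lra.
  by have := H2 n o nN2 m mK; rewrite ltNge hm.
have K1m : K1 <= Num.max K1 K2 by rewrite le_max lexx.
have : m%:R <= t%:R :> R by rewrite ler_nat.
lra.
Qed.

End Cutoff.

Local Open Scope classical_set_scope.

Theorem theorem1 (R : realType) (q : nat) (beta : R) (hq : (2 <= q)%N)
    (hbeta : 0 < beta < beta_s R q) :
  exists2 c : R, 0 < c &
    (forall eps : R, 0 < eps < 1 ->
       exists kappa : R, \forall n \near \oo, forall o : 'S_n,
         ((c * ln n%:R - kappa)%:E <= scan_tmix q beta o eps)%E /\
         (scan_tmix q beta o eps <= (c * ln n%:R + kappa)%:E)%E)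
    /\
    (forall (o : forall n : nat, 'S_n) (eps : R), 0 < eps < 1 ->
       (fun n : nat => fine (scan_tmix q beta (o n) eps)
                       - fine (scan_tmix q beta (o n) (1 - eps)))
         =o_\oo (fun n : nat => fine (scan_tmix q beta (o n) 4^-1))).
Proof.
have [a1 [rho rho01 contract]] := spin_prob_contract hq hbeta.
have /andP[beta0 _] := hbeta.
have q0 : (0 : R) < q%:R by rewrite ltr0n ltnW.
have [gr gr0 rg] := gamma_exists rho01.
have a01 : 0 < beta / q%:R < 1 by rewrite divr_gt0.
have [gam gam0 ag] := gamma_exists a01.
have H := cutoff_window hq beta0 a1 rho01 gr0 rg contract gam0 ag.
set c := (2 * gam)^-1 in H.
have c0 : 0 < c by rewrite invr_gt0 mulr_gt0.
exists c => //; split=> [eps epsP|o eps epsP].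
  have [K [N HN]] := H eps epsP.
  exists K; exists N => // n nN o.
  have [m -> /andP[m1 m2]] := HN n o nN.
  by rewrite !lee_fin.
have epsP' : 0 < 1 - eps < 1 by move: epsP => /andP[? ?]; apply/andP; split; lra.
have quarter : 0 < (4^-1 : R) < 1 by rewrite invr_gt0 ltr0n invf_lt1 ?ltr1n.
have [K1 [N1 H1]] := H _ epsP; have [K2 [N2 H2]] := H _ epsP'.
have [K3 [N3 H3]] := H _ quarter.
apply/eqoP => e e0.
(* Both mixing times lie within a constant of the same [c * ln n], so they differ by at most
   [K1 + K2]. This threshold makes [c * ln n - K3], a lower bound for the mixing time at 1/4, at
   least [(K1 + K2) / e]. *)
have [N4 H4] := ln_nat_unbounded (((K1 + K2) / e + K3) / c).
exists (maxn (maxn N1 N2) (maxn N3 N4)) => // n.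
rewrite /= !geq_max => /andP[/andP[nN1 nN2] /andP[nN3 nN4]].
have [m1 -> /andP[l1 u1]] := H1 n (o n) nN1.
have [m2 -> /andP[l2 u2]] := H2 n (o n) nN2.
have [m3 -> /andP[l3 u3]] := H3 n (o n) nN3.
rewrite /= [`|m3%:R|]ger0_norm //.
apply: (@le_trans _ _ (K1 + K2)).
  by rewrite ler_norml; apply/andP; split; lra.
have := H4 n nN4; rewrite ler_pdivrMr // => L.
have X : (K1 + K2) / e <= m3%:R by lra.
by move: X; rewrite ler_pdivrMr // mulrC.
Qed.
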